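(* Let $n\ge3$ and set $X_n:=\mathbb CP^n/\mathbb CP^{n-2}$. Then $$X_n\simeq\begin{cases}\mathbb S^{2n-2}\vee\mathbb S^{2n},&\text{if } n\text{ is odd},\\ \Sigma^{2n-4}\mathbb CP^2,&\text{if } n\text{ is even}.\end{cases}$$ In particular, $\mathbb CP^n/\mathbb CP^{n-2}\not\simeq\mathbb S^{2n-2}\vee\mathbb S^{2n}$ for $n$ even.
   Context: $\simeq$ denotes homotopy equivalence, $\Sigma^k$ the $k$-fold (reduced) suspension, and $\mathbb CP^n/\mathbb CP^{n-2}$ the quotient of $\mathbb CP^n$ by its standard subcomplex $\mathbb CP^{n-2}$. *)

(* Defs.v *)
From HB Require Import structures.
From mathcomp Require Import all_boot all_order all_algebra generic_quotient.
From mathcomp Require Import complex.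
From mathcomp Require Import all_classical all_reals topology normedtype.
From mathcomp Require Import wedge_sigT.

Set Implicit Arguments.
Unset Strict Implicit.
Unset Printing Implicit Defensive.

Import Order.TTheory GRing.Theory Num.Theory.
Import numFieldNormedType.Exports.

Local Open Scope classical_set_scope.
Local Open Scope ring_scope.
Local Open Scope quotient_scope.

Section unit_interval.
Context (R : realType).

Definition unit_interval : Type := set_type ([set` `[0%R, 1%R]] : set R).
HB.instance Definition _ := Topological.on unit_interval.

Lemma unit_interval0_subproof : (0 : R) \in ([set` `[0%R, 1%R]] : set R).
Proof. by apply/mem_set; rewrite /= in_itv /= lexx ler01. Qed.

Lemma unit_interval1_subproof : (1 : R) \in ([set` `[0%R, 1%R]] : set R).
Proof. by apply/mem_set; rewrite /= in_itv /= lexx ler01. Qed.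

Definition I0 : unit_interval := exist _ 0 unit_interval0_subproof.
Definition I1 : unit_interval := exist _ 1 unit_interval1_subproof.

End unit_interval.
Arguments I0 {R}.
Arguments I1 {R}.

Section homotopy.
Context (R : realType).

Definition homotopic (X Y : topologicalType) (f g : X -> Y) : Prop :=
  exists H : X * unit_interval R -> Y,
    [/\ continuous H, forall x, H (x, I0) = f x & forall x, H (x, I1) = g x].

(* Homotopies are free, i.e. not required to preserve base points. *)
Definition homotopy_equivalent (X Y : topologicalType) : Prop :=
  exists (f : X -> Y) (g : Y -> X),
    [/\ continuous f, continuous g,
        homotopic (g \o f) id & homotopic (f \o g) id].

End homotopy.

(* The quotient space X / A; for empty A this is X itself, not X with a       *)
(* disjoint base point added.                                                 *)
Section collapse.
Context (X : topologicalType) (A : set X).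

Let collapse_rel' (x y : X) : bool := (x == y) || ((x \in A) && (y \in A)).

Lemma collapse_rel_refl : reflexive collapse_rel'.
Proof. by move=> x; rewrite /collapse_rel' eqxx. Qed.

Lemma collapse_rel_sym : symmetric collapse_rel'.
Proof. by move=> x y; rewrite /collapse_rel' eq_sym andbC. Qed.

Lemma collapse_rel_trans : transitive collapse_rel'.
Proof.
move=> y x z; rewrite /collapse_rel'.
case/predU1P => [-> //|/andP[xA yA]].
by case/predU1P => [<-|/andP[_ zA]]; rewrite ?xA ?yA ?zA orbT.
Qed.

Definition collapse_rel :=
  EquivRel _ collapse_rel_refl collapse_rel_sym collapse_rel_trans.

Definition collapse : Type := quotient_topology {eq_quot collapse_rel}.
HB.instance Definition _ := Topological.on collapse.
HB.instance Definition _ := Quotient.on collapse.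

End collapse.

Section suspension.
Context (R : realType).

Definition susp_collapsed (X : ptopologicalType) :
    set (X * unit_interval R) :=
  [set p | [\/ p.2 = I0, p.2 = I1 | p.1 = point]].

Definition susp (X : ptopologicalType) : Type := collapse (@susp_collapsed X).
HB.instance Definition _ X := Topological.on (susp X).
HB.instance Definition _ X := Quotient.on (susp X).
HB.instance Definition _ X :=
  isPointed.Build (susp X) (\pi_(susp X) (point, I0)).

Definition iter_susp (k : nat) (X : ptopologicalType) : ptopologicalType :=
  iter k (fun Y : ptopologicalType => susp Y : ptopologicalType) X.

End suspension.

Definition wedge2 (X Y : ptopologicalType) : Type :=
  pwedge (fun b : bool => if b then X else Y).
HB.instance Definition _ X Y := Topological.on (wedge2 X Y).
HB.instance Definition _ X Y := Pointed.on (wedge2 X Y).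

Section sphere.
Context (R : realType) (k : nat).

(* The norm of the library on 'rV[R]_k.+1 is the sup norm, whence the sum of  *)
(* squares.                                                                   *)
Definition sphere_set : set 'rV[R]_k.+1 := [set x | \sum_i x 0 i ^+ 2 = 1].

Definition sphere : Type := set_type sphere_set.
HB.instance Definition _ := Topological.on sphere.

Lemma sphere_point_subproof : delta_mx 0 0 \in sphere_set.
Proof.
apply/mem_set; rewrite /sphere_set /= (bigD1 ord0) //= mxE !eqxx expr1n.
rewrite big1 ?addr0// => i i0.
by rewrite mxE (negbTE i0) andbF expr0n.
Qed.

HB.instance Definition _ :=
  isPointed.Build sphere
    (exist (fun x => x \in sphere_set) _ sphere_point_subproof).

End sphere.

Section complex_projective_space.
Context (R : realType) (n : nat).

(* R[i]^o is R[i] with the topology of its modulus.                           *)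
Definition nonzero_vec : set 'rV[R[i]^o]_n.+1 := [set z | z != 0].

Let CP_rel' (z w : nonzero_vec) : bool :=
  `[< exists2 c : R[i], c != 0 & set_val w = c *: set_val z >].

Lemma CP_rel_refl : reflexive CP_rel'.
Proof. by move=> z; apply/asboolP; exists 1; rewrite ?oner_neq0 ?scale1r. Qed.

Lemma CP_rel_sym : symmetric CP_rel'.
Proof.
suff sub z w : CP_rel' z w -> CP_rel' w z by move=> z w; apply/idP/idP; exact: sub.
move=> /asboolP[c c0 E]; apply/asboolP; exists c^-1; first by rewrite invr_eq0.
by rewrite E scalerA mulVf ?scale1r.
Qed.

Lemma CP_rel_trans : transitive CP_rel'.
Proof.
move=> w z v /asboolP[c c0 E] /asboolP[d d0 F]; apply/asboolP.
by exists (d * c); rewrite ?mulf_neq0// F E scalerA.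
Qed.

Definition CP_rel := EquivRel _ CP_rel_refl CP_rel_sym CP_rel_trans.

Definition CP : Type := quotient_topology {eq_quot CP_rel}.
HB.instance Definition _ := Topological.on CP.
HB.instance Definition _ := Quotient.on CP.

Lemma CP_point_subproof : delta_mx 0 0 \in nonzero_vec.
Proof.
apply/mem_set => /=; apply/eqP => /matrixP/(_ 0 0).
by rewrite !mxE eqxx => /eqP; rewrite oner_eq0.
Qed.

HB.instance Definition _ :=
  isPointed.Build CP
    (\pi_CP (exist (fun z => z \in nonzero_vec) _ CP_point_subproof)).

(* The standard CP^m in CP^n: the points [z_0 : ... : z_m : 0 : ... : 0].     *)
Definition CP_sub (m : nat) : set CP :=
  \pi_CP @` [set z : nonzero_vec |
    forall i : 'I_n.+1, (m < i)%N -> (set_val z) 0 i = 0].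

End complex_projective_space.

(* Main.v *)
(* CP^n / CP^(n-2) is the Thom space of n-1 copies of the dual tautological   *)
(* bundle over CP^1, and two copies of that bundle are trivialized by the      *)
(* quaternionic structure j on C^2. For n even all but one copy can be removed *)
(* in pairs, which leaves the Thom space CP^2 of one copy, suspended 2n-4      *)
(* times: both spaces are quotients of CP^2 times a cube by the same           *)
(* identifications, and they are compact Hausdorff. For n odd the bundle is    *)
(* trivial, so that the quotient is S^(2n-2) with a 2n-cell attached by a map  *)
(* that extends radially over the disc and can be deformed to a constant.      *)
(*                                                                             *)
(* For the last claim, Sq^2 on mod 2 Alexander-Spanier cohomology is computed  *)
(* with Steenrod's cup-i products on arbitrary cochains: it vanishes on the    *)
(* wedge, whose summands have no cohomology in the relevant degrees, and is    *)
(* nonzero on every suspension of CP^2 because it commutes with suspension and *)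
(* the first Chern class of CP^2 has nonzero square.                           *)

From HB Require Import structures.
From Stdlib Require Btauto.
Require Import Defs.
From mathcomp Require Import all_boot all_order all_algebra generic_quotient.
From mathcomp Require Import all_classical all_reals topology normedtype.
From mathcomp Require Import ring lra complex realfun trigo wedge_sigT.

Set Implicit Arguments.
Unset Strict Implicit.
Unset Printing Implicit Defensive.
Import Order.TTheory GRing.Theory Num.Theory.
Import numFieldNormedType.Exports.
Local Open Scope classical_set_scope.
Local Open Scope ring_scope.
Local Notation Re := complex.Re.
Local Notation Im := complex.Im.

(** * Modulo 2 Alexander-Spanier cochains *)

(** Put $n=N+2$. Off $\mathbb CP^N$ the last two coordinates of a point of $\mathbb CP^{N+2}$ define
    $(w_0:w_1)\in\mathbb CP^1$, and the other $N+1$ coordinates form a vector in $N+1$ copies of a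
    line bundle over $\mathbb CP^1$; the quotient is the Thom space. The map $a\mapsto w_0a+w_1j(a)$
    ([quat]) is complex linear in $(w_0,w_1)$, real linear in $a$, and invertible by the quaternion
    identity [quat_inv], so it trivializes the copies in pairs. The vectors [tvec] write points of
    $\mathbb CP^{N+2}$ in the trivialized coordinates.

    For $N$ even one copy is left over, with Thom space $\mathbb CP^2$. [twist_param] and [suspc]
    present $X_n$ and $\Sigma^{2N}\mathbb CP^2$ as quotients of $\mathbb CP^2$ times a $2N$-cube
    with the same identifications. Compactness and Hausdorffness then give a homeomorphism
    ([same_kernel_homeo], [even_homeomorphism]); Hausdorffness comes from explicit injections into
    normed spaces ([embeds]).

    For $N$ odd everything is trivialized. With $m=2N+2$, [projective_two_cells] exhibits $X_n$ as
    $\mathbb S^m$, a cube modulo its boundary, with an $(m+2)$-cube attached by projection to the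
    last $m$ coordinates. Multiplying that projection by $e\in[0,1]$ deforms the attaching map to a
    constant, and [two_cells_homotopy_equivalent] shows that the homotopy type does not depend on
    $e$. At $e=0$ the space is the wedge ([wedge_two_cells]).

    For the last claim, let $u$ be a cocycle of degree $k+2$ on $\Sigma^k\mathbb CP^2$; $Sq^2$ of
    its class is represented by $u\cup_k u$. On the wedge such squares are exact
    ([cobound_cup_wedge_spheres]). Exactness on a suspension implies exactness one suspension lower
    ([cobound_cup_susp]), which leaves $k=0$: the square of the first Chern class of $\mathbb CP^2$
    is nonzero ([chern_square_neq0]). There, a Mayer-Vietoris zigzag over the three charts
    ([cup_square_on_triple]) turns exactness of the square into exactness of a product of two
    winding classes on the torus $|z_0|=|z_1|=|z_2|$, which is refuted by integrating along two
    loops. *)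

Lemma addb_xorb a b : addb a b = xorb a b. Proof. by case: a; case: b. Qed.
Ltac btauto := rewrite ?addb_xorb; Btauto.btauto.

Section cochains.
Context {T : Type}.
Implicit Types (a b c : seq T -> bool) (s l : seq T) (A B : set T).

(** A cochain takes tuples of all lengths at once. Length [p] means degree [p - 1], and the empty
    tuple carries the augmentation, so the resulting cohomology is reduced. *)
Fixpoint cod c s : bool :=
  if s is x :: s' then c s' (+) cod (fun l => c (x :: l)) s' else false.

(** The vertices are dealt to [a] and [b] in consecutive blocks that share their end vertices, with
    [k] changes of hand, summed over all ways to do so. At a change the shared vertex goes to both
    cochains and the arguments trade places, so that the first one is always the one being fed. *)
Fixpoint cup (k : nat) a b s : bool :=
  match s with
  | [::] => [&& k == 0%N, a [::] & b [::]]
  | x :: s' => cup k (fun l => a (x :: l)) b s' (+)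
      match k with
      | 0 => false
      | k'.+1 => cup k' (fun l => b (x :: l)) (fun l => a (x :: l)) s'
      end
  end.

Definition cup_pred k a b s : bool := if k is k'.+1 then cup k' a b s else false.

Fixpoint allin A s : Prop := if s is x :: s' then A x /\ allin A s' else True.

Lemma allin_sub A B s : A `<=` B -> allin A s -> allin B s.
Proof. by move=> AB; elim: s => //= x s IH [/AB ? /IH]. Qed.

Lemma allinI A B s : allin (A `&` B) s <-> allin A s /\ allin B s.
Proof. by elim: s => //= x s [IH1 IH2]; split; [case=> -[? ?] /IH1 [] | case=> -[? ?] [? ?]; split=> //; exact: IH2]. Qed.

Lemma eq_cod A c c' s : (forall l, allin A l -> c l = c' l) -> allin A s ->
  cod c s = cod c' s.
Proof.
elim: s c c' => //= x s IH c c' E [Ax As]; rewrite E//; congr (_ (+) _).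
by apply: IH => // l Al; apply: E.
Qed.

Lemma eq_codT c c' : c =1 c' -> cod c =1 cod c'.
Proof. by move=> E s; apply: (@eq_cod setT) => //; elim: s. Qed.

Lemma cod0 s : cod (fun _ => false) s = false.
Proof. by elim: s. Qed.

Lemma codD a b s : cod (fun l => a l (+) b l) s = cod a s (+) cod b s.
Proof.
elim: s a b => //= x s IH a b; rewrite IH.
by case: (a s); case: (b s); case: (cod _ s); case: (cod _ s).
Qed.

Lemma cod_cod c s : cod (cod c) s = false.
Proof.
elim: s c => //= x s IH c; rewrite codD IH addbF.
by case: (cod c s).
Qed.

Lemma eq_cup k A a a' b b' s : (forall l, allin A l -> a l = a' l) ->
  (forall l, allin A l -> b l = b' l) -> allin A s -> cup k a b s = cup k a' b' s.
Proof.
elim: s k a a' b b' => [|x s IH] k a a' b b' Ea Eb //=; first by rewrite Ea// Eb.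
move=> [Ax As]; congr (_ (+) _); last case: k => // k; apply: IH => // l Al.
all: by [apply: Ea|apply: Eb].
Qed.

Lemma cup0l k b s : cup k (fun _ => false) b s = false.
Proof.
(* The arguments trade places in the recursion, so both vanishing statements go through one
   induction. *)
suff: cup k (fun _ => false) b s = false /\ cup k b (fun _ => false) s = false by case.
elim: s k b => [|x s IH] k b /=; first by rewrite !andbF.
rewrite (IH k b).1 (IH k (fun l => b (x :: l))).2.
by case: k => // k; rewrite (IH k _).1 (IH k _).2.
Qed.

Lemma cup0r k b s : cup k b (fun _ => false) s = false.
Proof.
elim: s k b => [|x s IH] k b /=; first by rewrite !andbF.
by rewrite IH; case: k => // k; rewrite cup0l.
Qed.

Lemma cupDlr k a a' b s :
  (cup k (fun l => a l (+) a' l) b s = cup k a b s (+) cup k a' b s) *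
  (cup k b (fun l => a l (+) a' l) s = cup k b a s (+) cup k b a' s).
Proof.
elim: s k a a' b => [|x s IH] k a a' b /=.
  by case: eqP => //=; case: (a _); case: (a' _); case: (b _).
rewrite !IH; case: k => [|k]; first by rewrite !addbF.
rewrite !IH; split;
by case: (cup _ _ _ _); case: (cup _ _ _ _); case: (cup _ _ _ _);
  case: (cup _ _ _ _).
Qed.

Lemma cupDl k a a' b s :
  cup k (fun l => a l (+) a' l) b s = cup k a b s (+) cup k a' b s.
Proof. exact: (cupDlr k a a' b s).1. Qed.

Lemma cupDr k a a' b s :
  cup k b (fun l => a l (+) a' l) s = cup k b a s (+) cup k b a' s.
Proof. exact: (cupDlr k a a' b s).2. Qed.

Lemma cup_codxl k a b x s : cup k (fun l => cod a (x :: l)) b s =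
  cup k a b s (+) cup k (cod (fun l => a (x :: l))) b s.
Proof. exact: cupDl. Qed.

Lemma cup_codxr k a b x s : cup k b (fun l => cod a (x :: l)) s =
  cup k b a s (+) cup k b (cod (fun l => a (x :: l))) s.
Proof. exact: cupDr. Qed.

(* Steenrod's coboundary formula; the shifted indexing makes [cup k.+1] the   *)
(* usual cup-k product, so that [cup 1] is the ordinary cup product.          *)
Lemma cod_cup k a b s : cod (cup k a b) s =
  cup k (cod a) b s (+) cup k a (cod b) s (+)
  (cup_pred k a b s (+) cup_pred k b a s).
Proof.
elim: s k a b => [|x s IH] k a b.
  by case: k => [|[|k]] //=; rewrite /= ?andbF //=; case: (a _); case: (b _).
case: k => [|k] /=.
  under eq_codT do rewrite addbF.
  rewrite IH /= !addbF cup_codxl.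
  btauto.
rewrite codD !IH !cup_codxl !cup_codxr /=.
by case: k => [|k] /=; btauto.
Qed.

(** By [cod_cup], the coboundaries of [cup k c c] and of [cup k.+1 c (cod c)] have the same cross
    terms, which cancel modulo 2. Hence the square of a coboundary is exact, with a primitive built
    from the square one step lower: this is how squares commute with suspension. *)
Lemma cod_square k c s :
  cup k.+1 (cod c) (cod c) s = cod (fun l => cup k c c l (+) cup k.+1 c (cod c) l) s.
Proof.
rewrite codD !cod_cup /= addbb addbF.
rewrite (_ : cod (cod c) = fun _ => false); last first.
  by apply: funext => l; rewrite cod_cod.
by rewrite cup0r; btauto.
Qed.

Definition homog p c := forall s, size s != p -> c s = false.
Definition proj p c : seq T -> bool := fun s => if size s == p then c s else false.

Lemma homog_proj p c : homog p (proj p c).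
Proof. by move=> s /negbTE sp; rewrite /proj sp. Qed.

Lemma cod_proj p c s : cod (proj p c) s = proj p.+1 (cod c) s.
Proof.
elim: s p c => [|x s IH] p c /=; first by rewrite /proj.
rewrite /proj /= eqSS -/(proj p c s); case: p => [|p].
  rewrite (eq_codT (c' := fun _ => false)) ?cod0 ?addbF //.
  by case: s {IH} => //= *; rewrite addbF.
have -> : cod (fun l => if size (x :: l) == p.+1 then c (x :: l) else false) s
   = proj p.+1 (cod (fun l => c (x :: l))) s by rewrite -IH.
by rewrite /proj; case: eqP.
Qed.

Lemma homog_cod p c : homog p c -> homog p.+1 (cod c).
Proof.
move=> hc s sp; rewrite (eq_codT (c' := proj p c)); last first.
  by move=> l; rewrite /proj; case: eqP => // /eqP /hc.
by rewrite cod_proj homog_proj.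
Qed.

Lemma homog_sub p c x : homog p.+1 c -> homog p (fun l => c (x :: l)).
Proof. by move=> h s sp; apply: h. Qed.

Lemma homogD p a b : homog p a -> homog p b -> homog p (fun s => a s (+) b s).
Proof. by move=> ha hb s sp; rewrite ha// hb. Qed.

(** Each change of hand uses one vertex twice, so [size s + k] vertices are dealt out in all. *)
Lemma cup_size k p q a b s : homog p a -> homog q b ->
  (size s + k)%N != (p + q)%N -> cup k a b s = false.
Proof.
elim: s k p q a b => [|x s IH] k p q a b ha hb /=.
  case: k => //= ; case: p ha => [|p] ha; last by rewrite ha.
  by case: q hb => [|q] hb //; rewrite (hb [::])// andbF.
have z r c : homog r c -> r = 0%N -> (fun l => c (x :: l)) = (fun _ => false).
  by move=> h r0; apply: funext => l; rewrite h// r0.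
case: p ha => [|p] ha E.
  by rewrite (z 0%N a)// cup0l; case: k {E} => // k; exact: cup0r.
rewrite (IH k p q) //; last exact: homog_sub.
case: k E => // k E /=; case: q hb E => [|q] hb E.
  by rewrite (z 0%N b)// cup0l.
apply: (IH k q p); [exact: homog_sub..|].
by move: E; rewrite !addSn !addnS !eqSS (addnC q).
Qed.

Lemma homog_cup k p q r a b : homog p a -> homog q b -> (p + q = r + k)%N ->
  homog r (cup k a b).
Proof.
by move=> ha hb E s sr; apply: (cup_size ha hb); rewrite E eqn_add2r.
Qed.

End cochains.
Arguments cod {T} c !s /.
Arguments cup {T} k a b !s /.

Lemma allin_map (X Y : Type) (f : X -> Y) (B : set Y) s :
  allin B (map f s) <-> allin (f @^-1` B) s.
Proof. by elim: s => //= x s [IH1 IH2]; split=> -[? ?]; split=> //; [exact: IH1|exact: IH2]. Qed.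

(** Stated with neighbourhoods in the whole of [X], which is the form in which locally vanishing
    cochains on [A] are pulled back. *)
Definition cont_on (X Y : topologicalType) (A : set X) (f : X -> Y) :=
  forall x, A x -> forall V, nbhs (f x) V -> nbhs x [set y | A y -> V (f y)].

Lemma cont_onP (X Y : topologicalType) (A : set X) (f : X -> Y) :
  cont_on A f <-> {within A, continuous f}.
Proof.
split=> [cf|/subspace_continuousP cf x Ax V Vf]; last exact: cf.
by apply/subspace_continuousP => x Ax V Vf; apply: cf.
Qed.

Lemma cont_on_at (X Y : topologicalType) (A : set X) (f : X -> Y) :
  (forall x, A x -> {for x, continuous f}) -> cont_on A f.
Proof. move=> cf x Ax V Vx; have : nbhs x (f @^-1` V) := cf x Ax V Vx.
by apply: filterS => y ? _. Qed.

Lemma continuous_cont_on (X Y : topologicalType) (A : set X) (f : X -> Y) :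
  continuous f -> cont_on A f.
Proof. by move=> cf; apply: cont_on_at => x _; exact: cf. Qed.

Lemma cont_on_comp (X Y Z : topologicalType) (A : set X) (B : set Y)
    (f : X -> Y) (g : Y -> Z) : cont_on A f -> cont_on B g ->
  (forall x, A x -> B (f x)) -> cont_on A (g \o f).
Proof.
move=> cf cg AB x Ax V Vx; have := cf _ Ax _ (cg _ (AB _ Ax) _ Vx).
by apply: filterS => y h Ay; apply: h => //; exact: AB.
Qed.

Lemma eq_cont_on (X Y : topologicalType) (A : set X) (f g : X -> Y) :
  (forall x, A x -> f x = g x) -> cont_on A f -> cont_on A g.
Proof.
move=> E cf x Ax V; rewrite -E// => /(cf _ Ax); apply: filterS => y h Ay.
by rewrite -E//; exact: h.
Qed.

(** * Locally zero cochains and exactness modulo them *)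

Section local_zero.
Context {X : topologicalType}.
Implicit Types (A B : set X) (a b c : seq X -> bool).

(** Alexander-Spanier cohomology is taken modulo these cochains. One neighbourhood serves tuples of
    every length, the empty one included, so that [c [::]] is false as soon as [A] has a point. *)
Definition lz A c := forall x, A x ->
  exists2 U, nbhs x U & forall s, allin (U `&` A) s -> c s = false.

Lemma lz2 A a b c : (forall U s, (forall l, allin U l -> a l = false) ->
    (forall l, allin U l -> b l = false) -> allin U s -> c s = false) ->
  lz A a -> lz A b -> lz A c.
Proof.
move=> h la lb x Ax; have [U Ux Ua] := la x Ax; have [V Vx Vb] := lb x Ax.
exists (U `&` V); first exact: filterI.
move=> s; apply: h => l hl; [apply: Ua|apply: Vb]; apply: allin_sub hl => y [[? ?] ?] //.
Qed.

Lemma lz1 A a c : (forall U s, (forall l, allin U l -> a l = false) ->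
    allin U s -> c s = false) -> lz A a -> lz A c.
Proof. by move=> h la; apply: (lz2 (a := a) (b := a)) => // U s + _; exact: h. Qed.

Lemma eq_lz A a b : (forall s, allin A s -> a s = b s) -> lz A a -> lz A b.
Proof.
move=> E la x Ax; have [U Ux Ua] := la x Ax; exists U => // s Us.
by rewrite -E ?Ua//; apply: allin_sub Us => y [].
Qed.

Lemma eq_lzT A a b : a =1 b -> lz A a -> lz A b.
Proof. by move=> E; apply: eq_lz. Qed.

Lemma lz0 A : lz A (fun _ => false).
Proof. by move=> x Ax; exists setT => //; exact: filterT. Qed.

Lemma lzD A a b : lz A a -> lz A b -> lz A (fun s => a s (+) b s).
Proof. by apply: lz2 => U s ha hb Us; rewrite ha// hb. Qed.

Lemma lz_cod A c : lz A c -> lz A (cod c).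
Proof. by apply: lz1 => U s h Us; rewrite (eq_cod h Us) cod0. Qed.

Lemma lz_cupl k A a b : lz A a -> lz A (cup k a b).
Proof.
by apply: lz1 => U s h Us; rewrite (eq_cup _ h (fun _ _ => erefl) Us) cup0l.
Qed.

Lemma lz_cupr k A a b : lz A b -> lz A (cup k a b).
Proof.
by apply: lz1 => U s h Us; rewrite (eq_cup _ (fun _ _ => erefl) h Us) cup0r.
Qed.

Lemma lz_proj p A c : lz A c -> lz A (proj p c).
Proof. by apply: lz1 => U s h Us; rewrite /proj h// if_same. Qed.

Lemma lz_sub A B c : A `<=` B -> lz B c -> lz A c.
Proof.
move=> AB lc x /AB /lc [U Ux Uc]; exists U => // s Us; apply: Uc.
by apply: allin_sub Us => y [? /AB].
Qed.

Definition cobound A c := exists b, lz A (fun s => c s (+) cod b s).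

(** Vanishing of the reduced cohomology of [A] in degree [p - 1]. *)
Definition acyc A p := forall c, homog p c -> lz A (cod c) -> cobound A c.

Lemma cobound_homog p A c : homog p.+1 c -> cobound A c ->
  exists2 b, homog p b & lz A (fun s => c s (+) cod b s).
Proof.
move=> hc [b hb]; exists (proj p b); first exact: homog_proj.
apply: eq_lzT (lz_proj p.+1 hb) => s; rewrite cod_proj /proj.
by case: eqP => // /eqP /hc ->.
Qed.

End local_zero.

Lemma lz_pull (X Y : topologicalType) (A : set X) (B : set Y) (f : X -> Y) c :
  cont_on A f -> (forall x, A x -> B (f x)) -> lz B c -> lz A (c \o map f).
Proof.
move=> cf AB lc x Ax; have [V Vfx Vc] := lc _ (AB _ Ax).
exists [set y | A y -> V (f y)]; first exact: cf Vfx.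
move=> s hs /=; apply: Vc; apply/allin_map; apply: allin_sub hs => y [/= Vy Ay].
by split; [exact: Vy|exact: AB].
Qed.

Lemma cod_map (X Y : Type) (f : X -> Y) c s : cod c (map f s) = cod (c \o map f) s.
Proof. by elim: s c => //= x s IH c; rewrite IH. Qed.

Lemma cup_map (X Y : Type) (f : X -> Y) k a b s :
  cup k a b (map f s) = cup k (a \o map f) (b \o map f) s.
Proof. by elim: s k a b => //= x s IH k a b; rewrite IH; case: k => //= k; rewrite IH. Qed.

Lemma homog_map (X Y : Type) (f : X -> Y) p c : homog p c -> homog p (c \o map f).
Proof. by move=> h s sp; rewrite /= h// size_map. Qed.

(** * The prism operator and homotopy invariance *)

Section prism.
Context {X Y : Type}.

Fixpoint prism (f g : X -> Y) (c : seq Y -> bool) (s : seq X) : bool :=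
  if s is x :: s' then c (f x :: map g s) (+) prism f g (fun l => c (f x :: l)) s'
  else false.

Lemma prismD f g a b s :
  prism f g (fun l => a l (+) b l) s = prism f g a s (+) prism f g b s.
Proof. by elim: s a b => //= x s IH a b; rewrite IH; btauto. Qed.

Lemma cod_prism f g c s :
  cod (prism f g c) s (+) prism f g (cod c) s = c (map f s) (+) c (map g s).
Proof.
elim: s c => [|x s IH] c /=; first by rewrite addbb.
rewrite codD (prismD f g c (cod (fun l => c (f x :: l)))).
have -> : cod (prism f g (fun l => c (f x :: l))) s =
    c (f x :: map f s) (+) c (f x :: map g s) (+)
    prism f g (cod (fun l => c (f x :: l))) s.
  by have /= <- := IH (fun l => c (f x :: l)); rewrite -addbA addbb addbF.
have -> : cod (fun l => c (f x :: g x :: map g l)) s =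
    cod (fun l => c (f x :: g x :: l)) (map g s) by rewrite cod_map.
btauto.
Qed.

Lemma eq_prism (B : set Y) f g c c' s : (forall l, allin B l -> c l = c' l) ->
  allin B (map f s) -> allin B (map g s) -> prism f g c s = prism f g c' s.
Proof.
elim: s c c' => //= x s IH c c' E [fx fs] [gx gs]; rewrite E//; congr (_ (+) _).
by apply: IH => // l Bl; apply: E.
Qed.

Lemma prism0 f g s : prism f g (fun _ => false) s = false.
Proof. by elim: s. Qed.

End prism.

Section homotopy_invariance.
Context {R : realType} {X : topologicalType}.

Definition cylinder (A : set X) : set (X * R) := A `*` [set` `[0%R, 1%R]].

(** A prism is controlled only when its two levels are close together. Compactness of the cylinder
    gives one mesh that is fine enough everywhere, and the homotopy is the sum of the prisms between
    consecutive levels [k / N]. *)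
Lemma cochain_homotopy (A : set X) (c : seq (X * R) -> bool) : compact A ->
  lz (cylinder A) (cod c) ->
  exists2 h : seq X -> bool, h [::] = false &
    lz A (fun s => c (map (fun x => (x, 0)) s) (+) c (map (fun x => (x, 1)) s) (+) cod h s).
Proof.
move=> cA lc.
pose P (d : R) (z : X * R) := exists2 U, nbhs z.1 U & forall s,
  allin [set w : X * R | [/\ U w.1, A w.1, w.2 \in `[0, 1] & `|w.2 - z.2| <= d]] s ->
  cod c s = false.
(* A Lebesgue number for the interval direction: some [d > 0] is small enough at every point of the
   compact cylinder. *)
have : \forall d \near 0^'+, cylinder A `<=` P d.
  have cAI : compact (cylinder A).
    by apply: compact_setX => //; exact: segment_compact.
  apply: ((compact_near_coveringP _).1 cAI) => -[x t] Axt.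
  have [W [[U V] /= [Ux Vt] UV] hs] := lc _ Axt.
  have [e /= e0 eV] := (nbhs_ballP _ _).1 Vt.
  exists (interior U `*` ball t (e / 2), [set d : R | d < e / 2]).
    split; last by apply: nbhs_right_lt; lra.
    exists (interior U, ball t (e / 2)) => //; split => /=.
      exact: (nbhs_interior Ux).
    by apply: nbhsx_ballx; lra.
  move=> [[x' t'] d] /= [[Ux' tt'] de].
  exists U => //= s hs'; apply: hs; apply: allin_sub hs' => -[w v] /= [Uw Aw vI vd].
  split; last by split.
  apply: UV; split => //=; apply: eV; rewrite /ball /= in tt' *.
  have -> : t - v = (t - t') + (t' - v) by lra.
  have := ler_normD (t - t') (t' - v); rewrite (distrC t' v); lra.
move=> Pd; have [d [d0 hd]] : exists d, 0 < d /\ cylinder A `<=` P d.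
  near (0:R)^'+ => d; exists d; split; last exact: (near Pd d).
  by near: d; exact: nbhs_right_gt.
(* Chosen so that consecutive levels differ by [1 / N <= d]. *)
pose N := (Num.truncn d^-1).+1.
have N0 : 0 < N%:R :> R by [].
have Nd : N%:R^-1 <= d.
  by rewrite -[d]invrK lef_pV2 ?posrE ?invr_gt0 //; apply/ltW; rewrite truncnS_gt.
pose i_ (k : nat) (x : X) := (x, k%:R / N%:R : R).
pose h s := \big[addb/false]_(k < N) prism (i_ k) (i_ k.+1) c s.
(* The prism identities telescope: the inner levels cancel modulo 2. *)
have hE m s : \big[addb/false]_(k < m) prism (i_ k) (i_ k.+1) (cod c) s =
    c (map (i_ 0%N) s) (+) c (map (i_ m) s) (+)
    cod (fun s => \big[addb/false]_(k < m) prism (i_ k) (i_ k.+1) c s) s.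
  elim: m => [|m IH].
    rewrite big_ord0 addbb (eq_codT (c' := fun _ => false)) ?cod0 //.
    by move=> l; rewrite big_ord0.
  rewrite big_ord_recr /= IH.
  rewrite (_ : (fun s => \big[addb/false]_(k < m.+1) prism (i_ k) (i_ k.+1) c s) =
     fun s => \big[addb/false]_(k < m) prism (i_ k) (i_ k.+1) c s
       (+) prism (i_ m) (i_ m.+1) c s); last first.
    by apply: funext => l; rewrite big_ord_recr.
  rewrite codD.
  have -> : prism (i_ m) (i_ m.+1) (cod c) s = c (map (i_ m) s) (+)
    c (map (i_ m.+1) s) (+) cod (prism (i_ m) (i_ m.+1) c) s.
    by rewrite -cod_prism addbC addbA addbb addFb.
  btauto.
exists h; first by rewrite /h big1.
have E0 : (fun x : X => (x, 0 : R)) = i_ 0%N by apply: funext => x; rewrite /i_ mul0r.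
have E1 : (fun x : X => (x, 1 : R)) = i_ N.
  by apply: funext => x; rewrite /i_ divff// pnatr_eq0.
suff : lz A (fun s => \big[addb/false]_(k < N) prism (i_ k) (i_ k.+1) (cod c) s).
  by apply: eq_lzT => s; rewrite hE E0 E1.
move=> x Ax.
have kI (k : nat) : (k <= N)%N -> (k%:R / N%:R : R) \in `[0, 1].
  by move=> kN; rewrite in_itv /= divr_ge0 //= ler_pdivrMr // mul1r ler_nat.
have /all_sig2 [U Ux hU] (k : 'I_N) : {U | nbhs x U & forall s,
    allin [set w : X * R | [/\ U w.1, A w.1, w.2 \in `[0, 1] & `|w.2 - k%:R / N%:R| <= d]] s ->
    cod c s = false}.
  by apply: cid2; apply: (hd (x, k%:R / N%:R)); split => //=; exact/kI/ltnW.
exists [set y | forall k, U k y]; first exact: filter_forall.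
move=> s hs; apply: big1 => k _.
have kk : `|(k%:R : R) / N%:R - k.+1%:R / N%:R| <= d.
  rewrite -mulrBl -natr1 opprD addrA subrr add0r mulN1r normrN.
  by rewrite ger0_norm // invr_ge0.
rewrite -[RHS](prism0 (i_ k) (i_ k.+1) s).
apply: (@eq_prism _ _ [set w : X * R | [/\ U k w.1, A w.1, w.2 \in `[0, 1] &
  `|w.2 - k%:R / N%:R| <= d]]).
- exact: hU.
- apply/allin_map; apply: allin_sub hs => y [Uy Ay].
  by split; [exact: Uy | | exact/kI/ltnW | rewrite subrr normr0 ltW].
- apply/allin_map; apply: allin_sub hs => y [Uy Ay].
  by split; [exact: Uy | | exact: kI | rewrite distrC].
Unshelve. all: by end_near. Qed.
End homotopy_invariance.

Lemma pair_continuousl (X Y : topologicalType) (y : Y) :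
  continuous (fun x : X => (x, y)).
Proof.
move=> x W [[U V] /= [Ux Vy] UV]; apply: filterS Ux => z Uz.
by apply: UV; split => //; exact: nbhs_singleton.
Qed.

(** * Cones, deformations and Mayer-Vietoris *)

Section acyclicity.
Context {R : realType}.

(** Expanding [cod c] on [x :: s] gives [c s] plus the coboundary of the cone over [x], and the
    total vanishes. *)
Lemma cone_cocycle (T : Type) (U : set T) (c : seq T -> bool) x : U x ->
  (forall s, allin U s -> cod c s = false) ->
  forall s, allin U s -> c s = cod (fun l => c (x :: l)) s.
Proof.
move=> Ux h s Us; have /= := h (x :: s) (conj Ux Us).
by case: (c s); case: (cod _ _).
Qed.

Lemma acyc_point (X : topologicalType) (x : X) p : acyc [set x] p.
Proof.
move=> c _ lc; exists (fun l => c (x :: l)) => y /= ->.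
have [U Ux Uc] := lc x erefl; exists U => // s Us.
have /= E := @cone_cocycle _ (U `&` [set x]) c x.
by rewrite -E ?addbb//; split => //; exact: nbhs_singleton.
Qed.

Lemma acyc_set0 (X : topologicalType) p : acyc (@set0 X) p.
Proof. by move=> c _ _; exists c => x. Qed.

(** On a one-vertex tuple [cod c] takes the value [c [::]], so one point of [A] suffices to kill the
    augmentation. *)
Lemma acyc_nonempty (X : topologicalType) (A : set X) : A !=set0 -> acyc A 0.
Proof.
move=> [x Ax] c hc lc; exists (fun _ => false); apply: (eq_lzT (a := fun=> false)); last exact: lz0.
case=> [|y s] /=; last by rewrite hc // cod0.
have [U Ux Uc] := lc x Ax; have := Uc [:: x]; rewrite /= addbF => -> //.
by do 2 split => //; exact: nbhs_singleton.
Qed.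

(** The cohomology of a retract injects: pull back to [B] along [g], find a primitive there, and
    return along [f]. *)
Lemma acyc_transfer (X Y : topologicalType) (A : set X) (B : set Y)
    (f : X -> Y) (g : Y -> X) p :
  cont_on A f -> (forall x, A x -> B (f x)) ->
  cont_on B g -> (forall x, B x -> A (g x)) ->
  (forall x, A x -> g (f x) = x) -> acyc B p -> acyc A p.
Proof.
move=> cf AB cg BA fK aB c hc lc.
have [|b hb] := aB (c \o map g) (homog_map g hc).
  by apply: eq_lzT (lz_pull cg BA lc) => s /=; rewrite cod_map.
exists (b \o map f); apply: eq_lz (lz_pull cf AB hb) => s As /=.
rewrite -!cod_map -map_comp; congr (c _ (+) _).
by elim: s As => //= x s IH [Ax /IH ->]; rewrite fK.
Qed.

(** The end map of [H] factors through the acyclic [B], which makes the pullback of [c] along it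
    exact; the homotopy carries this back to [c] itself. *)
Lemma acyc_deform (X : topologicalType) (A B : set X) (H : X * R -> X) p :
  compact A -> B `<=` A -> cont_on (cylinder A) H ->
  (forall z, cylinder A z -> A (H z)) ->
  (forall x, A x -> H (x, 0) = x) -> (forall x, A x -> B (H (x, 1))) ->
  acyc B p -> acyc A p.
Proof.
move=> cA BA cH HA H0 H1 aB c hc lc.
have [b hb] := aB c hc (lz_sub BA lc).
have := @cochain_homotopy R _ A (c \o map H) cA.
have l1 : lz (cylinder A) (cod (c \o map H)).
  by apply: eq_lzT (lz_pull cH HA lc) => s /=; rewrite cod_map.
case=> // h _ lh.
have cH1 : cont_on A (fun x => H (x, 1)).
  apply: (@cont_on_comp _ _ _ _ _ (fun x : X => (x, 1:R)) _ _ cH) => [|x Ax].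
    exact/continuous_cont_on/pair_continuousl.
  by split => //=; rewrite in_itv /= ler01 lexx.
exists (fun s => h s (+) b (map (fun x => H (x, 1)) s)).
have lb := lz_pull cH1 H1 hb.
apply: eq_lz (lzD lh lb) => s As /=.
rewrite -!map_comp codD -[cod (fun l => b _) s]/(cod (b \o map _) s) -cod_map.
have -> : [seq (H \o (fun x => (x, 0))) i | i <- s] = s.
  by elim: s As => //= x s IH [Ax /IH ->]; rewrite H0.
have xorK (u v w z : bool) : ((u (+) v) (+) w) (+) (v (+) z) = u (+) (w (+) z) by btauto.
exact: xorK.
Qed.

(** Mayer-Vietoris. Primitives [a] on [A] and [b] on [B] differ on the intersection by some [cod e],
    and correcting [b] by [cod e] glues them. The covering condition says that small tuples lie
    entirely in one of the two sets. *)
Lemma acyc_union (X : topologicalType) (A B : set X) p :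
  closed A -> closed B ->
  (forall x, (A `|` B) x ->
     exists2 U, nbhs x U & (U `&` (A `|` B) `<=` A \/ U `&` (A `|` B) `<=` B)) ->
  (p = 0%N -> A `&` B !=set0) ->
  acyc A p.+1 -> acyc B p.+1 -> acyc (A `&` B) p -> acyc (A `|` B) p.+1.
Proof.
move=> clA clB cov ne aA aB aAB c hc lc.
have [a ha la] := cobound_homog hc (aA c hc (lz_sub (@subsetUl _ A B) lc)).
have [b hb lb] := cobound_homog hc (aB c hc (lz_sub (@subsetUr _ A B) lc)).
have lab : lz (A `&` B) (cod (fun s => a s (+) b s)).
  apply: eq_lzT (lzD (lz_sub (@subIsetl _ A B) la) (lz_sub (@subIsetr _ A B) lb)) => s /=.
  by rewrite codD; btauto.
have [e he] := aAB _ (homogD ha hb) lab.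
(* Tuples contained in neither set are never small, so the value chosen on them is harmless. *)
pose g s := if `[< allin A s >] then a s else b s (+) cod e s.
have gA s : allin A s -> g s = a s by move=> /asboolP As; rewrite /g As.
exists g => x Cx; have [U Ux UC] := cov x Cx.
(* For [p = 0] the two primitives live on the empty tuple and are compared at a point of the
   intersection; for larger [p] both vanish there by homogeneity. *)
have E0 : a [::] = b [::].
  case: p {la lb} hc ne ha hb aA aB aAB => [|p] hc ne ha hb aA aB aAB.
    have [//|y ABy] := ne; have [V Vy /(_ [::])] := he y ABy.
    by rewrite /= addbF; case: (a [::]); case: (b [::]) => // /(_ I).
  by rewrite ha// hb.
case: UC => UC.
  have Ax : A x by apply: UC; split => //; exact: nbhs_singleton.
  have [V Vx Vc] := la x Ax; exists (U `&` V); first exact: filterI.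
  move=> s hs; have sA : allin (V `&` A) s.
    by apply: allin_sub hs => y [[Uy Vy] ABy]; split => //; apply: UC.
  rewrite -[RHS](Vc s sA); congr (_ (+) _); apply: eq_cod sA => l /allinI [_ /gA //].
have Bx : B x by apply: UC; split => //; exact: nbhs_singleton.
have [V Vx Vc] := lb x Bx.
have [W Wx WAB] : exists2 W, nbhs x W & forall s, allin (W `&` A `&` B) s ->
    a s = b s (+) cod e s.
  have [Ax|nAx] := pselect (A x).
    have [W Wx Wc] := he x (conj Ax Bx); exists W => // s.
    rewrite -setIA => /Wc; by case: (a s); case: (b s); case: (cod e s).
  exists (~` A); first by apply: open_nbhs_nbhs; split => //; exact: closed_openC.
  by case=> [|y s] /=; [rewrite addbF E0|case=> -[[]]].
exists (U `&` (V `&` W)); first by apply: filterI => //; exact: filterI.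
move=> s hs; have sB : allin (V `&` B) s.
  by apply: allin_sub hs => y [[Uy [Vy Wy]] ABy]; split => //; apply: UC.
rewrite -[RHS](Vc s sB); congr (_ (+) _).
have sWB : allin (W `&` B) s.
  by apply: allin_sub hs => y [[Uy [Vy Wy]] ABy]; split => //; apply: UC.
rewrite (eq_cod (c' := fun l => b l (+) cod e l) _ sWB) ?codD ?cod_cod ?addbF //.
move=> l hl; rewrite /g; case: asboolP => // lA; apply: WAB.
by rewrite setIAC; apply/allinI.
Qed.

End acyclicity.

(** * Rules for continuity on a subset *)

Section continuity.
Context {X : topologicalType} (A : set X).

Lemma con_comp (Y Z : topologicalType) (g : Y -> Z) (f : X -> Y) :
  continuous g -> cont_on A f -> cont_on A (fun x => g (f x)).
Proof.
move=> cg cf; apply: (@cont_on_comp _ _ _ A setT f g cf _ _) => //.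
exact: continuous_cont_on.
Qed.

Lemma con_pair (Y Z : topologicalType) (f : X -> Y) (g : X -> Z) :
  cont_on A f -> cont_on A g -> cont_on A (fun x => (f x, g x)).
Proof.
move=> cf cg x Ax W [[U V] /= [/(cf _ Ax) Ux /(cg _ Ax) Vx] UV].
by apply: filterS2 Ux Vx => y Uy Vy Ay; apply: UV; split; [exact: Uy|exact: Vy].
Qed.

Lemma con_fst (Y Z : topologicalType) (f : X -> Y * Z) :
  cont_on A f -> cont_on A (fun x => (f x).1).
Proof. by apply: (@con_comp _ _ (@fst Y Z)) => -[y z] U Uy; exists (U, setT) => /=; [split=> //; exact: filterT|move=> [u v] []]. Qed.

Lemma con_snd (Y Z : topologicalType) (f : X -> Y * Z) :
  cont_on A f -> cont_on A (fun x => (f x).2).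
Proof. by apply: (@con_comp _ _ (@snd Y Z)) => -[y z] U Uy; exists (setT, U) => /=; [split=> //; exact: filterT|move=> [u v] []]. Qed.

Lemma con_cst (Y : topologicalType) (y : Y) : cont_on A (fun _ => y).
Proof. by move=> x Ax V Vy; apply: filterE => z _; exact: nbhs_singleton Vy. Qed.

Lemma con_id : cont_on A id.
Proof. by move=> x Ax V Vx; apply: filterS Vx => z Vz _. Qed.

Lemma con_mx (T : topologicalType) m n (f : X -> 'M[T]_(m, n)) :
  (forall i j, cont_on A (fun x => f x i j)) -> cont_on A f.
Proof.
move=> cf x Ax V [P Px PV].
have : \forall y \near x, forall i, forall j, A y -> P i j (f y i j).
  apply: filter_forall => i; apply: filter_forall => j.
  exact: (cf i j x Ax).
by apply: filterS => y h Ay; apply: PV => i j; exact: h.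
Qed.

Context {R : realType}.
Implicit Types f g : X -> R.

Lemma con_D f g : cont_on A f -> cont_on A g -> cont_on A (fun x => f x + g x).
Proof. by move=> cf cg x Ax; apply: (@cvgD _ _ _ (within A (nbhs x))); [exact: cf|exact: cg]. Qed.

Lemma con_N f : cont_on A f -> cont_on A (fun x => - f x).
Proof. by move=> cf x Ax; apply: (@cvgN _ _ _ (within A (nbhs x))); exact: cf. Qed.

Lemma con_M f g : cont_on A f -> cont_on A g -> cont_on A (fun x => f x * g x).
Proof. by move=> cf cg x Ax; apply: (@cvgM _ _ (within A (nbhs x))); [exact: cf|exact: cg]. Qed.

Lemma con_V f : cont_on A f -> (forall x, A x -> f x != 0) ->
  cont_on A (fun x => (f x)^-1).
Proof. by move=> cf f0 x Ax; apply: (@cvgV _ _ (within A (nbhs x))); [exact: f0|exact: cf]. Qed.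

Lemma con_X f n : cont_on A f -> cont_on A (fun x => f x ^+ n).
Proof.
move=> cf; elim: n => [|n IH]; first by under [X in cont_on A X]funext do rewrite expr0; exact: con_cst.
by under [X in cont_on A X]funext do rewrite exprS; exact: con_M.
Qed.

Lemma con_norm (V : normedModType R) (f : X -> V) :
  cont_on A f -> cont_on A (fun x => `|f x|).
Proof. by move=> cf x Ax; apply: (@cvg_norm _ _ _ (within A (nbhs x))); exact: cf. Qed.

Lemma con_max f g : cont_on A f -> cont_on A g ->
  cont_on A (fun x => Num.max (f x) (g x)).
Proof.
move=> cf cg; apply: (@eq_cont_on _ _ A (fun x => (f x + g x + `|f x - g x|) * 2^-1)).
  move=> x _; case: (leP (f x) (g x)) => h.
    rewrite ler0_norm ?subr_le0//; lra.
  rewrite gtr0_norm ?subr_gt0//; lra.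
apply: con_M; last exact: con_cst.
apply: con_D; first exact: con_D.
by apply: (@con_norm R^o); apply: con_D => //; exact: con_N.
Qed.

Lemma con_min f g : cont_on A f -> cont_on A g ->
  cont_on A (fun x => Num.min (f x) (g x)).
Proof.
move=> cf cg; apply: (@eq_cont_on _ _ A (fun x => - Num.max (- f x) (- g x))).
  by move=> x _; rewrite oppr_max !opprK.
by apply: con_N; apply: con_max; exact: con_N.
Qed.

Lemma con_sqrt f : cont_on A f -> cont_on A (fun x => Num.sqrt (f x)).
Proof. exact: (con_comp (@sqrt_continuous R)). Qed.

Lemma con_sum (I : Type) (r : seq I) (P : pred I) (F : I -> X -> R) :
  (forall i, cont_on A (F i)) -> cont_on A (fun x => \sum_(i <- r | P i) F i x).
Proof.
move=> cF; elim: r => [|i r IH].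
  by under [X in cont_on A X]funext do rewrite big_nil; exact: con_cst.
under [X in cont_on A X]funext do rewrite big_cons.
by case: (P i) => //; exact: con_D.
Qed.

Lemma con_coord m n (f : X -> 'M[R]_(m, n)) i j :
  cont_on A f -> cont_on A (fun x => f x i j).
Proof. exact: (con_comp (@coord_continuous R m n i j)). Qed.

Local Open Scope complex_scope.

Lemma con_coordC m n (f : X -> 'M[R[i]^o]_(m, n)) i j :
  cont_on A f -> cont_on A (fun x => f x i j).
Proof. exact: (con_comp (@coord_continuous R[i] m n i j)). Qed.

Lemma con_complex f g : cont_on A f -> cont_on A g ->
  cont_on A (fun x => (f x +i* g x : R[i]^o)).
Proof.
move=> cf cg x Ax V /nbhs_ballP [[e e'] /=]; rewrite ltcE /= => /andP[/eqP -> e0] eV.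
have : \forall y \near x, A y -> ball (f x) (e / 2) (f y).
  by apply: cf => //; apply: nbhsx_ballx; lra.
have : \forall y \near x, A y -> ball (g x) (e / 2) (g y).
  by apply: cg => //; apply: nbhsx_ballx; lra.
apply: filterS2 => y hg hf Ay; apply: eV; rewrite -ball_normE /=.
move: (hf Ay) (hg Ay); rewrite /ball /= => {}hf {}hg.
rewrite (_ : f x +i* g x - _ = (f x - f y) +i* (g x - g y)) //.
rewrite normc_def ltcR /=.
have h u v : Num.sqrt (u ^+ 2 + v ^+ 2) <= `|u| + `|v| :> R.
  rewrite -[leRHS]ger0_norm ?addr_ge0// -sqrtr_sqr ler_sqrt ?sqr_ge0//.
  rewrite sqrrD !real_normK ?num_real// lerD2r lerDl.
  by rewrite mulrn_wge0// mulr_ge0.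
by have := h (f x - f y) (g x - g y); lra.
Qed.

Lemma con_Re (f : X -> R[i]^o) : cont_on A f -> cont_on A (fun x => Re (f x)).
Proof.
apply: (@con_comp _ _ (fun z : R[i]^o => Re z)) => z V /nbhs_ballP [e /= e0 eV]; apply/nbhs_ballP.
exists e%:C; first by rewrite /= ltcR.
move=> w; rewrite -ball_normE /= => h; apply: eV; rewrite /ball /= -ltcR.
apply: le_lt_trans h; apply: le_trans (normc_ge_Re _).
by rewrite raddfB.
Qed.

Lemma con_Im (f : X -> R[i]^o) : cont_on A f -> cont_on A (fun x => Im (f x)).
Proof.
move=> cf; apply: (@eq_cont_on _ _ A (fun x => Re (- 'i * f x))).
  by move=> x _; case: (f x) => a b /=; lra.
apply: con_Re => x Ax.
by apply: (@cvgM _ _ (within A (nbhs x)) _ (fun=> - 'i : R[i]^o)); [exact: cvg_cst|exact: cf].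
Qed.

End continuity.

Section rowvec_norm.
Context {R : realType} {n : nat}.
Implicit Types x : 'rV[R]_n.

Lemma coord_le_norm x i : `|x 0 i| <= `|x|.
Proof. by rewrite [leRHS]/Num.norm /= mx_normrE; apply/bigmax_geP; right => /=; exists (0, i). Qed.

Lemma rowvec_norm_le x e : 0 <= e -> (`|x| <= e) <-> (forall i, `|x 0 i| <= e).
Proof.
move=> e0; split=> [h i|h]; first exact: le_trans (coord_le_norm _ _) h.
rewrite /Num.norm /= mx_normrE; apply/bigmax_leP; split => // -[i j] _ /=.
by rewrite (ord1 i).
Qed.

Lemma rowvec_norm_attained x : x != 0 -> exists i, `|x| = `|x 0 i|.
Proof.
rewrite -normr_eq0 => /mx_norm_neq0 [[i j]] /= E; exists j.
by rewrite -(ord1 i).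
Qed.

End rowvec_norm.

Lemma compact_cube (R : realType) m : compact [set T : 'rV[R]_m | `|T| <= 1].
Proof.
apply: bounded_closed_compact.
  by exists 1; split; [exact: num_real|move=> M M1 a /= a1; exact/ltW/(le_lt_trans a1)].
apply: (@preimage_closed _ _ (fun a : 'rV[R]_m => `|a|) [set t | t <= 1]).
  by move=> a _; exact: norm_continuous.
exact: closed_le.
Qed.

Lemma norm_const_mx1 (R : realType) m : (0 < m)%N -> `|const_mx 1 : 'rV[R]_m| = 1.
Proof.
move=> m0; apply/eqP; rewrite eq_le; apply/andP; split.
  by apply/rowvec_norm_le => // i; rewrite mxE normr1.
by have := coord_le_norm (const_mx 1 : 'rV[R]_m) (Ordinal m0); rewrite mxE normr1.
Qed.

(** * Cohomology of spheres *)

Section spheres.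
Context {R : realType} (N : nat).
Implicit Types (x : 'rV[R]_N.+1) (k p : nat).

(** A copy of $S^{k-1}$, empty for [k = 0]. In the sup norm the deformations below are piecewise
    linear and need no renormalization. *)
Definition maxsphere k : set 'rV[R]_N.+1 :=
  [set x : 'rV[R]_N.+1 | `|x| = 1 /\ forall i : 'I_N.+1, (k <= i)%N -> x 0 i = 0].

Lemma maxsphereP k x : maxsphere k x <->
  [/\ forall i, `|x 0 i| <= 1, exists i, `|x 0 i| = 1 &
    forall i : 'I_N.+1, (k <= i)%N -> x 0 i = 0].
Proof.
split=> [[x1 xk]|[le1 [i xi] xk]]; split=> //.
- by apply/rowvec_norm_le; rewrite ?x1.
- have x0 : x != 0 by rewrite -normr_eq0 x1 oner_eq0.
  by have [i xi] := rowvec_norm_attained x0; exists i; rewrite -xi.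
- apply/eqP; rewrite eq_le -{2}xi coord_le_norm andbT.
  exact/rowvec_norm_le.
Qed.

Lemma closed_coord (P : set R) (i : 'I_N.+1) : closed P ->
  closed [set x : 'rV[R]_N.+1 | P (x 0 i)].
Proof. by move=> cP; apply: preimage_closed => // x _; exact: coord_continuous. Qed.

Lemma closed_cap (e : R) (j : 'I_N.+1) :
  closed [set x : 'rV[R]_N.+1 | - 2^-1 <= e * x 0 j].
Proof.
apply: (@closed_coord [set t | - 2^-1 <= e * t]).
apply: (@preimage_closed _ _ ( *%R e) [set t | - 2^-1 <= t]); last exact: closed_ge.
by move=> t _; exact: mulrl_continuous.
Qed.

Lemma closed_maxsphere k : closed (maxsphere k).
Proof.
have -> : maxsphere k = [set x : 'rV[R]_N.+1 | `|x| = 1] `&`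
    \bigcap_(i in [set i : 'I_N.+1 | (k <= i)%N]) [set x : 'rV[R]_N.+1 | x 0 i = 0].
  by apply/seteqP; split=> x [? xk]; split=> // i; exact: xk.
apply: closedI; last first.
  by apply: closed_bigI => i _; apply: (@closed_coord [set 0]); exact: closed_eq.
apply: (@preimage_closed _ _ (fun x : 'rV[R]_N.+1 => `|x|) [set 1]); last exact: closed_eq.
by move=> x _; exact: norm_continuous.
Qed.

Lemma compact_sub_maxsphere k (A : set 'rV[R]_N.+1) :
  closed A -> A `<=` maxsphere k -> compact A.
Proof.
move=> clA Ak; apply: bounded_closed_compact => //.
by exists 1; split; [exact: num_real|move=> M M1 x /Ak[/= -> _]; exact: ltW].
Qed.

(** Induction by Mayer-Vietoris: with [j] the last coordinate in use, the caps $x_j\ge-1/2$ and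
    $x_j\le1/2$ contract to the poles, and their intersection flattens onto the equator
    [maxsphere k]. *)
Lemma acyc_maxsphere k p : (k <= N.+1)%N -> p != k -> acyc (maxsphere k) p.
Proof.
elim: k p => [|k IH] p kN pk.
  suff -> : maxsphere 0 = set0 by exact: acyc_set0.
  apply/seteqP; split=> // x [x1 x0].
  have : x = 0 by apply/rowP => i; rewrite x0// mxE.
  by move=> E; move: x1; rewrite E normr0 => /eqP; rewrite eq_sym oner_eq0.
pose j : 'I_N.+1 := Ordinal kN.
have neS k' : (0 < k')%N -> maxsphere k' !=set0.
  move=> k0; exists (delta_mx 0 0); apply/maxsphereP; split.
  - by move=> i; rewrite mxE eqxx /=; case: eqP; rewrite ?normr1 ?normr0.
  - by exists 0; rewrite mxE !eqxx normr1.
  - move=> i ki; rewrite mxE eqxx /=; case: eqP => // i0.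
    by move: (leq_trans k0 ki); rewrite i0.
case: p pk => [_|p pk]; first by apply: acyc_nonempty; exact: neS.
have cap (e : R) : `|e| = 1 -> acyc (maxsphere k.+1 `&` [set x : 'rV[R]_N.+1 | - 2^-1 <= e * x 0 j]) p.+1.
  move=> e1; pose A := maxsphere k.+1 `&` [set x : 'rV[R]_N.+1 | - 2^-1 <= e * x 0 j].
  have e2 : e * e = 1 by rewrite -expr2 -real_normK ?num_real// e1 expr1n.
  (* During the first half of the time coordinate [j] is pushed up to the pole with the others
     fixed: starting from at least $-1/2$, speed 4 brings it to at least $3/2$, capped at 1. Then
     the other coordinates shrink to 0. Some coordinate has absolute value 1 throughout. *)
  pose H (z : 'rV[R]_N.+1 * R) : 'rV[R]_N.+1 := \row_i (if i == j
      then e * Num.min 1 (e * z.1 0 j + 4 * z.2)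
      else Num.min 1 (2 - 2 * z.2) * z.1 0 i).
  have HA z : cylinder A z -> A (H z).
    move=> [[/maxsphereP[x1 [i0 xi0] xk] /= xj]] /=; rewrite in_itv /= => /andP[z0 z1].
    set m := Num.min 1 (2 - 2 * z.2).
    have m01 : 0 <= m <= 1 by rewrite /m le_min ge_min lexx ler01 andbT /=; lra.
    have ex : `|e * z.1 0 j| <= 1 by rewrite normrM e1 mul1r.
    split; last first.
      rewrite /= mxE eqxx mulrA e2 mul1r.
      by rewrite le_min; apply/andP; split; lra.
    apply/maxsphereP; split.
    - move=> i; rewrite mxE; case: eqP => _.
        rewrite normrM e1 mul1r; move: ex; rewrite !ler_norml => ex.
        by rewrite le_min ge_min lexx andbT; lra.
      by case/andP: m01 => m0 m1; rewrite normrM mulr_ile1// ger0_norm.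
    - have [zh|zh] := leP (4 * z.2) 2; last first.
        exists j; rewrite mxE eqxx normrM e1 mul1r.
        by rewrite min_l ?normr1//; lra.
      have m1 : m = 1 by rewrite /m min_l//; lra.
      have [i0j|i0j] := eqVneq i0 j; last first.
        by exists i0; rewrite mxE (negbTE i0j) -/m m1 mul1r.
      exists j; rewrite mxE eqxx normrM e1 mul1r.
      rewrite min_l ?normr1//.
      have : `|e * z.1 0 j| = 1 by rewrite normrM e1 mul1r -i0j.
      by case: ler0P; lra.
    - move=> i ki; rewrite mxE; case: eqP => [ij|_]; last by rewrite xk// mulr0.
      by move: ki; rewrite ij /= ltnn.
  apply: (@acyc_deform R _ A [set e *: delta_mx 0 j] H p.+1).
  - apply: (@compact_sub_maxsphere k.+1); last by move=> x [].
    apply: closedI; first exact: closed_maxsphere.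
    exact: closed_cap.
  - move=> _ ->; split; last by rewrite /= !mxE !eqxx mulr1 e2; lra.
    apply/maxsphereP; split.
    + move=> i; rewrite !mxE eqxx /= normrM e1 mul1r.
      by case: eqP; rewrite ?normr1 ?normr0.
    + by exists j; rewrite !mxE !eqxx mulr1.
    + by move=> i ki; rewrite !mxE eqxx /=; case: eqP => [ij|_]; rewrite ?mulr0//; move: ki; rewrite ij /= ltnn.
  - apply: con_mx => i0 i; rewrite /H; under [X in cont_on _ X]funext do rewrite mxE.
    case: eqP => _.
      apply: con_M; first exact: con_cst.
      apply: con_min; first exact: con_cst.
      apply: con_D; apply: con_M; try exact: con_cst.
        by apply: con_coord; apply: con_fst; exact: con_id.
      by apply: con_snd; exact: con_id.
    apply: con_M; last by apply: con_coord; apply: con_fst; exact: con_id.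
    apply: con_min; first exact: con_cst.
    apply: con_D; first exact: con_cst.
    apply: con_N; apply: con_M; first exact: con_cst.
    by apply: con_snd; exact: con_id.
  - exact: HA.
  - move=> x [/maxsphereP[x1 _ _] _]; apply/rowP => i; rewrite mxE /= !mulr0 addr0 subr0.
    case: eqP => [->|_]; last by rewrite min_l ?mul1r//; lra.
    rewrite min_r ?mulrA ?e2 ?mul1r//.
    by apply: le_trans (ler_norm _) _; rewrite normrM e1 mul1r.
  - move=> x [/maxsphereP[x1 _ _] _]; apply/rowP => i; rewrite !mxE /=.
    have ex : `|e * x 0 j| <= 1 by rewrite normrM e1 mul1r.
    have [_|_] := eqVneq i j.
      by rewrite min_l ?mulr1 //; move: ex; rewrite ler_norml; lra.
    by rewrite mulr0 mulr1 subrr min_r ?mul0r//; lra.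
  - exact: acyc_point.
pose A := maxsphere k.+1 `&` [set x : 'rV[R]_N.+1 | - 2^-1 <= 1 * x 0 j].
pose B := maxsphere k.+1 `&` [set x : 'rV[R]_N.+1 | - 2^-1 <= -1 * x 0 j].
have clh (e : R) : closed (maxsphere k.+1 `&` [set x : 'rV[R]_N.+1 | - 2^-1 <= e * x 0 j]).
  apply: closedI; first exact: closed_maxsphere.
  exact: closed_cap.
have AB : maxsphere k.+1 = A `|` B.
  apply/seteqP; split=> [x Sx|x [[]|[]]//].
  by have [h|h] := leP 0 (x 0 j); [left|right]; split => //=; lra.
have kAB : maxsphere k `<=` A `&` B.
  move=> x [x1 xk]; have Sx : maxsphere k.+1 x.
    by split=> // i /ltnW; exact: xk.
  by split; split => //=; rewrite xk //; lra.
rewrite AB; apply: acyc_union; rewrite ?/A ?/B; [exact: clh|exact: clh| | |..].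
- move=> x; rewrite -AB => Sx.
  have [h|h] := leP 0 (x 0 j).
    exists [set y : 'rV[R]_N.+1 | - 2^-1 < y 0 j].
      apply: (@coord_continuous R 1 N.+1 0 j x [set t | - 2^-1 < t]).
      by apply: (open_nbhs_nbhs (conj (@open_gt _ _) _)) => /=; lra.
    by left=> y [/= yj Sy]; split => //=; lra.
  exists [set y : 'rV[R]_N.+1 | y 0 j < 2^-1].
    apply: (@coord_continuous R 1 N.+1 0 j x [set t | t < 2^-1]).
    by apply: (open_nbhs_nbhs (conj (@open_lt _ _) _)) => /=; lra.
  by right=> y [/= yj Sy]; split => //=; lra.
- move=> p0; have k0 : (0 < k)%N by move: pk; rewrite p0 eqSS eq_sym lt0n.
  by have [x Sx] := neS k k0; exists x; exact: kAB.
- by apply: cap; rewrite normr1.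
- by apply: cap; rewrite normrN1.
(* On the intersection $|x_j|\le1/2$, so another coordinate has absolute value 1 and flattening
   $x_j$ stays on the sphere. *)
pose H (z : 'rV[R]_N.+1 * R) : 'rV[R]_N.+1 := \row_i (if i == j
      then (1 - z.2) * z.1 0 i else z.1 0 i).
apply: (@acyc_deform R _ (A `&` B) (maxsphere k) H p) => //; last first.
- by apply: IH; [exact: ltnW|rewrite -eqSS].
- move=> x [[[x1 xk] /= x2] [_ /= x3]].
  have /maxsphereP[y1 [i yi] yk] := conj x1 xk; apply/maxsphereP; split.
  + by move=> i'; rewrite mxE subrr mul0r; case: eqP => // _; rewrite normr0.
  + exists i; rewrite mxE; case: eqP => // ij; exfalso; move: yi; rewrite ij.
    by case: ler0P; lra.
  + move=> i' ki; rewrite mxE subrr mul0r; case: eqP => // /eqP ij.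
    by apply: yk; rewrite ltn_neqAle ki andbT eq_sym.
- by move=> x _; apply/rowP => i; rewrite mxE subr0 mul1r if_same.
- move=> z [[[[x1 xk] /= x2] [_ /= x3]]] /=; rewrite in_itv /= => /andP[z0 z1].
  have /maxsphereP[y1 [i yi] yk] := conj x1 xk.
  have Hj : - 2^-1 <= H z 0 j <= 2^-1.
    by rewrite mxE eqxx; apply/andP; split; nra.
  have SH : maxsphere k.+1 (H z).
    apply/maxsphereP; split.
    + move=> i'; have [->|ij] := eqVneq i' j.
        by move: Hj; rewrite ler_norml; lra.
      by rewrite mxE (negbTE ij).
    + exists i; rewrite mxE; case: eqP => // ij; exfalso; move: yi; rewrite ij.
      by case: ler0P; lra.
    + by move=> i' ki; rewrite mxE yk// mulr0 if_same.
  by split; split => //=; lra.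
- apply: con_mx => i0 i; rewrite /H; under [X in cont_on _ X]funext do rewrite mxE.
  case: eqP => _; last by apply: con_coord; apply: con_fst; exact: con_id.
  apply: con_M; last by apply: con_coord; apply: con_fst; exact: con_id.
  apply: con_D; first exact: con_cst.
  by apply: con_N; apply: con_snd; exact: con_id.
- apply: (@compact_sub_maxsphere k.+1); last by move=> x [[]].
  by apply: closedI; exact: clh.
Qed.
End spheres.

Lemma con_sub (X Y : topologicalType) (A : set X) (B : set Y) (f : X -> B) :
  cont_on A (fun x => set_val (f x)) -> cont_on A f.
Proof.
move=> cf x Ax V [_ /= [[W oW <-] Wfx WV]].
have := cf x Ax W (open_nbhs_nbhs (conj oW Wfx)).
by apply: filterS => y h Ay; apply: WV; exact: h.
Qed.

Lemma con_set_val (X Y : topologicalType) (A : set X) (B : set Y) (f : X -> B) :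
  cont_on A f -> cont_on A (fun x => set_val (f x)).
Proof. exact: con_comp (@initial_continuous _ _ set_val). Qed.

Section sphere_type.
Context {R : realType} (k : nat).
Implicit Types y : 'rV[R]_k.+1.

Definition sqnorm y : R := \sum_i y 0 i ^+ 2.

Lemma sqnorm_ge0 y : 0 <= sqnorm y.
Proof. by apply: sumr_ge0 => i _; exact: sqr_ge0. Qed.

Lemma sqnorm_eq0 y : sqnorm y = 0 -> y = 0.
Proof.
move=> /eqP; rewrite psumr_eq0 => [/allP y0|i _]; last exact: sqr_ge0.
apply/rowP => i; apply/eqP; rewrite mxE -sqrf_eq0.
by apply: (implyP (y0 i _)) => //; rewrite mem_index_enum.
Qed.

Lemma sqnormZ a y : sqnorm (a *: y) = a ^+ 2 * sqnorm y.
Proof. by rewrite /sqnorm mulr_sumr; apply: eq_bigr => i _; rewrite mxE exprMn. Qed.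

Lemma sphere_normalize y : y != 0 ->
  (Num.sqrt (sqnorm y))^-1 *: y \in @sphere_set R k.
Proof.
move=> y0; apply/mem_set; rewrite /sphere_set /= -[LHS]/(sqnorm _) sqnormZ.
rewrite exprVn sqr_sqrtr ?sqnorm_ge0// mulVf//.
by apply: contra y0 => /eqP /sqnorm_eq0 ->.
Qed.

Definition to_sphere y : sphere R k :=
  match pselect (y != 0) with
  | left h => exist (fun z => z \in @sphere_set R k) _ (sphere_normalize h)
  | right _ => point
  end.

Lemma val_to_sphere y : y != 0 ->
  set_val (to_sphere y) = (Num.sqrt (sqnorm y))^-1 *: y.
Proof. by rewrite /to_sphere; case: pselect. Qed.

Lemma con_to_sphere (X : topologicalType) (A : set X) (f : X -> 'rV[R]_k.+1) :
  cont_on A f -> (forall x, A x -> f x != 0) -> cont_on A (to_sphere \o f).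
Proof.
move=> cf f0; apply: con_sub.
apply: (@eq_cont_on _ _ A (fun x => (Num.sqrt (sqnorm (f x)))^-1 *: f x)).
  by move=> x Ax; rewrite val_to_sphere //; exact: f0.
apply: con_mx => i j; under [X in cont_on _ X]funext do rewrite mxE.
apply: con_M; last exact: con_coord.
apply: con_V.
  by apply: con_sqrt; apply: con_sum => l; apply: con_X; exact: con_coord.
move=> x Ax; rewrite sqrtr_eq0 -ltNge lt_neqAle sqnorm_ge0 andbT eq_sym.
by apply: contra (f0 _ Ax) => /eqP /sqnorm_eq0 ->.
Qed.

Lemma sphere_val_sqnorm (x : sphere R k) : sqnorm (set_val x) = 1.
Proof. exact: (set_mem (valP x)). Qed.

Lemma sphere_val_neq0 (x : sphere R k) : set_val x != 0.
Proof.
apply/eqP => E; have := sphere_val_sqnorm x; rewrite E /sqnorm.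
rewrite big1 => [/eqP|i _]; first by rewrite eq_sym oner_eq0.
by rewrite mxE expr0n.
Qed.

Lemma to_sphereZ (x : sphere R k) a : 0 < a -> to_sphere (a *: set_val x) = x.
Proof.
move=> a0; have x0 := sphere_val_neq0 x.
have ax0 : a *: set_val x != 0 by rewrite scaler_eq0 negb_or x0 gt_eqF.
apply: val_inj; rewrite -[LHS]/(set_val (to_sphere (a *: set_val x))).
rewrite val_to_sphere// sqnormZ sphere_val_sqnorm mulr1 sqrtr_sqr gtr0_norm//.
by rewrite scalerA mulVf ?gt_eqF// scale1r.
Qed.

(** Rescaling to sup norm 1 and back makes the round sphere a retract of [maxsphere k.+1]; the
    excluded length [k.+1] is degree [k]. *)
Lemma acyc_sphere p : p != k.+1 -> acyc [set: sphere R k] p.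
Proof.
move=> pk.
apply: (@acyc_transfer _ _ _ (@maxsphere R k k.+1)
  (fun x : sphere R k => `|(set_val x : 'rV[R]_k.+1)|^-1 *: (set_val x : 'rV[R]_k.+1)) to_sphere).
- apply: con_mx => i j; under [X in cont_on _ X]funext do rewrite mxE.
  have cv : cont_on setT (fun x : sphere R k => (set_val x : 'rV[R]_k.+1)).
    by apply: con_set_val; exact: con_id.
  apply: con_M; last exact: con_coord.
  apply: con_V; first exact: con_norm.
  by move=> x _; rewrite normr_eq0 sphere_val_neq0.
- move=> x _; split=> [|i]; last by rewrite leqNgt ltn_ord.
  by rewrite normrZ normfV normr_id mulVf // normr_eq0 sphere_val_neq0.
- apply: (con_to_sphere (@con_id _ _)) => x [x1 _].
  by rewrite -normr_eq0 x1 oner_eq0.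
- by [].
- by move=> x _; rewrite to_sphereZ// invr_gt0 normr_gt0 sphere_val_neq0.
- exact: acyc_maxsphere.
Qed.

End sphere_type.

(** * Gluing primitives over a wedge *)

Section wedge_gluing.
Context {W X Y : topologicalType} (w0 : W) (x0 : X) (y0 : Y).
Context (iX : X -> W) (iY : Y -> W) (rX : W -> X) (rY : W -> Y).
Context (ciX : continuous iX) (ciY : continuous iY).
Context (crX : continuous rX) (crY : continuous rY).
Context (iX0 : iX x0 = w0) (iY0 : iY y0 = w0).
Context (rX0 : rX w0 = x0) (rY0 : rY w0 = y0).
Context (wX : forall w, rX w != x0 -> iX (rX w) = w).
Context (wY : forall w, rY w != y0 -> iY (rY w) = w).
Context (wXY : forall w, rX w = x0 -> rY w = y0 -> w = w0).
Context (clx : closed [set x0]) (cly : closed [set y0]).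
Context (T1X : forall x, rY (iX x) = y0).

Lemma normalize_at (T : topologicalType) (x : T) (c : seq T -> bool) U :
  nbhs x U -> (forall s, allin U s -> cod c s = false) ->
  exists b, forall s, allin U s -> c s (+) cod b s = false.
Proof.
move=> Ux Uc; exists (fun l => c (x :: l)) => s Us.
by rewrite -(cone_cocycle (nbhs_singleton Ux) Uc Us) addbb.
Qed.

(** After subtracting a coboundary, [c] vanishes near the base point, and the primitives on the two
    summands can be made to vanish near it as well. They then glue, with value 0 on tuples that lie
    in neither summand. *)
Lemma cobound_wedge c : lz setT (cod c) -> cobound setT (c \o map iX) ->
  cobound setT (c \o map iY) -> cobound setT c.
Proof.
move=> lc [a la] [b lb].
have [U Uw Uc] := lc w0 I.
have [e he] : exists e, forall s, allin U s -> c s (+) cod e s = false.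
  by apply: normalize_at Uw _ => s Us; apply: Uc; apply: allin_sub Us => y.
pose c' s := c s (+) cod e s.
(* Near the base point the primitive is itself closed, hence equal to some [cod f] there; adding
   [cod f] makes it vanish. *)
have adj (T : topologicalType) (t0 : T) (i : T -> W) (d : seq T -> bool) :
    continuous i -> i t0 = w0 -> lz setT (fun s => (c \o map i) s (+) cod d s) ->
    exists d', lz setT (fun s => (c' \o map i) s (+) cod d' s) /\
      exists2 V, nbhs t0 V & forall s, allin V s -> d' s = false.
  move=> ci i0 ld.
  pose d1 := fun s => d s (+) e (map i s).
  have ld1 : lz setT (fun s => (c' \o map i) s (+) cod d1 s).
    apply: eq_lzT ld => s; rewrite /c' /d1 /= codD -[cod (fun l => e _) s]/(cod (e \o map i) s) -cod_map.
    by btauto.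
  have [V0 V0t V0c] := ld1 t0 I.
  pose V := V0 `&` i @^-1` U.
  have Vt : nbhs t0 V by apply: filterI => //; apply: ci; rewrite i0.
  have [f hf] : exists f, forall s, allin V s -> d1 s (+) cod f s = false.
    apply: normalize_at Vt _ => s Vs.
    have := V0c s; rewrite /= /c' he; last by apply/allin_map; apply: allin_sub Vs => y [].
    by rewrite addFb; apply; apply: allin_sub Vs => y [].
  exists (fun s => d1 s (+) cod f s); split; last by exists V.
  by apply: eq_lzT ld1 => s; rewrite codD cod_cod addbF.
have [a' [la' [VX VXx VXa]]] := adj _ _ _ _ ciX iX0 la.
have [b' [lb' [VY VYy VYb]]] := adj _ _ _ _ ciY iY0 lb.
pose rgX := [set w | iX (rX w) = w]; pose rgY := [set w | iY (rY w) = w].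
pose g s := if `[< allin rgX s >] then a' (map rX s)
   else if `[< allin rgY s >] then b' (map rY s) else false.
suff : lz setT (fun s => c' s (+) cod g s).
  move=> h; exists (fun s => e s (+) g s); apply: eq_lzT h => s.
  by rewrite codD /c'; btauto.
have mapK (i : X -> W) (r : W -> X) s : allin [set w | i (r w) = w] s -> map i (map r s) = s.
  by elim: s => //= w s IH [-> /IH ->].
have mapK' (i : Y -> W) (r : W -> Y) s : allin [set w | i (r w) = w] s -> map i (map r s) = s.
  by elim: s => //= w s IH [-> /IH ->].
move=> w _; have [/eqP rXw|rXw] := boolP (rX w == x0); last first.
  have [V Vw Vc] := la' (rX w) I.
  exists (rX @^-1` (V `&` ~` [set x0])).
    apply: crX; apply: filterI => //; apply: open_nbhs_nbhs; split; last exact/eqP.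
    exact: closed_openC.
  move=> s Us; have sX : allin rgX s by apply: allin_sub Us => v [[_ /eqP/wX]].
  have := Vc (map rX s); rewrite /= mapK// => <-; last first.
    by apply/allin_map; apply: allin_sub Us => v [[]].
  congr (_ (+) _); rewrite cod_map; apply: eq_cod sX => l lX.
  by rewrite /g; case: asboolP.
have [/eqP rYw|rYw] := boolP (rY w == y0); last first.
  have [V Vw Vc] := lb' (rY w) I.
  exists (rY @^-1` (V `&` ~` [set y0])).
    apply: crY; apply: filterI => //; apply: open_nbhs_nbhs; split; last exact/eqP.
    exact: closed_openC.
  move=> s Us; have sY : allin [set w | rY w <> y0] s by apply: allin_sub Us => v [[]].
  have sY' : allin rgY s by apply: allin_sub Us => v [[_ /eqP/wY]].
  have := Vc (map rY s); rewrite /= mapK'// => <-; last first.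
    by apply/allin_map; apply: allin_sub Us => v [[]].
  congr (_ (+) _); rewrite cod_map; apply: eq_cod sY => l lY.
  (* A tuple away from the base point that lies in both summands is empty, and both primitives
     vanish on the empty tuple. *)
  rewrite /g; case: asboolP => [lX|_].
    case: l lX lY => [|v l] /=; last by move=> [<- _] [].
    by rewrite VXa// VYb.
  by case: asboolP => // -[]; apply: allin_sub lY => v /eqP/wY.
rewrite (wXY rXw rYw) in Uw *.
exists (U `&` (rX @^-1` VX `&` rY @^-1` VY)).
  by apply: filterI => //; apply: filterI; [apply: crX; rewrite rX0|apply: crY; rewrite rY0].
move=> s Us.
rewrite /c' he ?addFb; last by apply: allin_sub Us => v [[]].
have {Us} : allin (rX @^-1` VX `&` rY @^-1` VY) s by apply: allin_sub Us => v [[]].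
move=> Vs; rewrite -[RHS](cod0 s); apply: eq_cod Vs => l /allinI [lX lY].
rewrite /g; case: asboolP => _; first by apply: VXa; exact/allin_map.
by case: asboolP => // _; apply: VYb; exact/allin_map.
Qed.

End wedge_gluing.

(** * Collapses, suspensions and wedges *)

Section collapse_theory.
Local Open Scope quotient_scope.
Context {X : topologicalType} (A : set X).

Definition cpi (x : X) : collapse A := \pi_(collapse A) x.
Definition csec (q : collapse A) : X := repr q.

Lemma csecK q : cpi (csec q) = q.
Proof. exact: reprK. Qed.

Lemma cpi_eqP x y : cpi x = cpi y <-> x = y \/ A x /\ A y.
Proof.
split=> [/eqmodP/predU1P[->|/andP[/set_mem ? /set_mem ?]]|h]; [by left|by right|].
apply/eqmodP; apply/orP; case: h => [->|[Ax Ay]]; first by left.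
by right; rewrite !mem_set.
Qed.

Lemma csec_cpi x : ~ A x -> csec (cpi x) = x.
Proof. by move=> nAx; have /cpi_eqP[//|[_ //]] := csecK (cpi x). Qed.

Lemma csec_cpiA x : A x -> A (csec (cpi x)).
Proof. by move=> Ax; have /cpi_eqP[->|[]] := csecK (cpi x). Qed.

Lemma cpi_continuous : continuous cpi.
Proof. exact: (@pi_continuous X _). Qed.

Lemma open_collapse (U : set (collapse A)) : open U <-> open (cpi @^-1` U).
Proof. by []. Qed.

Lemma nbhs_cpi x U : closed A -> ~ A x -> nbhs x U ->
  nbhs (cpi x) [set q | U (csec q) /\ ~ A (csec q)].
Proof.
move=> clA nAx; rewrite nbhsE => -[V [oV Vx] VU].
have : open [set q | V (csec q) /\ ~ A (csec q)].
  apply/open_collapse; rewrite (_ : cpi @^-1` _ = V `&` ~` A).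
    by apply: openI => //; exact: closed_openC.
  apply/seteqP; split=> y /= [].
    move=> Vy nAy; have /cpi_eqP[E|[]//] := csecK (cpi y).
    by rewrite E in Vy nAy.
  by move=> Vy nAy; rewrite csec_cpi.
move=> oW; apply: (@filterS _ _ _ [set q | V (csec q) /\ ~ A (csec q)]).
  by move=> q [/VU].
by apply: open_nbhs_nbhs; split => //=; rewrite csec_cpi.
Qed.

(** The representative [csec] of the collapsed point is an arbitrary element of [A], so [U] has to
    surround all of [A]. *)
Lemma nbhs_cpiA x U : A x -> (forall y, A y -> nbhs y U) ->
  nbhs (cpi x) [set q | U (csec q)].
Proof.
move=> Ax AU; apply: (@filterS _ _ _ [set q | (interior U) (csec q)]).
  by move=> q; exact: interior_subset.
apply: open_nbhs_nbhs; split => /=; last exact/AU/csec_cpiA.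
apply/open_collapse; rewrite (_ : cpi @^-1` _ = interior U); first exact: open_interior.
apply/seteqP; split=> y /=.
  by have /cpi_eqP[->//|[_ Ay]] := csecK (cpi y); move=> _; exact: AU.
by have /cpi_eqP[->//|[Ay _]] := csecK (cpi y); move=> _; exact: AU.
Qed.

Lemma collapse_continuous (Y : topologicalType) (f : collapse A -> Y) :
  continuous (f \o cpi) -> continuous f.
Proof. by move=> cf; apply/(@quotient_continuous X _). Qed.

Lemma compact_collapse : compact [set: X] -> compact [set: collapse A].
Proof.
move=> cX; have -> : [set: collapse A] = cpi @` setT.
  by apply/seteqP; split=> // q _; exists (csec q) => //; exact: csecK.
apply: continuous_compact => //; apply: continuous_subspaceT; exact: cpi_continuous.
Qed.

Lemma closed_cpi_point x : closed A -> A x -> closed [set cpi x].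
Proof.
move=> clA Ax; rewrite -openC; apply/open_collapse.
rewrite (_ : _ @^-1` _ = ~` A); first exact: closed_openC.
apply/seteqP; split=> y /=; first by move=> h Ay; apply: h; apply/cpi_eqP; right.
by move=> nAy /cpi_eqP[E|[]//]; apply: nAy; rewrite E.
Qed.

End collapse_theory.

Section unit_interval_theory.
Context {R : realType}.

Lemma set_val_I0 : (set_val (I0 : unit_interval R) : R) = 0. Proof. by []. Qed.
Lemma set_val_I1 : (set_val (I1 : unit_interval R) : R) = 1. Proof. by []. Qed.

Lemma unit_intervalP (t : unit_interval R) : 0 <= (set_val t : R) <= 1.
Proof. by have := set_mem (valP t); rewrite /= in_itv. Qed.

Lemma clampI_subproof (t : R) : Num.max 0 (Num.min 1 t) \in [set` `[0%R, 1%R]].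
Proof.
by apply/mem_set; rewrite /= in_itv /= le_max lexx /= ge_max ler01 ge_min lexx.
Qed.

Definition clampI (t : R) : unit_interval R :=   exist (fun x => x \in ([set` `[0%R, 1%R]] : set R)) _ (clampI_subproof t).

Lemma con_clampI (X : topologicalType) (A : set X) (f : X -> R) :
  cont_on A f -> cont_on A (clampI \o f).
Proof.
by move=> cf; apply: con_sub; apply: con_max; [exact: con_cst|apply: con_min; [exact: con_cst|]].
Qed.

Lemma val_clampI t : 0 <= t <= 1 -> set_val (clampI t) = t.
Proof. by move=> /andP[t0 t1]; rewrite /set_val /= min_r// max_r. Qed.

Lemma clampI_val (t : unit_interval R) : clampI (set_val t) = t.
Proof. by apply: val_inj; apply: val_clampI; exact: unit_intervalP. Qed.

Lemma clampI0 : clampI 0 = I0. Proof. by rewrite -(clampI_val I0). Qed.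
Lemma clampI1 : clampI 1 = I1. Proof. by rewrite -(clampI_val I1). Qed.

Lemma I0P (t : unit_interval R) : (set_val t : R) = 0 -> t = I0.
Proof. by move=> E; apply: val_inj. Qed.
Lemma I1P (t : unit_interval R) : (set_val t : R) = 1 -> t = I1.
Proof. by move=> E; apply: val_inj. Qed.

Lemma unit_interval_val_continuous :
  continuous (fun t : unit_interval R => (set_val t : R)).
Proof. exact: initial_continuous. Qed.

Lemma compact_unit_interval : compact [set: unit_interval R].
Proof.
have -> : [set: unit_interval R] = clampI @` [set` `[0%R, 1%R]].
  apply/seteqP; split=> // t _; exists (set_val t); last exact: clampI_val.
  by rewrite /= in_itv /=; exact: unit_intervalP.
apply: continuous_compact; last exact: segment_compact.
by apply/cont_onP; apply: (con_clampI (@con_id _ _)).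
Qed.

End unit_interval_theory.

Section wedge2_theory.
Context (X Y : ptopologicalType).
Local Notation part := (fun b : bool => if b then X else Y).
Local Notation base := (fun b : bool => @point (if b then X else Y)).

Definition winl (x : X) : wedge2 X Y := @wedge_lift bool part base true x.
Definition winr (y : Y) : wedge2 X Y := @wedge_lift bool part base false y.

Lemma winl_continuous : continuous winl.
Proof. exact: (@wedge_lift_continuous bool part base true). Qed.

Lemma winr_continuous : continuous winr.
Proof. exact: (@wedge_lift_continuous bool part base false). Qed.

Lemma winl_point : winl point = winr point.
Proof. exact: (@wedge_liftE bool part base false point true point). Qed.

Lemma wedge2P (w : wedge2 X Y) : (exists x, w = winl x) \/ (exists y, w = winr y).
Proof.
have : [set: wedge2 X Y] w by [].
by rewrite -wedgeTE => -[[] _ [x _ <-]]; [left|right]; exists x.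
Qed.

Definition to_left (b : bool) : (if b then X else Y) -> X :=
  match b return (if b then X else Y) -> X with true => id | false => fun=> point end.
Definition to_right (b : bool) : (if b then X else Y) -> Y :=
  match b return (if b then X else Y) -> Y with true => fun=> point | false => id end.
Definition wretl : wedge2 X Y -> X := wedge_fun (p0 := base) to_left.
Definition wretr : wedge2 X Y -> Y := wedge_fun (p0 := base) to_right.

Lemma wretl_winl x : wretl (winl x) = x.
Proof. by rewrite /wretl /winl wedge_lift_funE// => -[] []. Qed.
Lemma wretl_winr y : wretl (winr y) = point.
Proof. by rewrite /wretl /winr wedge_lift_funE// => -[] []. Qed.
Lemma wretr_winl x : wretr (winl x) = point.
Proof. by rewrite /wretr /winl wedge_lift_funE// => -[] []. Qed.
Lemma wretr_winr y : wretr (winr y) = y.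
Proof. by rewrite /wretr /winr wedge_lift_funE// => -[] []. Qed.

Lemma wretl_continuous : continuous wretl.
Proof.
apply: wedge_fun_continuous; last by move=> [] [].
by case; [move=> x V|exact: cst_continuous].
Qed.

Lemma wretr_continuous : continuous wretr.
Proof.
apply: wedge_fun_continuous; last by move=> [] [].
by case; [exact: cst_continuous|move=> x V].
Qed.

Lemma winl_inj : injective winl.
Proof. by move=> x x' E; rewrite -(wretl_winl x) E wretl_winl. Qed.

Lemma winr_inj : injective winr.
Proof. by move=> y y' E; rewrite -(wretr_winr y) E wretr_winr. Qed.

Lemma winl_winr x y : winl x = winr y -> y = point.
Proof. by move=> E; rewrite -(wretr_winr y) -E wretr_winl. Qed.

Lemma wedge2_hausdorff : hausdorff_space X -> hausdorff_space Y ->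
  hausdorff_space (wedge2 X Y).
Proof. by move=> hX hY; apply: (@wedge_hausdorff bool part base); case. Qed.

End wedge2_theory.

(** * Suspending a class together with its square *)

Section suspension_step.
Context {R : realType} {Y : ptopologicalType}.
Context (compY : compact [set: Y]) (clY : closed [set (point : Y)]).
Context (p : nat) (u : seq Y -> bool) (hu : homog p.+1 u).
Context (lu : lz setT (cod u)) (U : set Y) (Upt : nbhs (point : Y) U).
Context (uU : forall s, allin U s -> u s = false).

Local Notation YI := (Y * unit_interval R)%type.
Local Notation L := (@susp_collapsed R Y).
Local Notation tval := (fun z : YI => (set_val z.2 : R)).

Lemma nbhs_tval (z : YI) (V : set R) : nbhs (tval z) V -> nbhs z (tval @^-1` V).
Proof.
move=> Vz; exists (setT, (fun t => V (set_val t : R))) => /=; last by move=> w [].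
by split; [exact: filterT|exact: unit_interval_val_continuous].
Qed.

Lemma nbhs_fst (z : YI) (V : set Y) : nbhs z.1 V -> nbhs z (fst @^-1` V).
Proof. by move=> Vz; exists (V, setT) => /=; [split=> //; exact: filterT|move=> w []]. Qed.

Lemma nbhs_gt (z : YI) (a : R) : a < tval z -> nbhs z [set w | a < tval w].
Proof. by move=> az; apply: (@nbhs_tval z [set t | a < t]); apply: open_nbhs_nbhs; split => //; exact: open_gt. Qed.

Lemma nbhs_lt (z : YI) (a : R) : tval z < a -> nbhs z [set w | tval w < a].
Proof. by move=> az; apply: (@nbhs_tval z [set t | t < a]); apply: open_nbhs_nbhs; split => //; exact: open_lt. Qed.

Lemma closed_susp_collapsed : closed L.
Proof.
have cl (t : R) : closed [set z : YI | tval z = t].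
  apply: (@preimage_closed _ _ tval [set t]); last exact: closed_eq.
  by move=> z _ V Vz; exact: nbhs_tval.
have -> : L = [set z : YI | tval z = 0] `|` [set z : YI | tval z = 1] `|`
   [set z : YI | [set (point : Y)] z.1].
  apply/seteqP; split=> z /=.
    by case=> [->|->|->]; [left; left|left; right|right].
  by case=> [[/I0P|/I1P]|]; [exact: Or31|exact: Or32|exact: Or33].
apply: closedU; first by apply: closedU; exact: cl.
apply: (@preimage_closed _ _ fst) => // z _ V Vz; exact: nbhs_fst.
Qed.

Let upper : set YI := [set z | 2^-1 < tval z].
Let middle : set YI := [set z | 4^-1 < tval z < 3 / 4].
(** The pullback of [u], cut off to the upper half. The coboundary of this cut-off is concentrated
    at height $1/2$ and represents the suspension of [u]. *)
Let lift (l : seq YI) : bool := if `[< allin upper l >] then u (map fst l) else false.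
(** [cod lift] read on the suspension through representatives. The middle band stays clear of the
    two collapsed ends, and along the base point [lift] vanishes. *)
Let ususp (s : seq (susp R Y)) : bool :=
  if `[< allin (middle \o @csec _ L) s >] then cod lift (map (@csec _ L) s) else false.

Let u0 : u [::] = false. Proof. exact: hu. Qed.

Lemma lift_lower l : allin [set z : YI | tval z < 2^-1] l -> lift l = false.
Proof.
case: l => [_|z l [/= zl _]]; first by rewrite /lift /= u0 if_same.
rewrite /lift; case: asboolP => //= -[].
by rewrite /upper /= => zg; move: (lt_trans zl zg); rewrite ltxx.
Qed.

Lemma lift_upper l : allin upper l -> lift l = u (map fst l).
Proof. by move=> ul; rewrite /lift; case: asboolP. Qed.

Lemma lift_near_point l : allin (fst @^-1` U) l -> lift l = false.
Proof. by move=> lU; rewrite /lift uU ?if_same//; apply/allin_map. Qed.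

(** Below height $1/2$ [lift] is zero, and above it is the pullback of a cocycle. *)
Lemma cod_lift_loc (z : YI) : tval z != 2^-1 ->
  exists2 V, nbhs z V & forall l, allin V l -> cod lift l = false.
Proof.
rewrite neq_lt => /orP[h|h].
  exists [set w | tval w < 2^-1]; first exact: nbhs_lt.
  by move=> l hl; rewrite (eq_cod (c' := fun=> false) _ hl) ?cod0// => k; exact: lift_lower.
have [V Vz Vc] := @lu z.1 I.
exists (upper `&` fst @^-1` V); first by apply: filterI; [exact: nbhs_gt|exact: nbhs_fst].
move=> l /allinI[lu' lV]; rewrite (eq_cod (c' := u \o map fst) _ lu'); last first.
  by move=> k; exact: lift_upper.
rewrite -cod_map; apply: Vc; apply/allin_map; apply: allin_sub lV => w.
by split.
Qed.

Lemma ususp_loc (z : YI) : ~ L z -> exists2 V, nbhs z V & forall l, allin V l ->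
  (if `[< allin middle l >] then cod lift l else false) = cod lift l.
Proof.
move=> nLz; have [h|h] := eqVneq (tval z) 2^-1.
  exists middle.
    rewrite (_ : middle = [set w | 4^-1 < tval w] `&` [set w | tval w < 3 / 4]).
      by apply: filterI; [apply: nbhs_gt; rewrite h; lra|apply: nbhs_lt; rewrite h; lra].
    by apply/seteqP; split => w; [move=> /andP[]|move=> [/= w1 w2]; apply/andP].
  by move=> l ml; case: asboolP.
by have [V Vz Vc] := cod_lift_loc h; exists V => // l /Vc ->; rewrite if_same.
Qed.

Let susp_pt : susp R Y := @cpi _ L (point, I0).

Lemma ususp_near_point : exists2 V, nbhs susp_pt V & forall s, allin V s -> ususp s = false.
Proof.
pose O := [set z : YI | [\/ tval z < 4^-1, 3 / 4 < tval z | U z.1]].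
exists [set q | O (@csec _ L q)].
  apply: nbhs_cpiA => [|y]; first exact: Or31.
  case=> h.
  - apply: (@filterS _ _ _ [set w | tval w < 4^-1]); first by move=> w; exact: Or31.
    by apply: nbhs_lt; rewrite h set_val_I0; lra.
  - apply: (@filterS _ _ _ [set w | 3 / 4 < tval w]); first by move=> w; exact: Or32.
    by apply: nbhs_gt; rewrite h set_val_I1; lra.
  - apply: (@filterS _ _ _ (fst @^-1` U)); first by move=> w; exact: Or33.
    by apply: nbhs_fst; rewrite h.
move=> s hs; rewrite /ususp; case: asboolP => // ms.
have hs' : allin (fst @^-1` U) (map (@csec _ L) s).
  apply/allin_map; have /allinI := conj hs ms; apply: allin_sub => q [/= Oq /andP[m1 m2]].
  by case: Oq => //; lra.
by rewrite (eq_cod (c' := fun=> false) _ hs') ?cod0// => k; exact: lift_near_point.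
Qed.

Lemma homog_ususp : homog p.+2 ususp.
Proof.
move=> s sp; rewrite /ususp; case: asboolP => // _.
apply: (@homog_cod _ p.+1) => [l lp|]; last by rewrite size_map.
by rewrite /lift hu ?if_same// size_map.
Qed.

Lemma lz_cod_ususp : lz setT (cod ususp).
Proof.
move=> q _; rewrite -(csecK q); set z := csec q.
have [Lz|nLz] := pselect (L z).
  have -> : cpi L z = susp_pt by apply/cpi_eqP; right; split=> //; exact: Or31.
  have [V Vp Vc] := ususp_near_point; exists V => // s /allinI[Vs _].
  by rewrite (eq_cod (c' := fun=> false) _ Vs) ?cod0.
have [V Vz Vc] := ususp_loc nLz.
exists [set q | V (@csec _ L q) /\ ~ L (@csec _ L q)].
  by apply: nbhs_cpi => //; exact: closed_susp_collapsed.
move=> s hs; have Vs : allin [set q | V (@csec _ L q)] s by apply: allin_sub hs => r [[]].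
rewrite (eq_cod (c' := cod lift \o map (@csec _ L)) _ Vs).
  by rewrite -cod_map cod_cod.
move=> l Vl; have Vl' : allin V (map (@csec _ L) l) by apply/allin_map.
rewrite /= -(Vc _ Vl') /ususp; congr (if _ then _ else _).
apply/esym/asbool_equiv_eq; exact: allin_map.
Qed.

Lemma ususp_pi : lz setT (fun l => ususp (map (@cpi _ L) l) (+) cod lift l).
Proof.
move=> z _; have [Lz|nLz] := pselect (L z); last first.
  have [V Vz Vc] := ususp_loc nLz.
  exists (V `&` ~` L).
    apply: filterI => //; apply: open_nbhs_nbhs; split=> //.
    by apply: closed_openC; exact: closed_susp_collapsed.
  move=> l hl; have lV : allin V l by apply: allin_sub hl => w [[]].
  have El : map (@csec _ L) (map (@cpi _ L) l) = l.
    by elim: l hl {lV} => //= w l IH [[[_ nLw] _] /IH ->]; rewrite csec_cpi.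
  rewrite /ususp El -[X in _ (+) X](Vc _ lV).
  suff -> : `[< allin (middle \o @csec _ L) (map (@cpi _ L) l) >] = `[< allin middle l >].
    by rewrite addbb.
  rewrite -[in RHS]El; apply/esym/asbool_equiv_eq; exact: allin_map.
have [V Vp Vc] := ususp_near_point.
have [V' V'z V'c] : exists2 V, nbhs z V & forall l, allin V l -> cod lift l = false.
  case: (Lz) => h.
  - by apply: cod_lift_loc; rewrite h set_val_I0 lt_eqF//; lra.
  - by apply: cod_lift_loc; rewrite h set_val_I1 gt_eqF//; lra.
  - exists (fst @^-1` U); first by apply: nbhs_fst; rewrite h.
    by move=> l hl; rewrite (eq_cod (c' := fun=> false) _ hl) ?cod0// => k; exact: lift_near_point.
exists (@cpi _ L @^-1` V `&` V').
  have E : cpi L z = susp_pt by apply/cpi_eqP; right; split => //; exact: Or31.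
  by apply: filterI => //; apply: (@cpi_continuous _ L z V); rewrite E.
move=> l hl; rewrite Vc ?V'c//; first by apply: allin_sub hl => w [[]].
by apply/allin_map; apply: allin_sub hl => w [[]].
Qed.

(** By [cod_square], the square of [cod lift] is the coboundary of [cup K lift lift] plus
    [cup K.+1 lift (cod lift)]. Combined with a primitive [v] of the square of [ususp], this gives a
    cocycle [g] on the cylinder, whose restrictions to the two ends differ by a coboundary. At the
    bottom [lift] is zero, at the top it is [u], and [v] contributes the same to both; what remains
    is [cup K u u] up to a locally zero term. *)
Lemma cobound_cup_susp K : cobound setT (cup K.+1 ususp ususp) ->
  cobound setT (cup K u u).
Proof.
move=> [v lv].
pose g s := cup K lift lift s (+) cup K.+1 lift (cod lift) s (+) v (map (@cpi _ L) s).
have lg : lz setT (cod g).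
  have l1 : lz setT (fun l => cup K.+1 (ususp \o map (@cpi _ L)) (ususp \o map (@cpi _ L)) l (+)
     cod (v \o map (@cpi _ L)) l).
    have := lz_pull (continuous_cont_on (@cpi_continuous _ L)) _ lv.
    move=> /(_ setT (fun _ _ => I)); apply: eq_lzT => s /=.
    by rewrite cup_map cod_map.
  have l2 := lz_cupl K.+1 (ususp \o map (@cpi _ L)) ususp_pi.
  have l3 := lz_cupr K.+1 (cod lift) ususp_pi.
  apply: eq_lzT (lzD (lzD l1 l2) l3) => s.
  rewrite /g codD -(cod_square K lift s) -[cod (fun s => v _) s]/(cod (v \o map (@cpi _ L)) s).
  rewrite (cupDl K.+1 (ususp \o map (@cpi _ L)) (cod lift)).
  rewrite (cupDr K.+1 (ususp \o map (@cpi _ L)) (cod lift)).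
  have x4 (a b c d : bool) : a (+) d (+) (a (+) b) (+) (b (+) c) = c (+) d by btauto.
  exact: x4.
have [h _ lh] : exists2 h, h [::] = false & lz [set: Y] (fun s =>
    (g \o map (fun z : Y * R => (z.1, clampI z.2))) (map (fun x => (x, 0)) s) (+)
    (g \o map (fun z : Y * R => (z.1, clampI z.2))) (map (fun x => (x, 1)) s) (+) cod h s).
  apply: cochain_homotopy => //.
  have cc : cont_on (cylinder [set: Y]) (fun z : Y * R => (z.1, clampI z.2) : YI).
    apply: con_pair; first by apply: con_fst; exact: con_id.
    by apply: con_clampI; apply: con_snd; exact: con_id.
  by apply: eq_lzT (lz_pull cc (fun _ _ => I) lg) => s /=; rewrite cod_map.
have l4 := lz_cupr K.+1 u lu.
exists h; apply: eq_lzT (lzD lh l4) => s /=.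
rewrite -!map_comp.
have -> : [seq ((fun z : Y * R => (z.1, clampI z.2)) \o (fun x => (x, 0))) i | i <- s] =
   [seq (i, I0 : unit_interval R) | i <- s].
  by apply: eq_map => y /=; rewrite clampI0.
have -> : [seq ((fun z : Y * R => (z.1, clampI z.2)) \o (fun x => (x, 1))) i | i <- s] =
   [seq (i, I1 : unit_interval R) | i <- s].
  by apply: eq_map => y /=; rewrite clampI1.
rewrite /g -!map_comp.
(* Both ends of the cylinder are collapsed to the base point, so the two contributions of [v]
   coincide and cancel. *)
have -> : map (@cpi _ L \o (fun i => (i, I0))) s = map (@cpi _ L \o (fun i => (i, I1))) s.
  by apply: eq_map => y; apply/cpi_eqP; right; split; [exact: Or31|exact: Or32].
have s0 : allin [set z : YI | tval z < 2^-1] [seq (i, I0 : unit_interval R) | i <- s].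
  by elim: s => //= y s IH; split => //; rewrite set_val_I0; lra.
have s1 : allin upper [seq (i, I1 : unit_interval R) | i <- s].
  by elim: s {s0} => //= y s IH; split => //; rewrite /upper /= set_val_I1; lra.
rewrite (eq_cup K (a' := fun=> false) (b' := fun=> false) _ _ s0); [|exact: lift_lower..].
rewrite (eq_cup K.+1 (a' := fun=> false) (b' := cod lift) _ _ s0); [|exact: lift_lower|by []].
rewrite !cup0l.
rewrite (eq_cup K (a' := u \o map fst) (b' := u \o map fst) _ _ s1); [|exact: lift_upper..].
rewrite (eq_cup K.+1 (a' := u \o map fst) (b' := cod u \o map fst) _ _ s1); [|exact: lift_upper|]; last first.
  by move=> l ul; rewrite (eq_cod (c' := u \o map fst) _ ul) /= ?cod_map // => k; exact: lift_upper.
rewrite -!cup_map -map_comp (_ : map (fst \o _) s = s); last by rewrite map_id_in.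
btauto.
Qed.

End suspension_step.

Lemma susp_class (R : realType) (Y : ptopologicalType) (p : nat) (u : seq Y -> bool) :
  compact [set: Y] -> closed [set (point : Y)] ->
  homog p.+1 u -> lz setT (cod u) ->
  (exists2 U, nbhs (point : Y) U & forall s, allin U s -> u s = false) ->
  exists u' : seq (susp R Y) -> bool,
   [/\ homog p.+2 u', lz setT (cod u'),
     (exists2 V, nbhs (point : susp R Y) V & forall s, allin V s -> u' s = false) &
     forall K, cobound setT (cup K.+1 u' u') -> cobound setT (cup K u u)].
Proof.
move=> cY clY hu lu [U Upt uU].
eexists; split.
- exact: (homog_ususp hu).
- exact: (lz_cod_ususp clY hu lu Upt uU).
- by have := ususp_near_point Upt uU.
- by move=> K; exact: (cobound_cup_susp cY clY hu lu Upt uU).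
Qed.

Lemma hausdorff_inj (X Y : topologicalType) (f : X -> Y) : continuous f ->
  injective f -> hausdorff_space Y -> hausdorff_space X.
Proof.
move=> cf fI hY x y clxy; apply/fI/hY => U V Ux Vy.
by have [z [? ?]] := clxy _ _ (cf x _ Ux) (cf y _ Vy); exists (f z).
Qed.

Lemma sphere_hausdorff (R : realType) k : hausdorff_space (sphere R k).
Proof.
apply: (@hausdorff_inj _ _ (@set_val _ (@sphere_set R k))).
- exact: initial_continuous.
- exact: val_inj.
- exact: norm_hausdorff.
Qed.

Lemma cobound_wedge2 (X Y : ptopologicalType) (c : seq (wedge2 X Y) -> bool) :
  hausdorff_space X -> hausdorff_space Y -> lz setT (cod c) ->
  cobound setT (c \o map (@winl X Y)) -> cobound setT (c \o map (@winr X Y)) ->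
  cobound setT c.
Proof.
move=> hX hY lc.
apply: (@cobound_wedge _ _ _ (winl Y point) point point (@winl X Y) (@winr X Y) (@wretl X Y) (@wretr X Y)) => //.
- exact: winl_continuous.
- exact: winr_continuous.
- exact: wretl_continuous.
- exact: wretr_continuous.
- by rewrite winl_point.
- exact: wretl_winl.
- exact: wretr_winl.
- by move=> w; have [[x ->]|[y ->]] := wedge2P w; rewrite ?wretl_winl// wretl_winr eqxx.
- by move=> w; have [[x ->]|[y ->]] := wedge2P w; rewrite ?wretr_winr// wretr_winl eqxx.
- move=> w; have [[x ->]|[y ->]] := wedge2P w; first by rewrite wretl_winl => ->.
  by rewrite wretr_winr winl_point => _ ->.
- exact/accessible_closed_set1/hausdorff_accessible.
- exact/accessible_closed_set1/hausdorff_accessible.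
- exact: wretr_winl.
Qed.

Lemma lz_cod_cup_square (X : topologicalType) (A : set X) k (c : seq X -> bool) :
  lz A (cod c) -> lz A (cod (cup k c c)).
Proof.
move=> lc; apply: eq_lzT (lzD (lz_cupl k c lc) (lz_cupr k c lc)) => s.
by rewrite cod_cup addbb addbF.
Qed.

(** On the first sphere the square has a length [q] in which the sphere is acyclic. On the second
    sphere the class itself is exact for dimension reasons, and the square of a coboundary is exact
    by [cod_square]. *)
Lemma cobound_cup_wedge_spheres (R : realType) (a b k q : nat)
    (c : seq (wedge2 (sphere R a) (sphere R b)) -> bool) :
  homog a.+1 c -> lz setT (cod c) ->
  (q + k.+1 = a.+1 + a.+1)%N -> q != a.+1 -> a != b ->
  cobound setT (cup k.+1 c c).
Proof.
move=> hc lc qk qa ab; apply: cobound_wedge2.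
- exact: sphere_hausdorff.
- exact: sphere_hausdorff.
- exact: lz_cod_cup_square.
- set i := @winl _ _; have ci : continuous i by exact: winl_continuous.
  apply: (acyc_sphere qa).
    move=> s sq; rewrite /= cup_map; apply: (@homog_cup _ k.+1 a.+1 a.+1 q) => //.
    1,2: exact: homog_map.
  apply: (eq_lzT (a := cod (cup k.+1 c c) \o map i)).
    by move=> s; rewrite /= cod_map.
  by apply: lz_pull (continuous_cont_on ci) _ (lz_cod_cup_square _ lc).
- set i := @winr _ _; have ci : continuous i by exact: winr_continuous.
  have ab' : a.+1 != b.+1 by rewrite eqSS.
  have [|e he] := acyc_sphere ab' (homog_map i hc).
    apply: (eq_lzT (a := cod c \o map i)); first by move=> s; rewrite /= cod_map.
    by apply: lz_pull (continuous_cont_on ci) _ lc.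
  exists (fun s => cup k e e s (+) cup k.+1 e (cod e) s).
  have l1 := lz_cupl k.+1 (c \o map i) he.
  have l2 := lz_cupr k.+1 (cod e) he.
  apply: eq_lzT (lzD l1 l2) => s.
  rewrite /= cup_map -cod_square (cupDl k.+1 (c \o map i) (cod e)) (cupDr k.+1 (c \o map i) (cod e)).
  have x3 (x y z : bool) : (x (+) y) (+) (y (+) z) = x (+) z by btauto.
  exact: x3.
Qed.

(** * The square of a degree two class over a three-set cover *)

Section three_set_cup_square.
Context {X : topologicalType}.

Lemma cup0E (a b : seq X -> bool) s : cup 0 a b s = a s && b [::].
Proof. by elim: s a => [|x s IH] a //=; rewrite IH addbF. Qed.

(** The commutator terms of [cod_cup] are [cup 0] products, which contain the value of one factor on
    the empty tuple as a factor. *)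
Lemma cod_cup1 (a b : seq X -> bool) s : a [::] = false -> b [::] = false ->
  cod (cup 1 a b) s = cup 1 (cod a) b s (+) cup 1 a (cod b) s.
Proof. by move=> a0 b0; rewrite cod_cup /= !cup0E a0 b0 !andbF !addbF. Qed.

Context (A : 'I_3 -> set X) (u : seq X -> bool) (a : 'I_3 -> seq X -> bool).
Context (acyc1 : forall i, acyc (A i) 4).
Context (acyc2 : forall i j, i != j -> acyc (A i `&` A j) 3).
Context (hu : homog 3 u) (ha : forall i, homog 2 (a i)).
Context (lua : forall i, lz (A i) (fun s => u s (+) cod (a i) s)).

Let i0 : 'I_3 := inord 0.
Let i1 : 'I_3 := inord 1.
Let i2 : 'I_3 := inord 2.

(** A zigzag through the double complex of the cover: starting from a primitive [v] of the square,
    acyclicity of the sets and then of their pairwise intersections moves the exactness down to the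
    triple intersection, where the square has become a product of two differences of the local
    primitives [a i]. *)
Lemma cup_square_on_triple : cobound setT (cup 1 u u) ->
  exists g, lz (A i0 `&` A i1 `&` A i2)
    (fun s => cup 1 (fun l => a i0 l (+) a i1 l) (fun l => a i1 l (+) a i2 l) s (+) cod g s).
Proof.
move=> cu; have hsq : homog 5 (cup 1 u u) by apply: homog_cup hu hu _.
have [v hv lv] := cobound_homog hsq cu.
have a0 i : a i [::] = false by exact: ha.
have u0 : u [::] = false by exact: hu.
have lcu i : lz (A i) (cod u).
  by apply: eq_lzT (lz_cod (@lua i)) => s; rewrite codD cod_cod addbF.
(* On [A i] both [v] and [cup 1 (a i) u] have coboundary [cup 1 u u], so their sum is closed. *)
have /choice [f hf] : forall i, exists f, homog 3 f /\
    lz (A i) (fun s => v s (+) cup 1 (a i) u s (+) cod f s).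
  move=> i; have h4 : homog 4 (fun s => v s (+) cup 1 (a i) u s).
    by apply: homogD => //; apply: homog_cup (@ha i) hu _.
  suff lc : lz (A i) (cod (fun s => v s (+) cup 1 (a i) u s)).
    by have [f hf lf] := cobound_homog h4 (acyc1 h4 lc); exists f.
  have l1 := lz_sub (@subsetT _ (A i)) lv.
  have l2 := lz_cupl 1 u (@lua i); have l3 := lz_cupr 1 (a i) (lcu i).
  apply: eq_lzT (lzD (lzD l1 l2) l3) => s.
  rewrite codD cod_cup1// (cupDl 1 u (cod (a i))); btauto.
have hfi i := (hf i).1; have lf i := (hf i).2.
pose al i j l := a i l (+) a j l.
have hal i j : homog 2 (al i j) by exact: homogD.
have lal i j : lz (A i `&` A j) (cod (al i j)).
  have := lzD (lz_sub (@subIsetl _ (A i) (A j)) (@lua i)) (lz_sub (@subIsetr _ (A i) (A j)) (@lua j)).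
  by apply: eq_lzT => s; rewrite codD; btauto.
(* On [A i] intersected with [A j], the coboundaries of [f i + f j] and of [cup 1 (a i + a j) (a j)]
   are both [cup 1 (a i + a j) u]. *)
have /choice [g hg] : forall ij : 'I_3 * 'I_3, exists g, ij.1 != ij.2 ->
    lz (A ij.1 `&` A ij.2) (fun s => f ij.1 s (+) f ij.2 s (+) cup 1 (al ij.1 ij.2) (a ij.2) s (+) cod g s).
  move=> [i j] /=; have [_|ij] := eqVneq i j; first by exists u.
  have h3 : homog 3 (fun s => f i s (+) f j s (+) cup 1 (al i j) (a j) s).
    by apply: homogD; [exact: homogD|apply: homog_cup (hal i j) (@ha j) _].
  suff lc : lz (A i `&` A j) (cod (fun s => f i s (+) f j s (+) cup 1 (al i j) (a j) s)).
    by have [g lg] := acyc2 ij h3 lc; exists g.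
  have l1 := lz_sub (@subIsetl _ (A i) (A j)) (lf i).
  have l2 := lz_sub (@subIsetr _ (A i) (A j)) (lf j).
  have l3 := lz_cupl 1 (a j) (lal i j).
  have l4 := lz_cupr 1 (al i j) (lz_sub (@subIsetr _ (A i) (A j)) (@lua j)).
  apply: eq_lzT (lzD (lzD l1 l2) (lzD l3 l4)) => s.
  rewrite !codD cod_cup1 ?/al ?a0 // (cupDr 1 u (cod (a j))) !(cupDl 1 (a i) (a j)).
  btauto.
have n01 : i0 != i1 by rewrite -val_eqE /= !inordK.
have n12 : i1 != i2 by rewrite -val_eqE /= !inordK.
have n02 : i0 != i2 by rewrite -val_eqE /= !inordK.
exists (fun s => g (i0, i1) s (+) g (i1, i2) s (+) g (i0, i2) s).
have sub i j : (A i0 `&` A i1 `&` A i2 `<=` A i `&` A j) ->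
  i != j -> lz (A i0 `&` A i1 `&` A i2) (fun s => f i s (+) f j s (+) cup 1 (al i j) (a j) s (+) cod (g (i, j)) s).
  by move=> AA ij; apply: lz_sub AA _; exact: (hg (i, j)).
have l1 := sub i0 i1 (fun x h => conj h.1.1 h.1.2) n01.
have l2 := sub i1 i2 (fun x h => conj h.1.2 h.2) n12.
have l3 := sub i0 i2 (fun x h => conj h.1.1 h.2) n02.
(* Summed over the three pairs the [f] cancel, and
   $(a_0+a_1)a_1+(a_1+a_2)a_2+(a_0+a_2)a_2=(a_0+a_1)(a_1+a_2)$ modulo 2. *)
apply: eq_lzT (lzD (lzD l1 l2) l3) => s.
rewrite !codD /al !(cupDl 1 (a _) (a _)) !(cupDr 1 (a _) (a _)).
btauto.
Qed.

End three_set_cup_square.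

(** * The first Chern class of projective space modulo 2 *)

Section projective_space.
Local Open Scope quotient_scope.
Context {R : realType} {n : nat}.
Local Notation vec := 'rV[R[i]^o]_n.+1.
Implicit Types (z w : vec) (q : CP R n).

Definition mkCP z : CP R n :=
  match pselect (z != 0) with
  | left h => \pi_(CP R n) (exist (fun x => x \in @nonzero_vec R n) _ (mem_set h))
  | right _ => point
  end.

Definition repCP q : vec := set_val (repr q : @nonzero_vec R n).

Lemma mkCPE z (h : z \in @nonzero_vec R n) :
  mkCP z = \pi_(CP R n) (exist (fun x => x \in @nonzero_vec R n) _ h).
Proof.
rewrite /mkCP; case: pselect => [h'|]; last by move/set_mem: (h).
by congr (\pi_(CP R n) _); apply: val_inj.
Qed.

Lemma repCP_neq0 q : repCP q != 0.
Proof. exact: (set_mem (valP (repr q : @nonzero_vec R n))). Qed.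

Lemma repCPK q : mkCP (repCP q) = q.
Proof.
rewrite (mkCPE (mem_set (repCP_neq0 q))) -[RHS]reprK; congr (\pi_(CP R n) _).
exact: val_inj.
Qed.

Lemma mkCP_eqP z w : z != 0 -> w != 0 ->
  mkCP z = mkCP w <-> exists2 c : R[i], c != 0 & w = c *: z.
Proof.
move=> z0 w0; rewrite (mkCPE (mem_set z0)) (mkCPE (mem_set w0)); split.
  by move/eqmodP => /asboolP[c c0 /= E]; exists c.
by move=> [c c0 E]; apply/eqmodP/asboolP; exists c.
Qed.

Lemma mkCPZ c z : c != 0 -> mkCP (c *: z) = mkCP z.
Proof.
move=> c0; have [->|z0] := eqVneq z 0; first by rewrite scaler0.
apply/esym/mkCP_eqP => //; last by exists c.
by rewrite scaler_eq0 negb_or c0.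
Qed.

Lemma repCP_mk z : z != 0 -> exists2 c : R[i], c != 0 & repCP (mkCP z) = c *: z.
Proof.
move=> z0; apply/mkCP_eqP => //; first exact: repCP_neq0.
by rewrite repCPK.
Qed.

Lemma con_mkCP (X : topologicalType) (A : set X) (f : X -> vec) :
  cont_on A f -> (forall x, A x -> f x != 0) -> cont_on A (mkCP \o f).
Proof.
move=> cf f0.
pose F x : @nonzero_vec R n := match pselect (f x != 0) with
  | left h => exist (fun x => x \in @nonzero_vec R n) _ (mem_set h)
  | right _ => repr (point : CP R n) end.
have cF : cont_on A F.
  apply: con_sub; apply: eq_cont_on cf => x Ax; rewrite /F.
  by case: pselect => // -[]; exact: f0.
apply: (@eq_cont_on _ _ A (fun x => \pi_(CP R n) (F x))).
  move=> x Ax; rewrite /F /= /mkCP; case: pselect => //= _.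
  by rewrite reprK.
apply: con_comp cF; exact: (@pi_continuous _ _).
Qed.

(** The projection from nonzero vectors is open, because multiplication by a fixed scalar is
    continuous. *)
Lemma nbhs_mkCP z (U : set vec) : z != 0 -> nbhs z U ->
  nbhs (mkCP z) [set q | exists w, [/\ U w, w != 0 & mkCP w = q]].
Proof.
move=> z0; rewrite nbhsE => -[V [oV Vz] VU].
pose O := [set q | exists w, [/\ V w, w != 0 & mkCP w = q]].
suff oO : open O.
  apply: (@filterS _ _ _ O); first by move=> q [w [/VU ? ? ?]]; exists w.
  by apply: open_nbhs_nbhs; split => //; exists z.
rewrite /open /= /quotient_open openE => -[x xP] /= [w [Vw w0 E]].
have x0 : x != 0 := set_mem xP.
move: E; rewrite -(mkCPE xP) => /(mkCP_eqP w0 x0) [c c0 xE].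
have ci0 : c^-1 != 0 by rewrite invr_eq0.
exists (@set_val _ (@nonzero_vec R n) @^-1` [set y | V (c^-1 *: y)]); split => //=.
- exists [set y : vec | V (c^-1 *: y)] => //.
  apply: (@open_comp _ _ (fun y : vec => (c^-1 : R[i]^o) *: y) V) => // y _.
  exact: scaler_continuous.
- have : V (c^-1 *: x) by rewrite xE scalerA mulVf // scale1r.
  by [].
- move=> [y yP] /= Vy; exists (c^-1 *: y); split => //.
    by rewrite scaler_eq0 negb_or ci0; exact: (set_mem yP).
  by rewrite mkCPZ // (mkCPE yP).
Qed.

(** Since the projection is open, its product with the identity of [T] is again a quotient map, so
    continuity may be tested on homogeneous coordinates. *)
Lemma con_CP (T Y : topologicalType) (A : set (CP R n * T)) (f : CP R n * T -> Y) :
  cont_on [set zt : vec * T | zt.1 != 0 /\ A (mkCP zt.1, zt.2)]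
    (fun zt => f (mkCP zt.1, zt.2)) -> cont_on A f.
Proof.
move=> cf [q t] Aqt V Vf.
have Aq : A (mkCP (repCP q), t) by rewrite repCPK.
have Vq : nbhs (f (mkCP (repCP q), t)) V by rewrite repCPK.
have [[U J] /= [Uz Jt] UJ] := cf (repCP q, t) (conj (repCP_neq0 q) Aq) V Vq.
have Uq := nbhs_mkCP (repCP_neq0 q) Uz; rewrite repCPK in Uq.
exists ([set q | exists w, [/\ U w, w != 0 & mkCP w = q]], J) => //=.
move=> [q' t'] /= [[w [Uw w0 wq]] Jt'] Aq'; rewrite -wq.
by apply: (UJ (w, t')) => //; split => //=; rewrite wq.
Qed.

Lemma con_CP1 (Y : topologicalType) (A : set (CP R n)) (f : CP R n -> Y) :
  cont_on [set z : vec | z != 0 /\ A (mkCP z)] (fun z => f (mkCP z)) -> cont_on A f.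
Proof.
move=> cf q Aq V Vf.
have Aq' : A (mkCP (repCP q)) by rewrite repCPK.
have Vq : nbhs (f (mkCP (repCP q))) V by rewrite repCPK.
have Uq := nbhs_mkCP (repCP_neq0 q) (cf (repCP q) (conj (repCP_neq0 q) Aq') V Vq).
rewrite repCPK in Uq; apply: filterS Uq => q' [w [Uw w0 wq]] Aq2.
by rewrite -wq; apply: Uw; split => //; rewrite wq.
Qed.

(** The chosen representatives [repCP] jump from point to point, but a condition invariant under
    independent rescaling of its arguments does not notice. *)
Lemma near_repCP (Q : vec -> vec -> vec -> Prop) q :
  (forall (a b c : R[i]) x y z, a != 0 -> b != 0 -> c != 0 ->
     Q x y z -> Q (a *: x) (b *: y) (c *: z)) ->
  (exists2 U, nbhs (repCP q) U & forall x y z, U x -> U y -> U z -> Q x y z) ->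
  exists2 U, nbhs q U & forall x y z : CP R n, U x -> U y -> U z ->
    Q (repCP x) (repCP y) (repCP z).
Proof.
move=> QZ [U Uq UQ]; exists [set q | exists w, [/\ U w, w != 0 & mkCP w = q]].
  by have := nbhs_mkCP (repCP_neq0 q) Uq; rewrite repCPK.
move=> x y z [x' [Ux x0 <-]] [y' [Uy y0 <-]] [z' [Uz z0 <-]].
have [a a0 ->] := repCP_mk x0; have [b b0 ->] := repCP_mk y0.
by have [c c0 ->] := repCP_mk z0; apply: QZ => //; exact: UQ.
Qed.

End projective_space.

(** * Signs of complex numbers close to the real axis *)

Section complex_tools.
Context {R : realType}.
Local Open Scope complex_scope.
Implicit Types (a b c : R[i]) (k : R).

Definition negRe c : bool := Re c < 0.
(** The numbers strictly within 45 degrees of the real axis. *)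
Definition cone c : Prop := 0 < Re (c * c).
Definition normsq c : R := Re c ^+ 2 + Im c ^+ 2.

Lemma normsq_gt0 c : c != 0 -> 0 < normsq c.
Proof.
move=> c0; rewrite lt_neqAle addr_ge0 ?sqr_ge0// andbT eq_sym.
apply: contra c0; rewrite paddr_eq0 ?sqr_ge0// !sqrf_eq0.
by case: c => x y /= /andP[/eqP-> /eqP->].
Qed.

Lemma normsq_conj c : normsq (conjc c) = normsq c.
Proof. by case: c => x y; rewrite /normsq /= sqrrN. Qed.

Lemma mulc_conj c : c * conjc c = (normsq c)%:C.
Proof.
case: c => x y; rewrite /normsq /=; apply/eqP; rewrite eq_complex /=.
by apply/andP; split; apply/eqP; ring.
Qed.

Lemma normsqM a b : normsq (a * b) = normsq a * normsq b.
Proof. by case: a => x y; case: b => z t; rewrite /normsq /=; ring. Qed.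

Lemma negRe_conj c : negRe (conjc c) = negRe c.
Proof. by case: c. Qed.

Lemma negRe_scale k c : 0 < k -> negRe (k%:C * c) = negRe c.
Proof.
by move=> k0; case: c => x y; rewrite /negRe /= mul0r subr0 pmulr_rlt0.
Qed.

(** In the cone the imaginary part is smaller than the real part in absolute value, so the product
    of the real parts decides the sign of the real part of [a * b]. *)
Lemma negReM a b : cone a -> cone b -> negRe (a * b) = negRe a (+) negRe b.
Proof.
case: a => p q; case: b => r s; rewrite /cone /negRe /= => h1 h2.
have : `|q * s| < `|p * r|.
  rewrite !normrM; apply: ltr_pM => //.
  - by rewrite -ltr_sqr ?nnegrE// !real_normK ?num_real// !expr2; lra.
  - by rewrite -ltr_sqr ?nnegrE// !real_normK ?num_real// !expr2; lra.
have := ler_norm (q * s); have := ler_norm (- (q * s)); rewrite normrN.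
have p0 : p != 0 by apply/eqP => p0; move: h1; rewrite p0; nra.
have r0 : r != 0 by apply/eqP => r0; move: h2; rewrite r0; nra.
move: p0 r0; rewrite !neq_lt => /orP[p0|p0] /orP[r0|r0] i1 i2.
- have pr : 0 < p * r by nra.
  by rewrite (gtr0_norm pr) p0 r0 => i3; apply/negbTE; rewrite -leNgt; lra.
- have pr : p * r < 0 by nra.
  by rewrite (ltr0_norm pr) p0 (ltNge r) (ltW r0) => i3; have -> : p * r - q * s < 0 by lra.
- have pr : p * r < 0 by nra.
  by rewrite (ltr0_norm pr) r0 (ltNge p) (ltW p0) => i3; have -> : p * r - q * s < 0 by lra.
- have pr : 0 < p * r by nra.
  rewrite (gtr0_norm pr) (ltNge r) (ltNge p) (ltW r0) (ltW p0) => i3.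
  by apply/negbTE; rewrite -leNgt; lra.
Qed.

Lemma negRe_quad a b c d k l : cone a -> cone b -> cone c -> cone d ->
  0 < k -> 0 < l -> k%:C * (a * b) = l%:C * (c * d) ->
  negRe a (+) negRe b = negRe c (+) negRe d.
Proof.
move=> ca cb cc cd k0 l0 E.
by rewrite -!negReM// -(negRe_scale (a * b) k0) E negRe_scale.
Qed.

Lemma cone_conj c : cone c -> cone (conjc c).
Proof. by case: c => x y; rewrite /cone /= !mulNr !mulrN !opprK. Qed.

Context {X : topologicalType} (A : set X).
Implicit Types f g : X -> R[i].

Definition con_onC f := cont_on A (f : X -> R[i]^o).

Lemma con_DC f g : con_onC f -> con_onC g -> con_onC (fun x => f x + g x).
Proof. by move=> cf cg x Ax; apply: (@cvgD _ _ _ (within A (nbhs x))); [exact: cf|exact: cg]. Qed.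

Lemma con_MC f g : con_onC f -> con_onC g -> con_onC (fun x => f x * g x).
Proof. by move=> cf cg x Ax; apply: (@cvgM _ _ (within A (nbhs x))); [exact: cf|exact: cg]. Qed.

Lemma con_cstC (c : R[i]) : con_onC (fun _ => c).
Proof. exact: con_cst. Qed.

Lemma con_ReC f : con_onC f -> cont_on A (fun x => Re (f x)).
Proof. exact: con_Re. Qed.

Lemma con_ImC f : con_onC f -> cont_on A (fun x => Im (f x)).
Proof. exact: con_Im. Qed.

Lemma con_complexC (u v : X -> R) : cont_on A u -> cont_on A v ->
  con_onC (fun x => u x +i* v x).
Proof. exact: con_complex. Qed.

Lemma con_real (u : X -> R) : cont_on A u -> con_onC (fun x => (u x)%:C).
Proof. by move=> cu; apply: con_complex => //; exact: con_cst. Qed.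

Lemma con_conj f : con_onC f -> con_onC (fun x => conjc (f x)).
Proof.
move=> cf; apply: (@eq_cont_on _ _ A (fun x => (Re (f x) +i* - Im (f x) : R[i]^o))).
  by move=> x _; case: (f x).
by apply: con_complex; [exact: con_Re|apply: con_N; exact: con_Im].
Qed.

Lemma con_sumC (I : Type) (r : seq I) (P : pred I) (F : I -> X -> R[i]) :
  (forall i, con_onC (F i)) -> con_onC (fun x => \sum_(i <- r | P i) F i x).
Proof.
move=> cF; elim: r => [|i r IH].
  by under [X in con_onC X]funext do rewrite big_nil; exact: con_cst.
under [X in con_onC X]funext do rewrite big_cons.
by case: (P i); [exact: (con_DC (cF i) IH)|exact: IH].
Qed.

Lemma con_normsq f : con_onC f -> cont_on A (fun x => normsq (f x)).
Proof. by move=> cf; apply: con_D; apply: con_X; [exact: con_Re|exact: con_Im]. Qed.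

Lemma con_gt0 (f : X -> R) x : cont_on setT f -> 0 < f x ->
  nbhs x [set y | 0 < f y].
Proof.
move=> cf fx; have := cf x I [set t | 0 < t] (open_nbhs_nbhs (conj (@open_gt _ _) fx)).
by apply: filterS => y; apply.
Qed.

End complex_tools.

Section hermitian.
Context {R : realType} {n : nat}.
Local Open Scope complex_scope.
Local Notation vec := 'rV[R[i]^o]_n.+1.
Implicit Types x y z : vec.

Definition co z i : R[i] := z 0 i.
Definition hdot x y : R[i] := \sum_i co x i * conjc (co y i).
Definition vnormsq z : R := \sum_i normsq (co z i).

Lemma coZ (c : R[i]) z i : co (c *: z) i = c * co z i.
Proof. by rewrite /co mxE. Qed.

Lemma vec_neq0 z : z != 0 -> exists i, co z i != 0.
Proof.
move=> z0; apply/existsP; apply: contraTT z0 => /existsPn h.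
by rewrite negbK; apply/eqP/rowP => i; rewrite mxE; apply/eqP; have := h i; rewrite negbK.
Qed.

Lemma co_neq0 z i : co z i != 0 -> z != 0.
Proof. by apply: contra => /eqP ->; rewrite /co mxE. Qed.

Lemma hdotZ (a b : R[i]) x y : hdot (a *: x) (b *: y) = a * conjc b * hdot x y.
Proof.
rewrite /hdot mulr_sumr; apply: eq_bigr => i _; rewrite !coZ rmorphM /=.
by rewrite mulrACA.
Qed.

Lemma hdot_sq z : hdot z z = (vnormsq z)%:C.
Proof.
rewrite /hdot /vnormsq rmorph_sum /=; apply: eq_bigr => i _.
exact: mulc_conj.
Qed.

Lemma vnormsq_gt0 z : z != 0 -> 0 < vnormsq z.
Proof.
move=> /vec_neq0[i zi]; rewrite /vnormsq (bigD1 i) //= ltr_pwDl//.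
  exact: normsq_gt0.
by apply: sumr_ge0 => j _; rewrite addr_ge0 ?sqr_ge0.
Qed.

Context {X : topologicalType} (A : set X).

Lemma con_co (f : X -> vec) i : cont_on A f -> con_onC A (fun t => co (f t) i).
Proof. exact: con_coordC. Qed.

Lemma con_hdot (f g : X -> vec) : cont_on A f -> cont_on A g ->
  con_onC A (fun t => hdot (f t) (g t)).
Proof.
move=> cf cg; apply: (@con_sumC R X A _ _ _ (fun i t => co (f t) i * conjc (co (g t) i))) => i.
by apply: con_MC; [exact: con_co|apply: con_conj; exact: con_co].
Qed.

Lemma con_vnormsq (f : X -> vec) : cont_on A f -> cont_on A (fun t => vnormsq (f t)).
Proof. by move=> cf; apply: con_sum => i; apply: con_normsq; exact: con_co. Qed.

End hermitian.

(** * The cocycle of the Chern class and its local primitives *)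

Section chern_cocycle.
Context {R : realType} {n : nat}.
Local Open Scope complex_scope.
Local Notation vec := 'rV[R[i]^o]_n.+1.
Implicit Types (x y z t : CP R n) (s : seq (CP R n)).

Lemma near_diag3 (X : topologicalType) (P : set (X * X * X)) (x : X) :
  nbhs (x, x, x) P -> exists2 U, nbhs x U &
    forall a b c, U a -> U b -> U c -> P (a, b, c).
Proof.
move=> [[UV W] /= [[[U V] /= [Ux Vx] UVs] Wx] sub].
exists (U `&` V `&` W); first by apply: filterI => //; exact: filterI.
move=> a b c [[Ua _] _] [[_ Vb] _] [_ Wc]; apply: sub; split => //=.
exact: UVs.
Qed.

Definition hp x y : R[i] := hdot (repCP x) (repCP y).
Definition hcoord (i : 'I_n.+1) x : R[i] := co (repCP x) i.
(** The square root is chosen pointwise and without continuity, which Alexander-Spanier cochains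
    permit. *)
Definition rho x y : R[i] := sqrtc (hp x y).
Definition kap i x : R[i] := sqrtc (hcoord i x).
(** Its square is [hp x y * hp y z * conjc (hp x z)], which has positive real part for close points.
    So [w3] lies in the cone and its sign is meaningful. *)
Definition w3 x y z : R[i] := rho x y * rho y z * conjc (rho x z).
Definition m2 i x y : R[i] := rho x y * (conjc (kap i x) * kap i y).

(* A cocycle for the mod 2 reduction of the first Chern class: the sign by    *)
(* which chosen square roots of the transition phases fail to multiply.       *)
Definition chern s : bool := if s is [:: x; y; z] then negRe (w3 x y z) else false.
Definition chart_cochain i s : bool := if s is [:: x; y] then negRe (m2 i x y) else false.

Lemma homog_chern : homog 3 chern. Proof. by case=> [|x [|y [|z []]]]. Qed.
Lemma homog_chart_cochain i : homog 2 (chart_cochain i). Proof. by case=> [|x [|y []]]. Qed.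

Lemma sqrtcK (c : R[i]) : sqrtc c * sqrtc c = c.
Proof. by rewrite -expr2 sqr_sqrtc. Qed.

Lemma sqrtc_neq0 (c : R[i]) : c != 0 -> sqrtc c != 0.
Proof. by rewrite sqrtc_eq0. Qed.

Lemma Re_scale (k : R) (c : R[i]) : Re (k%:C * c) = k * Re c.
Proof. by case: c => a b /=; rewrite mul0r subr0. Qed.

(** Each vector enters once linearly and once antilinearly, so rescaling multiplies the product by a
    positive number; on the diagonal it is the cube of [vnormsq]. *)
Lemma near_triple (q : CP R n) : exists2 U, nbhs q U & forall x y z, U x -> U y -> U z ->
  0 < Re (hp x y * hp y z * conjc (hp x z)).
Proof.
apply: (@near_repCP R n (fun x y z : vec => 0 < Re (hdot x y * hdot y z * conjc (hdot x z))) q).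
  move=> a b c x y z a0 b0 c0 h; rewrite !hdotZ.
  rewrite (_ : _ * _ * _ = (normsq a * normsq b * normsq c)%:C *
     (hdot x y * hdot y z * conjc (hdot x z))).
    by rewrite Re_scale mulr_gt0// !mulr_gt0// normsq_gt0.
  rewrite !rmorphM /= -!mulc_conj conjcK; ring.
apply: (@near_diag3 _ [set abc : vec * vec * vec | 0 < Re (hdot abc.1.1 abc.1.2 *
   hdot abc.1.2 abc.2 * conjc (hdot abc.1.1 abc.2))]).
apply: con_gt0.
  have c11 : cont_on [set: vec * vec * vec] (fun abc => abc.1.1).
    by apply: con_fst; apply: con_fst; exact: con_id.
  have c12 : cont_on [set: vec * vec * vec] (fun abc => abc.1.2).
    by apply: con_snd; apply: con_fst; exact: con_id.
  have c2 : cont_on [set: vec * vec * vec] (fun abc => abc.2).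
    by apply: con_snd; exact: con_id.
  exact: (con_ReC (con_MC (con_MC (con_hdot c11 c12) (con_hdot c12 c2)) (con_conj (con_hdot c11 c2)))).
have v0 := vnormsq_gt0 (repCP_neq0 q).
by rewrite /= !hdot_sq conjc_real -!rmorphM /= !mulr_gt0.
Qed.

Lemma near_pair i (q : CP R n) : hcoord i q != 0 -> exists2 U, nbhs q U &
  forall x y, U x -> U y -> 0 < Re (hp x y * (conjc (hcoord i x) * hcoord i y)).
Proof.
move=> qi.
suff [U Uq h] : exists2 U, nbhs q U & forall x y z, U x -> U y -> U z ->
    0 < Re (hdot (repCP x) (repCP y) * (conjc (co (repCP x) i) * co (repCP y) i)).
  by exists U => // x y Ux Uy; apply: (h x y y).
apply: (@near_repCP R n (fun x y z : vec => 0 < Re (hdot x y * (conjc (co x i) * co y i))) q).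
- move=> a b c x y z a0 b0 c0 h; rewrite !hdotZ !coZ.
  rewrite (_ : _ * _ * _ = (normsq a * normsq b)%:C *
     (hdot x y * (conjc (co x i) * co y i))).
    by rewrite Re_scale mulr_gt0// mulr_gt0// normsq_gt0.
  rewrite !rmorphM /= -!mulc_conj; ring.
- apply: (@near_diag3 _ [set abc : vec * vec * vec | 0 < Re (hdot abc.1.1 abc.1.2 *
   (conjc (co abc.1.1 i) * co abc.1.2 i))]).
  apply: con_gt0.
    have c11 : cont_on [set: vec * vec * vec] (fun abc => abc.1.1).
      by apply: con_fst; apply: con_fst; exact: con_id.
    have c12 : cont_on [set: vec * vec * vec] (fun abc => abc.1.2).
      by apply: con_snd; apply: con_fst; exact: con_id.
    exact: (con_ReC (con_MC (con_hdot c11 c12) (con_MC (con_conj (con_co (i := i) c11)) (con_co (i := i) c12)))).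
  have v0 := vnormsq_gt0 (repCP_neq0 q).
  by rewrite /= hdot_sq [conjc _ * _]mulrC mulc_conj -rmorphM /= mulr_gt0// normsq_gt0.
Qed.

Lemma cone_w3 x y z : 0 < Re (hp x y * hp y z * conjc (hp x z)) -> cone (w3 x y z).
Proof.
rewrite /cone => h; rewrite (_ : _ * _ = hp x y * hp y z * conjc (hp x z)) //.
rewrite -(sqrtcK (hp x y)) -(sqrtcK (hp y z)) -(sqrtcK (hp x z)) rmorphM /= /w3 /rho.
ring.
Qed.

Lemma cone_m2 i x y : 0 < Re (hp x y * (conjc (hcoord i x) * hcoord i y)) -> cone (m2 i x y).
Proof.
rewrite /cone => h; rewrite (_ : _ * _ = hp x y * (conjc (hcoord i x) * hcoord i y)) //.
rewrite -(sqrtcK (hp x y)) -(sqrtcK (hcoord i x)) -(sqrtcK (hcoord i y)) rmorphM /= /m2 /rho /kap.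
ring.
Qed.

Lemma rho_neq0 x y z : 0 < Re (hp x y * hp y z * conjc (hp x z)) -> 0 < normsq (rho x z).
Proof.
move=> h; apply: normsq_gt0; apply: sqrtc_neq0; apply/eqP => E.
by move: h; rewrite E conjc0 mulr0 ltxx.
Qed.

(** On a small quadruple the four [w3] multiply up in two pairs whose products agree up to the
    positive factors [normsq (rho x z)] and [normsq (rho y t)]; signs are multiplicative in the
    cone. *)
Lemma lz_cod_chern : lz setT (cod chern).
Proof.
move=> q _; have [U Uq h] := near_triple q; exists U => //.
move=> s; have [s4|/(homog_cod homog_chern) -> //] := eqVneq (size s) 4%N.
case: s s4 => [|x [|y [|z [|t []]]]] //= _ [[Ux _] [[Uy _] [[Uz _] [[Ut _] _]]]].
rewrite !addbF.
have E : negRe (w3 y z t) (+) negRe (w3 x y t) = negRe (w3 x z t) (+) negRe (w3 x y z).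
  apply: (@negRe_quad _ _ _ _ _ (normsq (rho x z)) (normsq (rho y t))).
  1-4: by apply: cone_w3; exact: h.
  - by apply: (@rho_neq0 x y z); exact: h.
  - by apply: (@rho_neq0 y z t); exact: h.
  - by rewrite -!mulc_conj /w3; ring.
by move: E; do ![case: (negRe _)].
Qed.

(** Where $z_i\ne0$, the square root [kap i] of the coordinate corrects [rho x y] to [m2 i x y],
    which lies in the cone for close points. The product of two consecutive [m2] is [w3] times the
    third one, up to positive factors. *)
Lemma lz_chart_cochain i (A : set (CP R n)) : (forall x, A x -> hcoord i x != 0) ->
  lz A (fun s => chern s (+) cod (chart_cochain i) s).
Proof.
move=> Ai q Aq; have [U Uq h] := near_triple q.
have [V Vq k] := near_pair (Ai q Aq).
exists (U `&` V); first exact: filterI.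
move=> s; have [s3|s3] := eqVneq (size s) 3%N; last first.
  by rewrite homog_chern// (homog_cod (@homog_chart_cochain i)).
case: s s3 => [|x [|y [|z []]]] //= _ [[[Ux Vx] _] [[[Uy Vy] _] [[[Uz Vz] _] _]]]; rewrite !addbF.
have E : negRe (m2 i y z) (+) negRe (m2 i x y) = negRe (w3 x y z) (+) negRe (m2 i x z).
  have kap_gt0 : 0 < normsq (kap i y).
    apply/normsq_gt0/sqrtc_neq0/eqP => E.
    by move: (k y y Vy Vy); rewrite E mulr0 mulr0 ltxx.
  apply: (@negRe_quad _ _ _ _ _ (normsq (rho x z)) (normsq (kap i y))) => //.
  1,2,4: by apply: cone_m2; exact: k.
  - by apply: cone_w3; exact: h.
  - by apply: (@rho_neq0 x y z); exact: h.
  - by rewrite -!mulc_conj /w3 /m2; ring.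
by move: E; do ![case: (negRe _)].
Qed.

(** A square root of $z_i\bar z_j$: its sign change around a loop is the winding number of $z_i/z_j$
    modulo 2. By [lz_chart_sum], two chart primitives differ by the corresponding cocycle. *)
Definition phase i j x : R[i] := kap i x * conjc (kap j x).

Lemma lz_chart_sum i j (A : set (CP R n)) :
  (forall x, A x -> hcoord i x != 0) -> (forall x, A x -> hcoord j x != 0) ->
  lz A (fun s => chart_cochain i s (+) chart_cochain j s (+)
    if s is [:: x; y] then negRe (conjc (phase i j x) * phase i j y) else false).
Proof.
move=> Ai Aj q Aq.
have [V Vq k] := near_pair (Ai q Aq); have [V' Vq' k'] := near_pair (Aj q Aq).
exists (V `&` V'); first exact: filterI.
case=> [|x [|y [|z s]]] //= [[[Vx Vx'] _] [[[Vy Vy'] _] _]].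
rewrite -[negRe (m2 j x y)]negRe_conj -negReM; [|exact/cone_m2/k|exact/cone_conj/cone_m2/k'].
have r0 : 0 < normsq (rho x y).
  apply/normsq_gt0/sqrtc_neq0/eqP => E.
  by move: (k x y Vx Vy); rewrite E mul0r ltxx.
rewrite (_ : m2 i x y * _ = (normsq (rho x y))%:C * (conjc (phase i j x) * phase i j y)).
  by rewrite negRe_scale// addbb.
rewrite -mulc_conj /m2 /phase !rmorphM /= !conjcK; ring.
Qed.

End chern_cocycle.

(** * Compact charts of projective space and their intersections *)

Section projective_charts.
Context {R : realType} {n : nat}.
Local Open Scope complex_scope.
Local Notation vec := 'rV[R[i]^o]_n.+1.
Implicit Types (x y : CP R n) (z w : vec) (i j : 'I_n.+1).

Lemma compact_CP : compact [set: CP R n].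
Proof.
pose f (ab : 'rV[R]_n.+1 * 'rV[R]_n.+1) : CP R n :=
  mkCP (\row_j (ab.1 0 j +i* ab.2 0 j) : vec).
pose D := [set a : 'rV[R]_n.+1 | `|a| <= 1].
pose K := (D `*` D) `&` [set ab | Num.max `|ab.1| `|ab.2| = 1].
have cD : compact D := @compact_cube R n.+1.
have cK : compact K.
  apply: compact_closedI; first exact: compact_setX.
  apply: (@preimage_closed _ _ (fun ab : 'rV[R]_n.+1 * 'rV[R]_n.+1 => Num.max `|ab.1| `|ab.2|) [set 1]); last exact: closed_eq.
  move=> ab _.
  have : cont_on setT (fun ab : 'rV[R]_n.+1 * 'rV[R]_n.+1 => Num.max `|ab.1| `|ab.2|).
    apply: con_max; apply: con_norm; [apply: con_fst|apply: con_snd]; exact: con_id.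
  by move=> h V Vab; have := h ab I V Vab; apply: filterS => c; apply.
have nz (ab : 'rV[R]_n.+1 * 'rV[R]_n.+1) : ab != 0 ->
   (\row_j (ab.1 0 j +i* ab.2 0 j) : vec) != 0.
  apply: contra => /eqP/rowP E; apply/eqP.
  case: ab E => a b E; congr (_, _); apply/rowP => j; rewrite mxE;
  by have := E j; rewrite !mxE => -[].
have -> : [set: CP R n] = f @` K.
  apply/seteqP; split=> // q _.
  pose a : 'rV[R]_n.+1 := \row_j Re (co (repCP q) j).
  pose b : 'rV[R]_n.+1 := \row_j Im (co (repCP q) j).
  have E : repCP q = \row_j (a 0 j +i* b 0 j).
    by apply/rowP => j; rewrite !mxE /co; case: (repCP q 0 j).
  pose M := Num.max `|a| `|b|.
  have M0 : 0 < M.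
    rewrite lt_max !normr_gt0; have := repCP_neq0 q; rewrite E.
    apply: contraTT; rewrite negb_or !negbK => /andP[/eqP-> /eqP->].
    by apply/eqP/rowP => j; rewrite !mxE.
  have nM (d : 'rV[R]_n.+1) : `|M^-1 *: d| = M^-1 * `|d|.
    by rewrite normrZ gtr0_norm ?invr_gt0.
  exists (M^-1 *: a, M^-1 *: b).
    split; first by split; rewrite /D /= nM ler_pdivrMl// mulr1 le_max lexx ?orbT.
    by rewrite /= !nM -maxr_pMr ?invr_ge0 ?ltW// mulVf// gt_eqF.
  rewrite -[RHS]repCPK E -(@mkCPZ _ _ (M^-1)%:C); last first.
    by rewrite eq_complex /= eqxx andbT invr_eq0 gt_eqF.
  congr mkCP; apply/rowP => j; rewrite !mxE.
  by apply/eqP; rewrite eq_complex /= !mul0r subr0 addr0 !eqxx.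
apply: continuous_compact cK; apply/cont_onP; apply: con_mkCP.
  apply: con_mx => i j; under [X in cont_on _ X]funext do rewrite mxE.
  by apply: con_complex; apply: con_coord; [apply: con_fst|apply: con_snd]; exact: con_id.
move=> ab [_ /= h]; apply: nz; apply: contra_eq_neq h => ->.
by rewrite /= !normr0 maxxx eq_sym oner_neq0.
Qed.

(** Dividing by the squared norm makes the size of a coordinate a well-defined continuous function
    on projective space. *)
Definition ratio j x : R := normsq (hcoord j x) / vnormsq (repCP x).

Lemma normsqC (k : R) : normsq k%:C = k ^+ 2.
Proof. by rewrite /normsq /= [0 ^+ 2]expr0n addr0. Qed.

Lemma vnormsqZ (c : R[i]) z : vnormsq (c *: z) = normsq c * vnormsq z.
Proof. by rewrite /vnormsq mulr_sumr; apply: eq_bigr => i _; rewrite coZ normsqM. Qed.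

Lemma ratio_mk j z : z != 0 -> ratio j (mkCP z) = normsq (co z j) / vnormsq z.
Proof.
move=> z0; have [c c0 E] := repCP_mk z0.
rewrite /ratio /hcoord E coZ normsqM vnormsqZ -mulf_div divff ?mul1r//.
by rewrite gt_eqF// normsq_gt0.
Qed.

Lemma con_ratio j (A : set (CP R n)) : cont_on A (ratio j).
Proof.
apply: con_CP1.
apply: (@eq_cont_on _ _ _ (fun z : vec => normsq (co z j) / vnormsq z)).
  by move=> z [z0 _]; rewrite ratio_mk.
apply: con_M; first by apply: con_normsq; apply: con_co; exact: con_id.
apply: con_V; first by apply: con_vnormsq; exact: con_id.
by move=> z [z0 _]; rewrite gt_eqF// vnormsq_gt0.
Qed.

Definition chart i : set (CP R n) := [set x | forall j, ratio j x <= ratio i x].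

Lemma chart_mk i z : z != 0 ->
  chart i (mkCP z) <-> (forall j, normsq (co z j) <= normsq (co z i)).
Proof.
by move=> z0; split=> h j; have := h j; rewrite !ratio_mk// ler_pM2r// invr_gt0 vnormsq_gt0.
Qed.

Lemma chartP i x : chart i x <-> (forall j, normsq (hcoord j x) <= normsq (hcoord i x)).
Proof. by rewrite -{1}(repCPK x) chart_mk// repCP_neq0. Qed.

Lemma chart_neq0 i x : chart i x -> hcoord i x != 0.
Proof.
move=> /chartP h; apply/eqP => E; have [j xj] := vec_neq0 (repCP_neq0 x).
have := h j; rewrite E /normsq /= expr0n addr0 leNgt.
by rewrite -/(normsq _) normsq_gt0.
Qed.

Lemma closed_chart i : closed (chart i).
Proof.
have -> : chart i = \bigcap_(j in setT) [set x | ratio j x - ratio i x <= 0].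
  apply/seteqP; split=> x h j; first by move=> _; rewrite /= subr_le0; exact: h.
  by have := h j I; rewrite /= subr_le0.
apply: closed_bigI => j _.
apply: (@preimage_closed _ _ (fun x => ratio j x - ratio i x) [set t | t <= 0]); last exact: closed_le.
have c := con_D (@con_ratio j setT) (con_N (@con_ratio i setT)).
by move=> x _ V Vx; have := c x I V Vx; apply: filterS => y; apply.
Qed.

Lemma compact_chartI (P : set (CP R n)) : closed P -> compact P.
Proof. by move=> cP; rewrite -[P]setTI; apply: compact_closedI => //; exact: compact_CP. Qed.

Definition shrink (S : pred 'I_n.+1) (t : R) z : vec :=
  \row_j (if S j then ((1 - t)%:C * co z j : R[i]) else co z j).

Lemma co_shrink S t z j :
  co (shrink S t z) j = if S j then (1 - t)%:C * co z j else co z j.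
Proof. by rewrite /co mxE. Qed.

Definition shrinkCP S (xt : CP R n * R) : CP R n := mkCP (shrink S xt.2 (repCP xt.1)).

Lemma shrinkZ S t (c : R[i]) z : shrink S t (c *: z) = c *: shrink S t z.
Proof.
apply/rowP => j; rewrite -[LHS]/(co _ j) -[RHS]/(co _ j) coZ !co_shrink coZ.
by case: (S j) => //; rewrite mulrCA.
Qed.

Lemma shrinkCP_mk S t z : z != 0 -> shrinkCP S (mkCP z, t) = mkCP (shrink S t z).
Proof. by move=> z0; rewrite /shrinkCP /=; have [c c0 ->] := repCP_mk z0; rewrite shrinkZ mkCPZ. Qed.

Lemma shrink_neq0 S t z i : ~~ S i -> co z i != 0 -> shrink S t z != 0.
Proof. by move=> Si zi; apply: (@co_neq0 _ _ _ i); rewrite co_shrink (negbTE Si). Qed.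

Lemma con_shrinkCP S i (A : set (CP R n)) : ~~ S i -> (forall x, A x -> hcoord i x != 0) ->
  cont_on (cylinder (R := R) A) (shrinkCP S).
Proof.
move=> Si A0; apply: con_CP.
apply: (@eq_cont_on _ _ _ (fun zt : vec * R => mkCP (shrink S zt.2 zt.1))).
  by move=> [z t] [/= z0 _]; rewrite shrinkCP_mk.
apply: con_mkCP.
  apply: con_mx => k j; rewrite /shrink; under [X in cont_on _ X]funext do rewrite mxE.
  have cz : cont_on [set zt : vec * R | zt.1 != 0 /\ cylinder A (mkCP zt.1, zt.2)] (fun zt => co zt.1 j : R[i]^o).
    by apply: con_co; apply: con_fst; exact: con_id.
  case: (S j); last exact: cz.
  apply: (@con_MC R _ _ (fun zt : vec * R => (1 - zt.2)%:C) (fun zt => co zt.1 j)); last exact: cz.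
  apply: con_real.
  by apply: con_D; [exact: con_cst|apply: con_N; apply: con_snd; exact: con_id].
move=> [z t] [/= z0 [/= Az _]]; apply: (@shrink_neq0 _ _ _ i Si).
have := A0 _ Az; rewrite /hcoord; have [c c0 ->] := repCP_mk z0.
by rewrite coZ mulf_eq0 (negbTE c0).
Qed.

Lemma shrinkCP0 S x : shrinkCP S (x, 0) = x.
Proof.
rewrite /shrinkCP /= -[RHS]repCPK; congr mkCP; apply/rowP => j.
by rewrite mxE subr0 mul1r if_same.
Qed.

Lemma normsq_shrink S t z j : 0 <= t <= 1 ->
  normsq (co (shrink S t z) j) <= normsq (co z j).
Proof.
move=> /andP[t0 t1]; rewrite co_shrink; case: (S j) => //.
rewrite normsqM normsqC ler_piMl ?addr_ge0 ?sqr_ge0//.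
by rewrite expr_le1//; lra.
Qed.

Lemma shrink_chart S i x t : ~~ S i -> 0 <= t <= 1 -> chart i x ->
  chart i (shrinkCP S (x, t)).
Proof.
move=> Si t01 Ax; have xi := chart_neq0 Ax; have /chartP h := Ax.
apply/chart_mk; first exact: (shrink_neq0 _ Si xi).
move=> j; apply: le_trans (normsq_shrink _ _ _ t01) _.
by rewrite [in leRHS]co_shrink (negbTE Si); exact: h.
Qed.

(** Where $|z_i|$ is maximal, scaling the other coordinates to 0 contracts the chart to a point. *)
Lemma acyc_chart i p : acyc (chart i) p.
Proof.
apply: (@acyc_deform R _ (chart i) [set mkCP (delta_mx 0 i : vec)] (shrinkCP (predC1 i)) p).
- exact/compact_chartI/closed_chart.
- move=> _ ->; apply/chart_mk.
    by apply: (@co_neq0 _ _ _ i); rewrite /co mxE !eqxx oner_neq0.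
  move=> j; rewrite /co !mxE !eqxx /=.
  by case: (j == i); rewrite /normsq /= ?expr0n ?expr1n ?addr0.
- by apply: (@con_shrinkCP _ i) => [|x]; [rewrite /= eqxx|exact: chart_neq0].
- move=> [x t] [/= Ax]; rewrite in_itv /= => t01.
  by apply: shrink_chart => //; rewrite /= eqxx.
- by move=> x _; exact: shrinkCP0.
- move=> x Ax /=; have xi := chart_neq0 Ax.
  rewrite /shrinkCP /= -(@mkCPZ _ _ (hcoord i x) (delta_mx 0 i))//; congr mkCP.
  apply/rowP => j; rewrite -[LHS]/(co _ j) -[RHS]/(co _ j) co_shrink coZ.
  rewrite [co (delta_mx _ _) _]/co mxE eqxx /= subrr mul0r.
  by case: eqP => [->|_] /=; rewrite ?mulr1 ?mulr0.
- exact: acyc_point.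
Qed.

Lemma to_sphereZ_vec k (y : 'rV[R]_k.+1) a : 0 < a -> y != 0 -> to_sphere (a *: y) = to_sphere y.
Proof.
move=> a0 y0; have E : y = Num.sqrt (sqnorm y) *: set_val (to_sphere y).
  rewrite val_to_sphere// scalerA divff ?scale1r//.
  rewrite sqrtr_eq0 -ltNge lt_neqAle sqnorm_ge0 andbT eq_sym.
  by apply: contra y0 => /eqP /sqnorm_eq0 ->.
have s0 : 0 < Num.sqrt (sqnorm y).
  rewrite sqrtr_gt0 lt_neqAle sqnorm_ge0 andbT eq_sym.
  by apply: contra y0 => /eqP /sqnorm_eq0 ->.
by rewrite {1}E scalerA to_sphereZ// mulr_gt0.
Qed.

Definition reim (c : R[i]) : 'rV[R]_2 := \row_l (if l == 0 then Re c else Im c).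

Lemma reim_neq0 c : c != 0 -> reim c != 0.
Proof.
apply: contra => /eqP/rowP E; move: (E 0) (E 1); rewrite !mxE /= => {E}.
by case: c => a b /= -> ->.
Qed.

Lemma reimZ (k : R) c : reim (k%:C * c) = k *: reim c.
Proof.
apply/rowP => l; rewrite !mxE; case: c => a b /=.
by rewrite !mul0r subr0 addr0; case: (l == 0).
Qed.

(** Shrinking the remaining coordinates leaves the circle $|z_i|=|z_j|$ with all others zero; the
    excluded length 2 is its degree 1. *)
Lemma acyc_chartI i j p : i != j -> p != 2%N -> acyc (chart i `&` chart j) p.
Proof.
move=> ij p2; have ji : (j == i) = false by rewrite eq_sym (negbTE ij).
pose S := [pred l | (l != i) && (l != j)].
have Si : ~~ S i by rewrite /= eqxx.
have Sj : ~~ S j by rewrite /= eqxx andbF.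
pose B := (chart i `&` chart j) `&` [set x | forall l, S l -> hcoord l x = 0].
apply: (@acyc_deform R _ _ B (shrinkCP S) p).
- by apply: compact_chartI; apply: closedI; exact: closed_chart.
- by move=> x [].
- by apply: (@con_shrinkCP _ i) => // x [Ai _]; exact: chart_neq0.
- by move=> [x t] [/= [Ai Aj]]; rewrite in_itv /= => t01; split; exact: shrink_chart.
- by move=> x _; exact: shrinkCP0.
- move=> x [Ai Aj]; have t1 : 0 <= (1 : R) <= 1 by rewrite ler01 lexx.
  split; first by split; exact: shrink_chart.
  move=> l Sl; rewrite /shrinkCP /hcoord.
  have [|c c0 ->] := @repCP_mk _ _ (shrink S 1 (repCP x)).
    exact: (shrink_neq0 _ Si (chart_neq0 Ai)).
  by rewrite coZ co_shrink Sl subrr mul0r mulr0.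
(* [f] reads off the direction of $z_i\bar z_j$; [gv] restores the point from it with $z_j=1$. *)
pose f x : sphere R 1 := to_sphere (reim (hcoord i x * conjc (hcoord j x))).
pose gv (y : sphere R 1) : vec := \row_l (if l == i then set_val y 0 0 +i* set_val y 0 1
   else if l == j then 1 else 0).
have gv0 (y : sphere R 1) : gv y != 0.
  apply: (@co_neq0 _ _ _ j); rewrite /co mxE ji eqxx.
  exact: oner_neq0.
apply: (@acyc_transfer _ _ _ [set: sphere R 1] f (mkCP \o gv)).
- apply: con_CP1.
  apply: (@eq_cont_on _ _ _ (fun z : vec => to_sphere (reim (co z i * conjc (co z j))))).
    move=> z [z0 [[Ai Aj] _]]; rewrite /f.
    have zi := chart_neq0 Ai; have zj := chart_neq0 Aj.
    rewrite /hcoord in zi zj *; move: zi zj; have [c c0 ->] := repCP_mk z0.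
    rewrite !coZ !mulf_eq0 (negbTE c0) /= => zi zj.
    rewrite rmorphM /= mulrACA mulc_conj reimZ to_sphereZ_vec// ?normsq_gt0//.
    by apply: reim_neq0; rewrite mulf_eq0 negb_or zi conjc_eq0.
  apply: con_to_sphere.
    apply: con_mx => k l; rewrite /reim; under [X in cont_on _ X]funext do rewrite mxE.
    have cc : con_onC [set z | z != 0 /\ B (mkCP z)] (fun z : vec => co z i * conjc (co z j)).
      by apply: con_MC; [|apply: con_conj]; apply: con_co; exact: con_id.
    by case: (l == 0); [exact: con_ReC|exact: con_ImC].
  move=> z [z0 [[Ai Aj] _]]; apply: reim_neq0.
  have zi := chart_neq0 Ai; have zj := chart_neq0 Aj.
  move: zi zj; rewrite /hcoord; have [c c0 ->] := repCP_mk z0.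
  by rewrite !coZ !mulf_eq0 (negbTE c0) /= conjc_eq0 negb_or => -> ->.
- by [].
- apply: con_mkCP => //; apply: con_mx => k l; rewrite /gv; under [X in cont_on _ X]funext do rewrite mxE.
  case: (l == i); last by case: (l == j); exact: con_cst.
  have cv : cont_on setT (fun y : sphere R 1 => set_val y : 'rV[R]_2).
    by apply: con_set_val; exact: con_id.
  by apply: con_complex; exact: con_coord.
- move=> y _.
  have ysq : normsq (set_val y 0 0 +i* set_val y 0 1) = 1.
    have := sphere_val_sqnorm y; rewrite /sqnorm !big_ord_recl big_ord0 addr0 /normsq /= => <-.
    by congr (_ + set_val y 0 _ ^+ 2); apply: val_inj.
  have gi : co (gv y) i = set_val y 0 0 +i* set_val y 0 1 by rewrite /co mxE eqxx.
  have gj : co (gv y) j = 1 by rewrite /co mxE ji eqxx.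
  have gl l : l != i -> l != j -> co (gv y) l = 0 by move=> li lj; rewrite /co mxE (negbTE li) (negbTE lj).
  have n1 : normsq (1 : R[i]) = 1 by rewrite /normsq /= expr1n expr0n addr0.
  have n0 : normsq (0 : R[i]) = 0 by rewrite /normsq /= expr0n addr0.
  have le1 l : normsq (co (gv y) l) <= 1.
    have [->|li] := eqVneq l i; first by rewrite gi ysq.
    have [->|lj] := eqVneq l j; first by rewrite gj n1.
    by rewrite gl// n0.
  split; first by split; apply/chart_mk => // l; rewrite ?gi ?ysq ?gj ?n1.
  move=> l /andP[li lj]; rewrite /hcoord; have [c c0 /= ->] := repCP_mk (gv0 y).
  by rewrite coZ gl// mulr0.
- move=> x [[Ai Aj] Sx]; have xi := chart_neq0 Ai; have xj := chart_neq0 Aj.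
  rewrite /= -[RHS]repCPK.
  have xij : normsq (hcoord i x) = normsq (hcoord j x).
    by apply/eqP; rewrite eq_le (chartP i x).1// (chartP j x).1.
  set c := hcoord i x * conjc (hcoord j x).
  have c0 : c != 0 by rewrite mulf_eq0 negb_or xi conjc_eq0.
  have nc : normsq c = normsq (hcoord j x) ^+ 2.
    by rewrite normsqM xij expr2; congr (_ * _); case: (hcoord j x) => a b; rewrite /normsq /= sqrrN.
  have fx : set_val (f x) 0 0 +i* set_val (f x) 0 1 = (normsq (hcoord j x))^-1%:C * c.
    rewrite val_to_sphere ?reim_neq0//.
    have -> : sqnorm (reim c) = normsq (hcoord j x) ^+ 2.
      by rewrite -nc /sqnorm !big_ord_recl big_ord0 addr0 !mxE /=.
    rewrite sqrtr_sqr gtr0_norm ?normsq_gt0// !mxE /= -/c.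
    by case: c {nc c0} => a b; apply/eqP; rewrite eq_complex /= !mul0r subr0 addr0 !eqxx.
  rewrite -(mkCPZ (gv (f x)) xj); congr mkCP; apply/rowP => l; rewrite mxE [gv _ _ _]mxE.
  case: eqP => [->|/eqP li].
    rewrite fx /c mulrCA [hcoord j x * _]mulrC -mulrA.
    rewrite [conjc _ * _]mulrC mulc_conj mulrCA -rmorphM /= mulVf ?mulr1//.
    by rewrite gt_eqF// normsq_gt0.
  case: eqP => [->|/eqP lj]; first by rewrite mulr1.
  by rewrite mulr0; have := Sx l; rewrite /= li lj /hcoord /co => ->.
- exact: acyc_sphere.
Qed.

End projective_charts.

(** * Winding of phases along loops *)

Section phase_loops.
Context {R : realType} {n : nat}.
Local Open Scope complex_scope.
Local Notation vec := 'rV[R[i]^o]_n.+1.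
Implicit Types (i j : 'I_n.+1).

(** A half turn: $\chi(t)^2$ runs once around the circle for $t$ in $[0,1]$, while its square root
    $\chi(t)$ ends at the opposite sign. *)
Definition chi (t : R) : R[i] := cos (pi * t) +i* sin (pi * t).

Arguments chi : simpl never.

(** If $a^2$ is a positive multiple of $\chi(t)^2$, then [twist a t] is real and nonzero, and its
    sign tells which of the two square roots [a] is. *)
Definition twist (a : R[i]) (t : R) : R[i] := a * conjc (chi t).
Arguments twist : simpl never.

Lemma chi0 : chi 0 = 1. Proof. by rewrite /chi mulr0 cos0 sin0. Qed.
Lemma chi1 : chi 1 = -1.
Proof. by rewrite /chi mulr1 cospi sinpi; apply/eqP; rewrite eq_complex /= oppr0 !eqxx. Qed.

Lemma chi_conj t : chi t * conjc (chi t) = 1.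
Proof. by rewrite mulc_conj /normsq /chi /= cos2Dsin2. Qed.

Lemma con_chi (X : topologicalType) (A : set X) (f : X -> R) :
  cont_on A f -> con_onC A (fun x => chi (f x)).
Proof.
move=> cf; have cp : cont_on A (fun x => pi * f x) by apply: con_M => //; exact: con_cst.
by apply: con_complexC; [exact: (con_comp (@continuous_cos R))|exact: (con_comp (@continuous_sin R))].
Qed.

Definition phase_sq i j (y : CP R n) (t : R) :=
  exists2 k : R, 0 < k & phase i j y * phase i j y = k%:C * (chi t * chi t).

Lemma phase_sq_mk i j (w : vec) t : w != 0 -> co w i * conjc (co w j) = chi t * chi t ->
  phase_sq i j (mkCP w) t.
Proof.
move=> w0 wE; have [c c0 E] := repCP_mk w0; exists (normsq c); first exact: normsq_gt0.
rewrite -wE -mulc_conj.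
have -> : phase i j (mkCP w) * phase i j (mkCP w) =
    hcoord i (mkCP w) * conjc (hcoord j (mkCP w)).
  by rewrite -(sqrtcK (hcoord i _)) -(sqrtcK (hcoord j _)) rmorphM /= /phase /kap; ring.
by rewrite /hcoord E !coZ rmorphM /=; ring.
Qed.

Lemma phase_real i j y t : phase_sq i j y t ->
  Im (twist (phase i j y) t) = 0 /\ Re (twist (phase i j y) t) != 0.
Proof.
move=> [k k0 E]; set r := twist _ _.
have : r * r = k%:C.
  transitivity (k%:C * (chi t * conjc (chi t)) * (chi t * conjc (chi t))).
    rewrite /r /twist mulrACA E; ring.
  by rewrite !chi_conj !mulr1.
case: r {E} => a b /eqP; rewrite eq_complex /= => /andP[/eqP Er /eqP Ei].
have a0 : a != 0 by apply/eqP => a0; move: Er; rewrite a0; nra.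
split=> //; apply/eqP; have : 2 * a * b == 0 by apply/eqP; rewrite -Ei; ring.
by rewrite !mulf_eq0 (negbTE a0) pnatr_eq0.
Qed.

Definition phase_cochain i j (s : seq (CP R n)) : bool :=
  if s is [:: x; y] then negRe (conjc (phase i j x) * phase i j y) else false.

Definition phase_sign i j (Z : Type) (y : Z -> CP R n) (t : Z -> R) (s : seq Z) : bool :=
  if s is [:: z] then negRe (twist (phase i j (y z)) (t z)) else false.

(** When $z_i/z_j$ has a continuous angle, here [t], each phase is $\pm\chi(t)$ up to a positive
    factor. For close angles the sign of [conjc (phase i j x) * phase i j y] is then the product of
    the two signs. *)
Lemma lz_phase_sign i j (Z : topologicalType) (B : set Z) (y : Z -> CP R n) (t : Z -> R) :
  cont_on B t -> (forall z, B z -> phase_sq i j (y z) (t z)) ->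
  lz B (fun s => phase_cochain i j (map y s) (+) cod (phase_sign i j y t) s).
Proof.
move=> ct good z Bz.
have [V Vt hV] : exists2 V, nbhs (t z) V &
    forall a b, V a -> V b -> 0 < Re (conjc (chi a) * chi b).
  have : nbhs (t z, t z) [set ab : R * R | 0 < Re (conjc (chi ab.1) * chi ab.2)].
    apply: con_gt0; last first.
      have E1 : conjc (chi (t z)) * chi (t z) = 1 by rewrite mulrC chi_conj.
      by rewrite E1 /= ltr01.
    apply: con_ReC; apply: con_MC; [apply: con_conj|]; apply: con_chi.
      by apply: con_fst; exact: con_id.
    by apply: con_snd; exact: con_id.
  move=> [[V V'] /= [Vt Vt'] sub]; exists (V `&` V'); first exact: filterI.
  by move=> a b [Va _] [_ Vb]; apply: (sub (a, b)).
exists [set z | B z -> V (t z)]; first exact: ct.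
have h1 : homog 1 (phase_sign i j y t) by case=> [|? []].
move=> s hs; have [s2|s2] := eqVneq (size s) 2; last first.
  by rewrite (homog_cod h1)// addbF; case: s s2 {hs} => [|a [|b []]].
case: s s2 hs => [|a [|b []]] //= _ [[Va Ba] [[Vb Bb] _]].
have [ia ra] := phase_real (good a Ba); have [ib rb] := phase_real (good b Bb).
have ab := hV _ _ (Va Ba) (Vb Bb); rewrite !addbF.
have ea := chi_conj (t a); have eb := chi_conj (t b).
set Xa := phase i j (y a) in ia ra *; set Xb := phase i j (y b) in ib rb *.
rewrite [X in _ (+) X]addbC.
have cone_real (c : R[i]) : Im c = 0 -> Re c != 0 -> cone c.
  by case: c => u v /= -> u0; rewrite /cone /= mul0r subr0 -expr2 exprn_even_gt0.
rewrite -[X in _ (+) X]negReM; [|exact: cone_real..].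
rewrite /twist in ia ra ib rb *.
move: (chi (t a)) (chi (t b)) ia ra ib rb ab ea eb => ca cb ia ra ib rb ab ea eb.
move: Xa Xb ia ra ib rb => Xa Xb ia ra ib rb.
have -> : conjc Xa * Xb = (Xa * conjc ca) * (Xb * conjc cb) * (conjc ca * cb).
  have -> : Xa * conjc ca = conjc (Xa * conjc ca).
    by case: (Xa * conjc ca) ia => u v /= ->; rewrite oppr0.
  transitivity (conjc Xa * Xb * (ca * conjc ca) * (cb * conjc cb)).
    by rewrite ea eb !mulr1.
  rewrite rmorphM /= conjcK; ring.
case: (Xa * conjc ca) ia ra => u u' /= -> u0; case: (Xb * conjc cb) ib rb => v v' /= -> v0.
have -> : (u +i* 0) * (v +i* 0) = (u * v)%:C.
  by apply/eqP; rewrite eq_complex /= !(mulr0, mul0r) subr0 addr0 !eqxx.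
rewrite /negRe Re_scale /= pmulr_llt0 //; exact: addbb.
Qed.

Lemma phase_sign_flip i j y t : phase_sq i j y t -> cone (twist (phase i j y) t).
Proof.
move=> /phase_real [i0 r0]; case: (twist _ _) i0 r0 => a b /= -> a0.
by rewrite /cone /= mul0r subr0 -expr2 exprn_even_gt0.
Qed.

Lemma twist01 a : cone (twist a 0) -> negRe (twist a 0) (+) negRe (twist a 1).
Proof.
rewrite /twist chi0 chi1 rmorphN !rmorph1 mulrN !mulr1; case: a => u v.
rewrite /cone /negRe /= oppr_lt0 => h.
have : u != 0 by apply/eqP => u0; move: h; rewrite u0; nra.
by case: ltrgt0P.
Qed.

End phase_loops.

(** * The Chern class of the projective plane has nonzero square *)

Section projective_plane.
Context {R : realType}.
Local Open Scope complex_scope.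
Local Notation vec := 'rV[R[i]^o]_3.
Local Notation CP2 := (CP R 2).
Let i0 : 'I_3 := inord 0.
Let i1 : 'I_3 := inord 1.
Let i2 : 'I_3 := inord 2.
Let n01 : (i0 == i1) = false. Proof. by rewrite -val_eqE /= !inordK. Qed.
Let n02 : (i0 == i2) = false. Proof. by rewrite -val_eqE /= !inordK. Qed.
Let n12 : (i1 == i2) = false. Proof. by rewrite -val_eqE /= !inordK. Qed.
Let n21 : (i2 == i1) = false. Proof. by rewrite eq_sym n12. Qed.
Let n10 : (i1 == i0) = false. Proof. by rewrite eq_sym n01. Qed.
Let n20 : (i2 == i0) = false. Proof. by rewrite eq_sym n02. Qed.
Let cases3 (j : 'I_3) : [\/ j = i0, j = i1 | j = i2].
Proof.
case: j => -[|[|[|//]]] h; [apply: Or31|apply: Or32|apply: Or33];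
by apply: val_inj; rewrite /= inordK.
Qed.

Let loop (t : R) : R[i] := chi t * chi t.
Let loop01 : loop 0 = 1 /\ loop 1 = 1.
Proof. by rewrite /loop chi0 chi1 mulr1 mulrNN mulr1. Qed.

Let normsq_loop t : normsq (loop t) = 1.
Proof.
have c1 : normsq (chi t) = 1 :> R by rewrite /normsq /chi /= cos2Dsin2.
by rewrite normsqM c1 mulr1.
Qed.

Definition vec3 (a b c : R[i]) : vec :=
  \row_j (if j == i0 then a else if j == i1 then b else c).

Lemma co_vec3 a b c : [/\ co (vec3 a b c) i0 = a, co (vec3 a b c) i1 = b &
  co (vec3 a b c) i2 = c].
Proof. by rewrite /co !mxE !eqxx n10 n20 n21. Qed.

Let torus : set CP2 := chart i0 `&` chart i1 `&` chart i2.

Lemma vec3_neq0 a c : vec3 a 1 c != 0.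
Proof. by apply: (@co_neq0 _ _ _ i1); have [_ -> _] := co_vec3 a 1 c; exact: oner_neq0. Qed.

Lemma torus_vec3 a c : normsq a = 1 -> normsq c = 1 -> torus (mkCP (vec3 a 1 c)).
Proof.
move=> na nc; have [ea eb ec] := co_vec3 a 1 c.
have n1 j : normsq (co (vec3 a 1 c) j) = 1.
  by case: (cases3 j) => ->; rewrite ?ea ?eb ?ec // /normsq /= expr1n expr0n addr0.
have v0 := vec3_neq0 a c.
by split; [split|]; apply/(chart_mk _ v0) => j; rewrite !n1.
Qed.

(** The conjugate makes $z_1\bar z_2$ equal to $\chi(t)^2$, so [t] is the angle of $z_1/z_2$ with
    the right orientation. *)
Definition circle_path (t : R) : CP2 := mkCP (vec3 1 1 (conjc (loop t))).
Let circle : set CP2 := circle_path @` [set` `[0%R, 1%R]].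

Lemma con_loop (X : topologicalType) (A : set X) (f : X -> R) :
  cont_on A f -> con_onC A (fun x => loop (f x)).
Proof. by move=> cf; exact: (con_MC (con_chi cf) (con_chi cf)). Qed.

Lemma con_vec3 (X : topologicalType) (A : set X) (a b c : X -> R[i]) :
  con_onC A a -> con_onC A b -> con_onC A c ->
  cont_on A (fun x => vec3 (a x) (b x) (c x)).
Proof.
move=> ca cb cc; apply: con_mx => k j; rewrite /vec3.
under [X in cont_on _ X]funext do rewrite mxE.
by case: (j == i0); [exact: ca|case: (j == i1); [exact: cb|exact: cc]].
Qed.

Lemma con_circle_path (A : set R) : cont_on A circle_path.
Proof.
apply: con_mkCP => [|t _]; last exact: vec3_neq0.
apply: con_vec3; [exact: con_cstC|exact: con_cstC|].
by apply: con_conj; apply: con_loop; exact: con_id.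
Qed.

Lemma compact_circle : compact circle.
Proof.
apply: continuous_compact; last exact: segment_compact.
by apply/cont_onP; exact: con_circle_path.
Qed.

(** Turns $z_0/z_1$ once around and leaves $z_1/z_2$ alone; at times 0 and 1 it is the identity. *)
Definition rotate (xt : CP2 * R) : CP2 :=
  mkCP (vec3 (loop xt.2 * hcoord i0 xt.1) (hcoord i1 xt.1) (hcoord i2 xt.1)).

Lemma rotate_path t u : rotate (circle_path t, u) = mkCP (vec3 (loop u) 1 (conjc (loop t))).
Proof.
have [c c0 E] := repCP_mk (vec3_neq0 1 (conjc (loop t))).
rewrite /rotate /hcoord /= /circle_path E !coZ.
have [-> -> ->] := co_vec3 1 1 (conjc (loop t)).
rewrite -[RHS](mkCPZ _ c0); congr mkCP; apply/rowP => j; rewrite !mxE.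
by case: (j == i0); [rewrite mulr1 mulrC|case: (j == i1)].
Qed.

Lemma rotate01 x t : t = 0 \/ t = 1 -> rotate (x, t) = x.
Proof.
move=> t01; have -> : rotate (x, t) = mkCP (repCP x); last exact: repCPK.
congr mkCP; apply/rowP => j; rewrite mxE /=.
have -> : loop t = 1 by case: t01 => ->; case: loop01.
by case: (cases3 j) => ->; rewrite ?eqxx ?n10 ?n20 ?n21 ?mul1r.
Qed.

Lemma con_rotate : cont_on (cylinder (R := R) circle) rotate.
Proof.
apply: con_CP.
apply: (@eq_cont_on _ _ _ (fun zt : vec * R => mkCP (vec3 (loop zt.2 * co zt.1 i0) (co zt.1 i1) (co zt.1 i2)))).
  move=> [z t] [/= z0 _]; rewrite /rotate /hcoord /=; have [c c0 ->] := repCP_mk z0.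
  rewrite !coZ -[LHS](mkCPZ _ c0); congr mkCP; apply/rowP => j; rewrite !mxE.
  by case: (j == i0); [rewrite mulrCA|case: (j == i1)].
set A := [set zt | _]; have c1 : cont_on A (fun zt : vec * R => zt.1) by apply: con_fst; exact: con_id.
have c2 : cont_on A (fun zt : vec * R => zt.2) by apply: con_snd; exact: con_id.
apply: con_mkCP.
  apply: con_vec3; [exact: (con_MC (con_loop c2) (con_co (i := i0) c1))|exact: (con_co (i := i1) c1)|exact: (con_co (i := i2) c1)].
move=> [z t] [/= z0 [/= [s _ E] _]].
apply: (@co_neq0 _ _ _ i1); have [_ -> _] := co_vec3 (loop t * co z i0) (co z i1) (co z i2).
move: E => /(mkCP_eqP (vec3_neq0 _ _) z0) [c c0 ->].
by rewrite coZ; have [_ -> _] := co_vec3 1 1 (conjc (loop s)); rewrite mulr1.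
Qed.

(* If the square of the class were zero, sweeping the circle over the torus   *)
(* by the rotation would exhibit the restriction of the class to a projective *)
(* line as trivial, against its odd period.                                   *)
Lemma chern_square_neq0 (b : seq CP2 -> bool) : homog 2 b ->
  ~ cobound setT (cup 1 (fun s => chern s (+) cod b s) (fun s => chern s (+) cod b s)).
Proof.
move=> hb sq0.
pose u s := chern s (+) cod b s.
pose a i s := chart_cochain i s (+) b s.
have hu : homog 3 u by apply: homogD; [exact: homog_chern|exact: homog_cod].
have ha i : homog 2 (a i) by apply: homogD => //; exact: homog_chart_cochain.
have lua i : lz (@chart R 2 i) (fun s => u s (+) cod (a i) s).
  apply: eq_lzT (lz_chart_cochain (@chart_neq0 R 2 i)) => s.
  by rewrite /u /a codD; btauto.
have [g lg] := cup_square_on_triple (fun i => @acyc_chart R 2 i 4)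
  (fun i j ij => @acyc_chartI R 2 i j 3 ij erefl) hu ha lua sq0.
pose P i j := @phase_cochain R 2 i j.
have sub0 : torus `<=` chart i0 by move=> x [[]].
have sub1 : torus `<=` chart i1 by move=> x [[]].
have sub2 : torus `<=` chart i2 by move=> x [].
have sum i j : torus `<=` chart i -> torus `<=` chart j ->
    lz torus (fun s => a i s (+) a j s (+) P i j s).
  move=> si sj; have := @lz_chart_sum R 2 i j torus (fun x h => chart_neq0 (si x h)) (fun x h => chart_neq0 (sj x h)).
  by apply: eq_lzT => s; rewrite /a /P /phase_cochain; btauto.
have lP i j : torus `<=` chart i -> torus `<=` chart j -> lz torus (cod (P i j)).
  move=> si sj; apply: eq_lzT (lzD (lz_cod (sum i j si sj)) (lzD (lz_sub si (lua i)) (lz_sub sj (lua j)))) => s.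
  have x4 (x y z w : bool) : (x (+) y (+) z) (+) ((w (+) x) (+) (w (+) y)) = z by btauto.
  by rewrite !codD; exact: x4.
(* If the square is exact, so is the product of the two winding cocycles on the torus. *)
have lPg : lz torus (fun s => cup 1 (P i0 i1) (P i1 i2) s (+) cod g s).
  have l1 := lz_cupl 1 (fun s => a i1 s (+) a i2 s) (sum i0 i1 sub0 sub1).
  have l2 := lz_cupr 1 (P i0 i1) (sum i1 i2 sub1 sub2).
  apply: eq_lzT (lzD (lzD l1 l2) lg) => s.
  rewrite (cupDl 1 (fun s => a i0 s (+) a i1 s)) (cupDr 1 (fun s => a i1 s (+) a i2 s)).
  have x4 (x y z w : bool) : x (+) y (+) (y (+) z) (+) (x (+) w) = z (+) w by btauto.
  exact: x4.
have homogP i j : homog 2 (P i j) by case=> [|? [|? []]].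
have rot_torus z : cylinder circle z -> torus (rotate z).
  case: z => x t [/= [s _ <-] _]; rewrite rotate_path; apply: torus_vec3.
    exact: normsq_loop.
  by rewrite normsq_conj normsq_loop.
(* On the cylinder over the circle, time is the angle of $z_0/z_1$, which makes the pulled back
   [P i0 i1] exact. *)
pose beta := phase_sign i0 i1 rotate snd.
have lbeta : lz (cylinder circle) (fun s => P i0 i1 (map rotate s) (+) cod beta s).
  apply: lz_phase_sign; first by apply: con_snd; exact: con_id.
  move=> [x t] [/= [s _ <-] _]; rewrite rotate_path; apply: phase_sq_mk; first exact: vec3_neq0.
  by have [-> -> _] := co_vec3 (loop t) 1 (conjc (loop s)); rewrite conjc1 mulr1.
(* A cocycle: the coboundary of its first summand is the pulled back product, which the second
   summand cancels. *)
pose gam s := cup 1 beta (P i1 i2 \o map rotate) s (+) g (map rotate s).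
have lgam : lz (cylinder circle) (cod gam).
  have l1 := lz_cupl 1 (P i1 i2 \o map rotate) lbeta.
  have l2 := lz_cupr 1 beta (lz_pull con_rotate rot_torus (lP i1 i2 sub1 sub2)).
  have l3 := lz_pull con_rotate rot_torus lPg.
  apply: eq_lzT (lzD (lzD l1 l2) l3) => s.
  rewrite /gam codD cod_cup1// (cupDl 1 (P i0 i1 \o map rotate) (cod beta)).
  rewrite -[cod (fun s => g (map rotate s)) s]/(cod (g \o map rotate) s) -cod_map /= cup_map.
  rewrite (_ : cod (P i1 i2 \o map rotate) = cod (P i1 i2) \o map rotate); last first.
    by apply: funext => l; rewrite /= cod_map.
  have x4 (x y z w : bool) : x (+) y (+) z (+) (x (+) w) = y (+) z (+) w by btauto.
  exact: x4.
have [h h0 lh] := cochain_homotopy compact_circle lgam.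
(* Both ends of the rotation are the identity, so [g] cancels between them. The two end values of
   [beta] add up to the constant 1 on single vertices, and the product of 1 with [P i1 i2] is
   [P i1 i2], which is therefore exact on the circle. *)
have lPh : lz circle (fun s => P i1 i2 s (+) cod h s).
  apply: eq_lz lh => s sC; rewrite /gam -!map_comp.
  have -> : [seq (rotate \o (fun x => (x, 0))) i | i <- s] = s.
    by rewrite map_id_in// => x _ /=; rewrite rotate01//; left.
  have -> : [seq (rotate \o (fun x => (x, 1))) i | i <- s] = s.
    by rewrite map_id_in// => x _ /=; rewrite rotate01//; right.
  rewrite !cup_map.
  have rK t : t = 0 \/ t = 1 -> (P i1 i2 \o map rotate) \o map (fun x => (x, t)) = P i1 i2.
    move=> t01; apply: funext => l /=; rewrite -map_comp map_id_in// => x _ /=.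
    exact: rotate01.
  rewrite !rK; [|by right|by left].
  set c0 := cup 1 _ _ s; set c1 := cup 1 _ _ s.
  suff E : c0 (+) c1 = P i1 i2 s by rewrite -E; btauto.
  rewrite /c0 /c1 -cupDl.
  have eps l : allin circle l -> (beta \o map (fun x => (x, 0))) l (+) (beta \o map (fun x => (x, 1))) l = (size l == 1)%N.
    case: l => [|x [|y l]] //= [[t _ <-] _]; rewrite /beta /phase_sign !rotate01; [|by right|by left].
    apply: twist01; apply: (@phase_sign_flip _ _ i0 i1).
    apply: phase_sq_mk; first exact: vec3_neq0.
    by have [-> -> _] := co_vec3 1 1 (conjc (loop t)); rewrite chi0 conjc1 mulr1.
  rewrite (eq_cup 1 eps (fun l _ => erefl) sC).
  case: s {c0 c1 sC} => [|x s] //=; rewrite cup0E andbT.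
  suff -> : cup 1 (fun l => size (x :: l) == 1%N) (P i1 i2) s = false by [].
  by case: s => [|y s] //=; rewrite cup0l cup0r.
(* Along the path [P i1 i2] has two primitives, the pullback of [h] and [beta2]. Their sum is
   closed, hence takes equal values at 0 and 1; but the path closes up while the sign in [beta2]
   flips. *)
pose beta2 := phase_sign i1 i2 circle_path id.
have path_sq t : phase_sq i1 i2 (circle_path t) t.
  apply: phase_sq_mk; first exact: vec3_neq0.
  by have [_ -> ->] := co_vec3 1 1 (conjc (loop t)); rewrite conjcK mul1r.
have lb2 : lz [set` `[(0 : R), 1]] (fun s => P i1 i2 (map circle_path s) (+) cod beta2 s).
  by apply: lz_phase_sign => [|t _]; [exact: con_id|exact: path_sq].
have lq : lz [set` `[(0 : R), 1]] (cod (fun s => h (map circle_path s) (+) beta2 s)).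
  have l1 : lz [set` `[(0 : R), 1]] ((fun s => P i1 i2 s (+) cod h s) \o map circle_path).
    have pc (t : R) : [set` `[(0 : R), 1]] t -> circle (circle_path t) by move=> t01; exists t.
    exact: (lz_pull (@con_circle_path [set` `[(0 : R), 1]]) pc lPh).
  apply: eq_lzT (lzD l1 lb2) => s.
  rewrite codD -[cod (fun s => h _) s]/(cod (h \o map circle_path) s) -cod_map /=.
  have x3 (x y z : bool) : x (+) y (+) (x (+) z) = y (+) z by btauto.
  exact: x3.
(* Closed cochains take equal values on the vertices 0 and 1: this is homotopy invariance over a
   one-point base, read on one-vertex tuples. *)
have [|k k0 lk] := @cochain_homotopy R R [set 0] ((fun s => h (map circle_path s) (+) beta2 s) \o map snd) (@compact_set1 _ 0).
  have cs : cont_on (cylinder [set (0 : R)]) (@snd R R) by apply: con_snd; exact: con_id.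
  have := lz_pull cs _ lq; move=> /(_ (fun z h => h.2)).
  by apply: eq_lzT => s; rewrite /= cod_map.
have [U U0 /(_ [:: 0])] := lk 0 erefl; rewrite /= k0 !addbF.
have -> : circle_path 0 = circle_path 1 by rewrite /circle_path; have [-> ->] := loop01.
move=> E; have {E} := E (conj (conj (nbhs_singleton U0) erefl) I).
have := twist01 (phase_sign_flip (path_sq 0)).
have <- : circle_path 0 = circle_path 1 by rewrite /circle_path; have [-> ->] := loop01.
by case: (h _); case: (negRe _); case: (negRe _).
Qed.

End projective_plane.

(** * Compact charts and Hausdorff quotients *)

Section quotient_charts.

(** Points of the compact [K] that do not map to [x0] are separated from it in the Hausdorff [Q];
    compactness makes these separations uniform, so a point of the image near [x0] comes only from
    points of [K] where [h \o q] is under control. *)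
Lemma con_chart (T Q V : topologicalType) (K : set T) (q : T -> Q) (h : Q -> V) :
  hausdorff_space Q -> compact K -> cont_on K q -> cont_on K (h \o q) ->
  cont_on (q @` K) h.
Proof.
move=> hQ cK cq chq x0 _ W Wx.
have : \forall x \near x0, K `<=` [set a | K a -> q a = x -> W (h x)].
  apply: ((compact_near_coveringP _).1 cK) => a Ka.
  have [E|E] := eqVneq (q a) x0.
    exists ([set a' | K a' -> W (h (q a'))], setT) => /=.
      split; last exact: filterT.
      by apply: chq => //=; rewrite E.
    by move=> [a' x] /= [h1 _] Ka' Ex; rewrite -Ex; exact: h1.
  move: hQ; rewrite open_hausdorff => /(_ _ _ E) [[U U'] /= [Ux Ux'] [oU oU' UU']].
  rewrite !inE in Ux Ux'.
  exists ([set a' | K a' -> U (q a')], U') => /=.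
    split; last exact: open_nbhs_nbhs.
    by apply: cq => //; exact: open_nbhs_nbhs.
  move=> [a' x] /= [h1 Ux2] Ka' Ex; exfalso.
  have : (U `&` U') x by split=> //; rewrite -Ex; exact: h1.
  by rewrite (eqP UU').
by apply: filterS => x h1 [a Ka qa]; exact: (h1 a Ka Ka qa).
Qed.

Lemma closed_chart_image (T Q : topologicalType) (K : set T) (q : T -> Q) :
  hausdorff_space Q -> compact K -> cont_on K q -> closed (q @` K).
Proof.
move=> hQ cK cq; apply: compact_closed => //.
by apply: continuous_compact => //; exact/cont_onP.
Qed.

Lemma con_closedU (X Y : topologicalType) (A B : set X) (f : X -> Y) :
  closed A -> closed B -> cont_on A f -> cont_on B f -> cont_on (A `|` B) f.
Proof.
move=> clA clB /cont_onP cA /cont_onP cB; apply/cont_onP.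
exact: withinU_continuous.
Qed.

Lemma cont_onT (X Y : topologicalType) (A : set X) (f : X -> Y) :
  A = setT -> cont_on A f -> continuous f.
Proof. by move=> -> cf x V Vx; have := cf x I V Vx; apply: filterS => y; apply. Qed.

(** Each comparison map is continuous after composition with a compact presentation, hence
    continuous by [con_chart]. *)
Lemma same_kernel_homeo (T Q1 Q2 : topologicalType) (K : set T)
    (q1 : T -> Q1) (q2 : T -> Q2) :
  hausdorff_space Q1 -> hausdorff_space Q2 -> compact K ->
  cont_on K q1 -> cont_on K q2 -> q1 @` K = setT -> q2 @` K = setT ->
  (forall a b, K a -> K b -> q1 a = q1 b <-> q2 a = q2 b) ->
  exists (f : Q1 -> Q2) (g : Q2 -> Q1),
    [/\ continuous f, continuous g, cancel f g & cancel g f].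
Proof.
move=> h1 h2 cK c1 c2 s1 s2 ker.
have /choice [r1 r1P] : forall x, exists a, K a /\ q1 a = x.
  by move=> x; have : [set: Q1] x by []; rewrite -s1 => -[a Ka <-]; exists a.
have /choice [r2 r2P] : forall x, exists a, K a /\ q2 a = x.
  by move=> x; have : [set: Q2] x by []; rewrite -s2 => -[a Ka <-]; exists a.
exists (q2 \o r1), (q1 \o r2); split.
- apply: cont_onT s1 (con_chart h1 cK c1 _); apply: eq_cont_on c2 => a Ka /=.
  by have [Kr Er] := r1P (q1 a); apply/esym/(ker _ _ Kr Ka).
- apply: cont_onT s2 (con_chart h2 cK c2 _); apply: eq_cont_on c1 => a Ka /=.
  by have [Kr Er] := r2P (q2 a); apply/esym/(ker _ _ Kr Ka).
- move=> x /=; have [K1 E1] := r1P x; have [K2 E2] := r2P (q2 (r1 x)).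
  by rewrite -[RHS]E1; apply/ker.
- move=> x /=; have [K2 E2] := r2P x; have [K1 E1] := r1P (q1 (r2 x)).
  by rewrite -[RHS]E2; apply/ker.
Qed.

End quotient_charts.

(** * Hausdorffness through injections into normed spaces *)

Section embeddings.
Context {R : realType}.

(** Sending the base point to 0 lets the property pass to suspensions, where the line over the base
    point is collapsed. *)
Definition embeds (Y : topologicalType) (y0 : Y) := exists (V : normedModType R) (e : Y -> V),
  [/\ continuous e, injective e & e y0 = 0].

Lemma embeds_hausdorff (Y : topologicalType) (y0 : Y) : embeds y0 -> hausdorff_space Y.
Proof.
move=> [V [e [ce ei _]]]; apply: (hausdorff_inj ce ei); exact: norm_hausdorff.
Qed.

Lemma embeds_closed1 (Y : topologicalType) (y0 y : Y) : embeds y0 -> closed [set y].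
Proof. by move=> /embeds_hausdorff/hausdorff_accessible/accessible_closed_set1. Qed.

Lemma embeds_collapse (X : topologicalType) (A : set X) (a : X) (V : normedModType R) (g : X -> V) :
  A a -> continuous g -> (forall x, g x = 0 <-> A x) ->
  (forall x y, ~ A x -> g x = g y -> x = y) -> embeds (cpi A a).
Proof.
move=> Aa cg g0 gi; exists V, (g \o @csec _ A); split.
- apply: collapse_continuous; rewrite (_ : _ \o _ = g) //; apply: funext => x /=.
  have [Ax|nAx] := pselect (A x); last by rewrite csec_cpi.
  by rewrite (g0 _).2 ?(g0 x).2//; exact: csec_cpiA.
- move=> x y /= E; rewrite -(csecK x) -(csecK y).
  have [Ax|nAx] := pselect (A (csec x)); last by rewrite (gi _ _ nAx E).
  by apply/cpi_eqP; right; split => //; apply/g0; rewrite -E; exact/g0.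
- by apply/g0; exact: csec_cpiA.
Qed.

(** With $c=t(1-t)$, the map $(y,t)\mapsto(c\,e(y),\,tc\,e(y))$ vanishes exactly on the collapsed
    set. Elsewhere comparing the two components recovers $t$, and then $y$. *)
Lemma embeds_susp (Y : ptopologicalType) : embeds (point : Y) ->
  embeds (point : susp R Y).
Proof.
move=> [V [e [ce ei e0]]].
pose c (z : Y * unit_interval R) : R := (set_val z.2 : R) * (1 - (set_val z.2 : R)).
pose g (z : Y * unit_interval R) : (V * V)%type :=
  (c z *: e z.1, ((set_val z.2 : R) * c z) *: e z.1).
have ct : cont_on setT (fun z : Y * unit_interval R => (set_val z.2 : R)).
  apply: con_comp (@unit_interval_val_continuous R) _; apply: con_snd; exact: con_id.
have cc : cont_on setT c.
  by apply: con_M => //; apply: con_D; [exact: con_cst|exact: con_N].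
have cez : cont_on setT (fun z : Y * unit_interval R => e z.1).
  by apply: con_comp ce _; apply: con_fst; exact: con_id.
have cZ (f : Y * unit_interval R -> R) : cont_on setT f -> cont_on setT (fun z => f z *: e z.1).
  by move=> cf z Az; apply: (@cvgZ _ _ _ (within setT (nbhs z))); [exact: cf|exact: cez].
have P : susp_collapsed ((point : Y), (I0 : unit_interval R)) by exact: Or31.
apply: (@embeds_collapse _ (@susp_collapsed R Y) (point, I0) (V * V)%type g P).
- by apply: (@cont_onT _ _ setT) => //; apply: con_pair; apply: cZ => //; exact: con_M.
- move=> z; split.
    move=> [/eqP]; rewrite scaler_eq0 /c mulf_eq0 subr_eq0 => /orP[/orP[/eqP t0|/eqP t1]|/eqP ez] _.
    + by apply: Or31; exact: I0P.
    + by apply: Or32; exact: I1P.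
    + by apply: Or33; apply: ei; rewrite ez.
  by rewrite /g /c => -[->|->|->]; rewrite ?set_val_I0 ?set_val_I1 ?subrr ?mul0r ?mulr0 ?mul0r ?e0 ?scale0r ?scaler0.
- move=> z w nLz [E1 E2].
  have cz : c z != 0.
    rewrite /c mulf_eq0 subr_eq0; apply/negP => /orP[/eqP t0|/eqP t1]; apply: nLz.
      by apply: Or31; exact: I0P.
    by apply: Or32; exact: I1P.
  have ez : e z.1 != 0 by apply/eqP => ez; apply: nLz; apply: Or33; apply: ei; rewrite ez.
  have v0 : c z *: e z.1 != 0 by rewrite scaler_eq0 negb_or cz.
  have Et : (set_val z.2 : R) = set_val w.2.
    move: E2; rewrite -(scalerA _ (c z)) -(scalerA _ (c w)) -E1 => /eqP; rewrite -subr_eq0 -scalerBl scaler_eq0 (negbTE v0) orbF.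
    by rewrite subr_eq0 => /eqP.
  have Et2 : z.2 = w.2 by apply: val_inj.
  have Ey : z.1 = w.1.
    apply: ei; move: E1; rewrite /c -Et => /eqP; rewrite -subr_eq0 -scalerBr scaler_eq0.
    by rewrite -/(c z) (negbTE cz) /= subr_eq0 => /eqP.
  by rewrite (surjective_pairing z) (surjective_pairing w) Ey Et2.
Qed.

Lemma embeds_iter_susp k (Y : ptopologicalType) : embeds (point : Y) ->
  embeds (point : iter_susp R k Y).
Proof. by move=> eY; elim: k => [|k IH] //=; exact: embeds_susp. Qed.

End embeddings.

Section projective_embedding.
Context {R : realType} {n : nat}.
Local Open Scope complex_scope.
Local Notation vec := 'rV[R[i]^o]_n.+1.
Local Notation V := ('M[R]_n.+1 * 'M[R]_n.+1)%type.

(** The orthogonal projector onto the line, with real and imaginary parts separated so as to land in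
    a real normed space. *)
Definition projector (x : CP R n) : V :=
  (\matrix_(i, j) (Re (hcoord i x * conjc (hcoord j x)) / vnormsq (repCP x)),
   \matrix_(i, j) (Im (hcoord i x * conjc (hcoord j x)) / vnormsq (repCP x))).

Lemma projectorE (z : vec) : z != 0 -> projector (mkCP z) =
  (\matrix_(i, j) (Re (co z i * conjc (co z j)) / vnormsq z),
   \matrix_(i, j) (Im (co z i * conjc (co z j)) / vnormsq z)).
Proof.
move=> z0; have [c c0 E] := repCP_mk z0; rewrite /projector /hcoord E vnormsqZ.
have n0 : normsq c != 0 by rewrite gt_eqF// normsq_gt0.
have v0 : vnormsq z != 0 by rewrite gt_eqF// vnormsq_gt0.
congr (_, _); apply/matrixP => i j; rewrite !mxE !coZ rmorphM /= mulrACA mulc_conj.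
  by rewrite Re_scale -mulf_div divff// mul1r.
have -> : Im ((normsq c)%:C * (co z i * conjc (co z j))) = normsq c * Im (co z i * conjc (co z j)).
  by case: (co z i * _) => a b /=; rewrite mul0r addr0.
by rewrite -mulf_div divff// mul1r.
Qed.

Lemma con_projector : continuous projector.
Proof.
apply: (@cont_onT _ _ setT) => //; apply: con_CP1.
apply: (@eq_cont_on _ _ _ (fun z : vec =>
  (\matrix_(i, j) (Re (co z i * conjc (co z j)) / vnormsq z),
   \matrix_(i, j) (Im (co z i * conjc (co z j)) / vnormsq z)) : V)).
  by move=> z [z0 _]; rewrite projectorE.
set A := [set z | _].
have cid := @con_id _ A.
have cv : cont_on A (fun z => (vnormsq z)^-1).
  apply: con_V; first exact: con_vnormsq cid.
  by move=> z [z0 _]; rewrite gt_eqF// vnormsq_gt0.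
have cz i j : con_onC A (fun z : vec => co z i * conjc (co z j)).
  exact: (con_MC (con_co (i := i) cid) (con_conj (con_co (i := j) cid))).
apply: con_pair; apply: con_mx => i j; under [X in cont_on _ X]funext do rewrite mxE.
  exact: (con_M (con_ReC (cz i j)) cv).
exact: (con_M (con_ImC (cz i j)) cv).
Qed.

(** A nonzero column of the projector spans the line, which gives the scalar [c] relating the two
    representatives. *)
Lemma projector_inj : injective projector.
Proof.
move=> x y [/matrixP E1 /matrixP E2].
have vx0 : vnormsq (repCP x) != 0 by rewrite gt_eqF// vnormsq_gt0// repCP_neq0.
have vy0 : vnormsq (repCP y) != 0 by rewrite gt_eqF// vnormsq_gt0// repCP_neq0.
have E i j : (vnormsq (repCP y))%:C * (hcoord i x * conjc (hcoord j x)) =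
    (vnormsq (repCP x))%:C * (hcoord i y * conjc (hcoord j y)).
  have := E1 i j; have := E2 i j; rewrite !mxE.
  case: (hcoord i x * _) => a b; case: (hcoord i y * _) => c d /= h2 h1.
  have {}h1 : vnormsq (repCP y) * a = vnormsq (repCP x) * c.
    by rewrite -[a](divfK vx0) h1; field.
  have {}h2 : vnormsq (repCP y) * b = vnormsq (repCP x) * d.
    by rewrite -[b](divfK vx0) h2; field.
  by apply/eqP; rewrite eq_complex /= !mul0r !subr0 !addr0 h1 h2 !eqxx.
have [j xj] := vec_neq0 (repCP_neq0 x); rewrite -/(hcoord j x) in xj.
have vxC : (vnormsq (repCP x))%:C != 0 by rewrite eq_complex /= negb_and vx0.
have vyC : (vnormsq (repCP y))%:C != 0 by rewrite eq_complex /= negb_and vy0.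
have yj : hcoord j y != 0.
  apply/eqP => yj; have := E j j; rewrite yj mul0r mulr0 => /eqP.
  by rewrite !mulf_eq0 (negbTE vyC) conjc_eq0 (negbTE xj).
pose c : R[i] := (vnormsq (repCP x))%:C * conjc (hcoord j y) / ((vnormsq (repCP y))%:C * conjc (hcoord j x)).
have c0 : c != 0 by rewrite !(mulf_eq0, invr_eq0) conjc_eq0 conjc_eq0 !negb_or vxC yj vyC xj.
rewrite -(repCPK x) -(repCPK y) -(mkCPZ (repCP y) c0); congr mkCP.
apply/rowP => i; rewrite -[LHS]/(hcoord i x) -[RHS]/(co (c *: repCP y) i) coZ -/(hcoord i y).
have xjc : conjc (hcoord j x) != 0 by rewrite conjc_eq0.
apply: (mulfI vyC); apply: (mulIf xjc); rewrite -mulrA E /c.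
by field; rewrite vyC xjc.
Qed.

Lemma embeds_CP : embeds (R := R) (point : CP R n).
Proof.
exists (V : normedModType R), (fun x => projector x - projector point); split.
- by move=> x; apply: (@cvgB _ _ _ (nbhs x)); [exact: con_projector|exact: cvg_cst].
- by move=> x y /addIr; exact: projector_inj.
- by rewrite subrr.
Qed.

End projective_embedding.

(** * The nonzero square on suspensions of the projective plane *)

Section iterated_suspension.
Context {R : realType}.

Lemma compact_iter_susp k (Y : ptopologicalType) : compact [set: Y] ->
  compact [set: iter_susp R k Y].
Proof.
move=> cY; elim: k => [|k IH] //=; apply: compact_collapse.
rewrite -setXTT; apply: compact_setX => //; exact: compact_unit_interval.
Qed.

Lemma closed_point_iter_susp k (Y : ptopologicalType) : closed [set (point : Y)] ->
  closed [set (point : iter_susp R k Y)].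
Proof.
move=> cY; elim: k => [|k IH] //=.
apply: (@closed_cpi_point _ (@susp_collapsed R (iter_susp R k Y))); last exact: Or31.
exact: closed_susp_collapsed.
Qed.

Lemma homotopy_cobound (Z : topologicalType) (c : seq Z -> bool) (e : Z -> Z) :
  compact [set: Z] -> lz setT (cod c) -> homotopic R e id ->
  cobound setT (c \o map e) -> cobound setT c.
Proof.
move=> cZ lc [H [cH H0 H1]] [b lb].
pose H' (z : Z * R) := H (z.1, clampI z.2).
have cH' : cont_on (cylinder (R := R) [set: Z]) H'.
  apply: con_comp cH _; apply: con_pair; first by apply: con_fst; exact: con_id.
  by apply: con_clampI; apply: con_snd; exact: con_id.
have [|h _ lh] := @cochain_homotopy R _ setT (c \o map H') cZ.
  by apply: eq_lzT (lz_pull cH' (fun _ _ => I) lc) => s; rewrite /= cod_map.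
exists (fun s => h s (+) b s); apply: eq_lzT (lzD lh lb) => s.
rewrite /= -!map_comp codD.
have -> : [seq (H' \o (fun x => (x, 0))) i | i <- s] = map e s.
  by apply: eq_map => z; rewrite /H' /= clampI0 H0.
have -> : [seq (H' \o (fun x => (x, 1))) i | i <- s] = s.
  by rewrite map_id_in// => z _; rewrite /H' /= clampI1 H1.
have x4 (x y z w : bool) : x (+) y (+) z (+) (x (+) w) = y (+) (z (+) w) by btauto.
exact: x4.
Qed.

(** Length [k.+3] is degree $k+2$ and [cup k.+1] is $\cup_k$, so the product represents $Sq^2$ of
    the class. Vanishing near the base point is carried along because the next suspension requires
    it. *)
Lemma iter_susp_class k : exists u : seq (iter_susp R k (CP R 2)) -> bool,
  [/\ homog k.+3 u, lz setT (cod u),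
    (exists2 U, nbhs (point : iter_susp R k (CP R 2)) U & forall s, allin U s -> u s = false) &
    ~ cobound setT (cup k.+1 u u)].
Proof.
have clCP : closed [set (point : CP R 2)] by apply: embeds_closed1; exact: (@embeds_CP R 2).
elim: k => [|k [u [hu lu u0 nu]]].
  have lch := @lz_cod_chern R 2.
  have [U Uq Uc] := lch (point : CP R 2) I.
  have Uc' s : allin U s -> cod (@chern R 2) s = false.
    by move=> Us; apply: Uc; apply: allin_sub Us => y.
  (* Near the base point the cocycle is the coboundary of its cone there; adding this coboundary
     makes it vanish near that point. *)
  pose b : seq (CP R 2) -> bool := fun l => chern (point :: l).
  have hb : homog 2 b by move=> l l2; rewrite /b homog_chern.
  exists (fun s => chern s (+) cod b s); split.
  - by apply: homogD; [exact: homog_chern|exact: homog_cod].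
  - by apply: eq_lzT lch => s; rewrite codD cod_cod addbF.
  - exists U => // s Us.
    by rewrite (cone_cocycle (nbhs_singleton Uq) Uc' Us) addbb.
  - exact: chern_square_neq0.
have [u' [hu' lu' u0' su']] := @susp_class R _ _ u (@compact_iter_susp k _ (@compact_CP R 2))
  (@closed_point_iter_susp k _ clCP) hu lu u0.
by exists u'; split=> // /su'.
Qed.

(** By naturality the square of [u] pulled back along [g \o f] comes from a square on the wedge,
    which is exact; a homotopy from [g \o f] to the identity would make the square of [u] exact. *)
Lemma iter_susp_CP2_not_wedge k
    (f : iter_susp R k (CP R 2) -> wedge2 (sphere R k.+2) (sphere R k.+4))
    (g : wedge2 (sphere R k.+2) (sphere R k.+4) -> iter_susp R k (CP R 2)) :
  continuous f -> continuous g -> ~ homotopic R (g \o f) id.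
Proof.
move=> cf cg gf; have [u [hu lu _ nu]] := iter_susp_class k; apply: nu.
apply: (homotopy_cobound _ _ gf).
- exact/compact_iter_susp/compact_CP.
- exact: lz_cod_cup_square.
have [ | | | | |v lv] := @cobound_cup_wedge_spheres R k.+2 k.+4 k k.+4.+1 (u \o map g).
- exact: homog_map.
- by apply: eq_lzT (lz_pull (continuous_cont_on cg) (fun _ _ => I) lu) => s; rewrite /= cod_map.
- by rewrite !addSn !addnS.
- by rewrite !eqSS gtn_eqF.
- by rewrite !eqSS ltn_eqF.
exists (v \o map f).
have lf := lz_pull (@continuous_cont_on _ _ setT f cf) (fun _ _ => I) lv.
apply: eq_lzT lf => s /=; rewrite -cod_map; congr (_ (+) _).
by rewrite -cup_map -map_comp.
Qed.

End iterated_suspension.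

(** * The quotients of projective spaces are Hausdorff *)

Section projective_collapse.
Local Open Scope quotient_scope.
Context {R : realType} {n : nat}.
Local Open Scope complex_scope.
Implicit Types (x : CP R n) (z : 'rV[R[i]^o]_n.+1).

Lemma CP_subP m x : CP_sub m x <-> forall i : 'I_n.+1, (m < i)%N -> hcoord i x = 0.
Proof.
split=> [[z h <-]|h].
  have [c c0 E] := repCP_mk (set_mem (valP z)).
  have Ez : mkCP (set_val z) = \pi_(CP R n) z.
    by rewrite (mkCPE (valP z)); congr (\pi_(CP R n) _); exact: val_inj.
  by move=> i mi; rewrite /hcoord -Ez E coZ /co h// mulr0.
exists (repr x) => [i mi|]; [exact: h|exact: reprK].
Qed.

Lemma CP_sub_mk m z : z != 0 ->
  CP_sub m (mkCP z) <-> forall i : 'I_n.+1, (m < i)%N -> co z i = 0.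
Proof.
move=> z0; have [c c0 E] := repCP_mk z0; rewrite CP_subP /hcoord E.
split=> h i mi; last by rewrite coZ h// mulr0.
by move/eqP: (h i mi); rewrite coZ mulf_eq0 (negbTE c0) => /eqP.
Qed.

Lemma projector_diag x i : (projector x).1 i i = normsq (hcoord i x) / vnormsq (repCP x).
Proof. by rewrite mxE mulc_conj. Qed.

Lemma projector_diag_ge0 x i : 0 <= (projector x).1 i i.
Proof.
rewrite projector_diag divr_ge0 ?addr_ge0 ?sqr_ge0//.
by apply: ltW; rewrite vnormsq_gt0// repCP_neq0.
Qed.

Lemma projector_trace x : \tr (projector x).1 = 1.
Proof.
rewrite /mxtrace (eq_bigr (fun i => normsq (hcoord i x) / vnormsq (repCP x))).
  by rewrite -mulr_suml divff// gt_eqF// vnormsq_gt0// repCP_neq0.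
by move=> i _; rewrite projector_diag.
Qed.

Definition defect m x : R := \sum_(i < n.+1 | (m < i)%N) (projector x).1 i i.

Lemma defect_eq0 m x : defect m x = 0 <-> CP_sub m x.
Proof.
rewrite CP_subP /defect; split=> [/eqP|h].
  rewrite psumr_eq0 => [/allP h i mi|i _]; last exact: projector_diag_ge0.
  apply/eqP; apply: contraT => /normsq_gt0 ci.
  have := h i; rewrite mem_index_enum mi projector_diag /= => /(_ isT).
  by rewrite gt_eqF// divr_gt0// vnormsq_gt0// repCP_neq0.
apply: big1 => i mi; rewrite projector_diag h//.
by rewrite /normsq /= expr0n addr0 mul0r.
Qed.

(** [defect] vanishes exactly on the collapsed subspace. As a projector onto a line has trace 1, the
    trace of the product returns [defect], and dividing by it returns the projector. *)
Lemma embeds_CP_collapse m (x : CP R n) : CP_sub m x ->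
  embeds (R := R) (cpi (@CP_sub R n m) x).
Proof.
move=> Ax.
apply: (@embeds_collapse R _ _ x ('M[R]_n.+1 * 'M[R]_n.+1)%type (fun x => defect m x *: projector x)) => //.
- move=> y; apply: (@cvgZ _ _ _ (nbhs y)); last exact: con_projector.
  apply: (@cont_onT _ _ setT) => //; apply: con_sum => i; apply: con_coord.
  by apply: con_fst; apply: continuous_cont_on; exact: con_projector.
- move=> y; split=> [[E _]|/defect_eq0 ->]; last by rewrite scale0r.
  apply/defect_eq0; have := congr1 mxtrace E.
  by rewrite mxtraceZ projector_trace mulr1 mxtrace0.
- move=> y z nAy E; have := congr1 (mxtrace \o fst) E.
  rewrite /= !mxtraceZ !projector_trace !mulr1 => Ed.
  apply: projector_inj; move: E; rewrite -Ed => /eqP.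
  rewrite -subr_eq0 -scalerBr scaler_eq0 subr_eq0 => /orP[/eqP/defect_eq0//|/eqP//].
Qed.

End projective_collapse.

(** * Cube coordinates on iterated suspensions *)

Section suspension_coordinates.
Context {R : realType} (Y : ptopologicalType).
Implicit Types (y : Y) (t : nat -> unit_interval R).

Fixpoint suspc k y t : iter_susp R k Y :=
  if k is j.+1 then cpi (@susp_collapsed R (iter_susp R j Y)) (suspc j y t, t j) else y.

Lemma susp_pointE j : (point : iter_susp R j.+1 Y) =
  cpi (@susp_collapsed R (iter_susp R j Y)) (point, I0).
Proof. by []. Qed.

Lemma suspc_pointS j y t : suspc j.+1 y t = point <->
  [\/ t j = I0, t j = I1 | suspc j y t = point].
Proof.
rewrite susp_pointE; split=> [/cpi_eqP[[_ ->]|[]//]|h]; first exact: Or31.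
by apply/cpi_eqP; right; split=> //; exact: Or31.
Qed.

Lemma suspc_point k y t : suspc k y t = point <->
  y = point \/ exists2 i, (i < k)%N & t i = I0 \/ t i = I1.
Proof.
elim: k => [|k IH]; first by split=> [|[//|[]//]]; left.
rewrite suspc_pointS; split.
  case=> [h|h|/IH[->|[i ik h]]]; first (by right; exists k; [exact: ltnSn|left]);
    first (by right; exists k; [exact: ltnSn|right]); first by left.
  by right; exists i => //; exact: ltnW.
case=> [E|[j]]; first by apply: Or33; apply/IH; left.
rewrite ltnS leq_eqVlt => /predU1P[->|jk] h; first by case: h => ->; [exact: Or31|exact: Or32].
by apply: Or33; apply/IH; right; exists j.
Qed.

(** The iterated suspension is the product with a cube in which all degenerate points, described by
    [suspc_point], are identified. *)
Lemma suspc_eq k y t y' t' : suspc k y t = suspc k y' t' <->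
  (y = y' /\ forall i, (i < k)%N -> t i = t' i) \/
  suspc k y t = point /\ suspc k y' t' = point.
Proof.
elim: k => [|k IH]; first by split=> [h|[[]//|[/= -> ->]//]]; left.
split=> [/cpi_eqP[[E Et]|[L1 L2]]|[[E h]|[-> -> //]]].
- have [[-> h]|[E1 E2]] := IH.1 E.
    left; split=> // i; rewrite ltnS leq_eqVlt => /predU1P[->//|]; exact: h.
  by right; rewrite !suspc_pointS; split; exact: Or33.
- by right; split; apply/suspc_pointS.
- rewrite /= h//; congr (cpi _ (_, _)); apply/IH; left; split=> // i ik.
  by apply: h; exact: ltnW.
Qed.

Lemma suspc_surj k (x : iter_susp R k Y) : exists y t, suspc k y t = x.
Proof.
elim: k x => [|k IH] x; first by exists x, (fun=> I0).
have [y [t E]] := IH (csec x).1.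
exists y, (fun i => if i == k then (csec x).2 else t i); rewrite /= eqxx.
rewrite -[RHS]csecK [in RHS](surjective_pairing (csec x)) -E; congr (cpi _ (_, _)).
by apply/suspc_eq; left; split=> // i ik; rewrite ltn_eqF.
Qed.

Lemma con_suspc (T : topologicalType) (A : set T) k (f : T -> Y) (t : T -> nat -> unit_interval R) :
  cont_on A f -> (forall i, cont_on A (fun a => t a i)) -> cont_on A (fun a => suspc k (f a) (t a)).
Proof.
move=> cf ct; elim: k => [|k IH] //=.
by apply: con_comp (@cpi_continuous _ _) _; apply: con_pair.
Qed.

End suspension_coordinates.

(** * The quaternionic twist *)

Section quaternionic_twist.
Context {R : realType}.
Local Open Scope complex_scope.
Implicit Types (a b : nat -> R[i]) (w : R[i]) (r : R).

(* The quaternionic structure j on pairs of complex coordinates; it trivializes*)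
(* the sum of two copies of the tautological bundle over CP^1.                *)
Definition jrot a l : R[i] := if odd l then conjc (a l.-1) else - conjc (a l.+1).
(** Complex linear in [(w0, w1)] and real linear in [a]: as [(w0, w1)] varies it identifies a
    constant fibre with the fibres of the bundle. *)
Definition quat w0 w1 a l : R[i] := w0 * a l + w1 * jrot a l.

Lemma normsqN w : normsq (- w) = normsq w.
Proof. by case: w => x y; rewrite /normsq /= !sqrrN. Qed.

(** Since $j$ is antilinear with $j^2=-1$, the operator $w_0+w_1j$ behaves as a quaternion;
    multiplying by its conjugate gives $|w_0|^2+|w_1|^2$. *)
Lemma quat_inv w0 w1 a l :
  conjc w0 * quat w0 w1 a l - w1 * jrot (quat w0 w1 a) l =
  (normsq w0 + normsq w1)%:C * a l.
Proof.
rewrite rmorphD /= -!mulc_conj /quat {2}/jrot; case: (boolP (odd l)) => ol.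
  have l0 : (0 < l)%N by case: l ol.
  have o1 : odd l.-1 = false by rewrite -[l]prednK//= in ol *; apply/negbTE.
  rewrite /jrot ol o1 prednK// !(rmorphD, rmorphM, rmorphN) /= !conjcK; ring.
by rewrite /jrot (negbTE ol) /= ol /= !(rmorphD, rmorphM, rmorphN) /= !conjcK; ring.
Qed.

(** Evenness of [M] keeps the partner index of each [l < M] below [M]. *)
Lemma jrot_ext M a b l : ~~ odd M -> (l < M)%N ->
  (forall i, (i < M)%N -> a i = b i) -> jrot a l = jrot b l.
Proof.
move=> oM lM ab; rewrite /jrot; case: ifP => ol; rewrite ab//.
  by rewrite (leq_ltn_trans (leq_pred l)).
by rewrite ltn_neqAle lM andbT; apply: contraNneq oM => <-; rewrite /= ol.
Qed.

Lemma quat_ext M w0 w1 a b l : ~~ odd M -> (l < M)%N ->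
  (forall i, (i < M)%N -> a i = b i) -> quat w0 w1 a l = quat w0 w1 b l.
Proof. by move=> oM lM ab; rewrite /quat (jrot_ext oM lM ab) ab. Qed.

Lemma jrotZ r a l : jrot (fun i => r%:C * a i) l = r%:C * jrot a l.
Proof. by rewrite /jrot; case: ifP => _; rewrite rmorphM /= oppr0 ?mulrN. Qed.

Lemma quatZ r w0 w1 a l : quat w0 w1 (fun i => r%:C * a i) l = r%:C * quat w0 w1 a l.
Proof. by rewrite /quat jrotZ mulrDr !(mulrCA r%:C). Qed.

Lemma quat_inj M w0 w1 a b : ~~ odd M -> (w0 != 0) || (w1 != 0) ->
  (forall l, (l < M)%N -> quat w0 w1 a l = quat w0 w1 b l) ->
  forall l, (l < M)%N -> a l = b l.
Proof.
move=> oM w E l lM.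
have n0 : (normsq w0 + normsq w1)%:C != 0 :> R[i].
  rewrite eq_complex /= eqxx andbT gt_eqF//.
  have g w' : 0 <= normsq w' by rewrite addr_ge0 ?sqr_ge0.
  by case/orP: w => /normsq_gt0 h; rewrite ?(ltr_wpDr (g _) h) ?(ltr_wpDl (g _) h).
by apply: (mulfI n0); rewrite -!quat_inv E// (jrot_ext oM lM E).
Qed.

Lemma quat_surj w0 w1 (Z : nat -> R[i]) : (w0 != 0) || (w1 != 0) ->
  exists b, forall l, quat w0 w1 b l = Z l.
Proof.
move=> w; pose n : R := normsq w0 + normsq w1.
have n0 : 0 < n.
  have g w' : 0 <= normsq w' by rewrite addr_ge0 ?sqr_ge0.
  by case/orP: w => /normsq_gt0 h; rewrite /n ?(ltr_wpDr (g _) h) ?(ltr_wpDl (g _) h).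
exists (fun l => n^-1%:C * quat (conjc w0) (- w1) Z l) => l; rewrite quatZ.
have -> : quat w0 w1 (quat (conjc w0) (- w1) Z) l = n%:C * Z l.
  by have := quat_inv (conjc w0) (- w1) Z l; rewrite conjcK mulNr opprK normsqN normsq_conj.
by rewrite mulrA -rmorphM /= mulVf ?gt_eqF// mul1r.
Qed.

End quaternionic_twist.

(** * Homogeneous coordinates adapted to the trivialization *)

Section twisted_vectors.
Context {R : realType} (p N : nat).
Local Open Scope complex_scope.
Implicit Types (a b : nat -> R[i]) (z w c : R[i]) (r : R).
Local Notation vec := 'rV[R[i]^o]_N.+3.

(** The first [p] entries are untwisted copies ([p] is 1 for even [N] and 0 for odd [N]), the next
    ones are trivialized in pairs, and the last two are [(w0, w1)] scaled by [r]. At [r = 0] the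
    point lies in the collapsed subspace. *)
Definition tcoord z0 w0 w1 a r (j : nat) : R[i] :=
  if (j < p)%N then z0 else if (j <= N)%N then quat w0 w1 a (j - p)
  else if j == N.+1 then r%:C * w0 else r%:C * w1.
Definition tvec z0 w0 w1 a r : vec := \row_j (tcoord z0 w0 w1 a r j : R[i]^o).

Lemma co_tvec z0 w0 w1 a r i : co (tvec z0 w0 w1 a r) i = tcoord z0 w0 w1 a r i.
Proof. by rewrite /co mxE. Qed.

Lemma tvecZ c z0 w0 w1 a r : tvec (c * z0) (c * w0) (c * w1) a r = c *: tvec z0 w0 w1 a r.
Proof.
apply/rowP => j; rewrite -[LHS]/(co _ j) -[RHS]/(co _ j) coZ !co_tvec /tcoord /quat.
by do 3?case: ifP => _ //; rewrite ?mulrDr ?mulrA// (mulrC r%:C).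
Qed.

Lemma tvec_rescale z0 w0 w1 b r : r != 0 ->
  tvec z0 (r^-1%:C * w0) (r^-1%:C * w1) (fun l => r%:C * b l) r = tvec z0 w0 w1 b 1.
Proof.
move=> r0; have rr : r%:C * r^-1%:C = 1 :> R[i] by rewrite -rmorphM /= divff.
apply/rowP => j; rewrite -[LHS]/(co _ j) -[RHS]/(co _ j) !co_tvec /tcoord quatZ /quat.
do 3?case: ifP => _ //; rewrite ?mul1r ?mulrA ?rr ?mul1r//.
by rewrite mulrDr !mulrA rr !mul1r.
Qed.

Context (pN : (p <= N)%N) (p1 : (p <= 1)%N) (oM : ~~ odd (N.+1 - p)).

Lemma tcoord_last z0 w0 w1 a r :
  tcoord z0 w0 w1 a r N.+1 = r%:C * w0 /\ tcoord z0 w0 w1 a r N.+2 = r%:C * w1.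
Proof.
have h1 : (N.+1 < p)%N = false by apply/negbTE; rewrite -leqNgt; exact: leqW.
have h2 : (N.+2 < p)%N = false by apply/negbTE; rewrite -leqNgt; exact/leqW/leqW.
have h3 : (N.+2 <= N)%N = false by apply/negbTE; rewrite -ltnNge leqW.
by rewrite /tcoord h1 h2 h3 ltnn eqxx gtn_eqF.
Qed.

Lemma tcoord_quat z0 w0 w1 a r l : (l < N.+1 - p)%N ->
  tcoord z0 w0 w1 a r (l + p)%N = quat w0 w1 a l.
Proof. move=> lM; have lN : (l + p <= N)%N by rewrite -ltnS addnC -ltn_subRL.
by rewrite /tcoord ltnNge leq_addl /= lN addnK. Qed.

Lemma eq_tvec z0 w0 w1 a b r : (forall l, (l < N.+1 - p)%N -> a l = b l) ->
  tvec z0 w0 w1 a r = tvec z0 w0 w1 b r.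
Proof.
move=> ab; apply/rowP => j; rewrite -[LHS]/(co _ j) -[RHS]/(co _ j) !co_tvec /tcoord.
case: ltnP => // pj; case: leqP => // jN; apply: (quat_ext _ _ oM) => //.
by rewrite ltn_sub2r// ltnS.
Qed.

(** The last two coordinates give $r'w'=c\,rw$. Linearity of [quat] in [(w0, w1)] then turns the
    middle coordinates into an equality between two values of the same injective map. *)
Lemma tvec_inj c z0 w0 w1 a r z0' w0' w1' a' r' : c != 0 -> r != 0 -> r' != 0 ->
  (w0 != 0) || (w1 != 0) -> tvec z0' w0' w1' a' r' = c *: tvec z0 w0 w1 a r ->
  [/\ (0 < p)%N -> z0' = c * z0, r'%:C * w0' = c * (r%:C * w0),
      r'%:C * w1' = c * (r%:C * w1) &
      forall l, (l < N.+1 - p)%N -> r'%:C * a l = r%:C * a' l].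
Proof.
move=> c0 r0 r0' w /rowP E.
have {}E j : (j < N.+3)%N -> tcoord z0' w0' w1' a' r' j = c * tcoord z0 w0 w1 a r j.
  by move=> jN; have := E (Ordinal jN); rewrite -[LHS]/(co _ _) -[RHS]/(co _ _) coZ !co_tvec.
have [l1 l2] := tcoord_last z0 w0 w1 a r; have [l1' l2'] := tcoord_last z0' w0' w1' a' r'.
have E0 : r'%:C * w0' = c * (r%:C * w0) by rewrite -l1 -l1' E.
have E1 : r'%:C * w1' = c * (r%:C * w1) by rewrite -l2 -l2' E.
split=> // [p0|l lM]; first by have := E 0%N isT; rewrite /tcoord p0.
have cw : (c * w0 != 0) || (c * w1 != 0) by rewrite !mulf_eq0 !negb_or c0.
apply: (@quat_inj _ _ _ _ (fun l => r'%:C * a l) (fun l => r%:C * a' l) oM cw _ l lM) => {lM}l lM.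
rewrite [LHS]quatZ [RHS]quatZ.
have lN : (l + p < N.+3)%N.
  by rewrite addnC -ltn_subRL (leq_trans lM)// leq_sub2r// ltnW.
have := E _ lN; rewrite !tcoord_quat// => El.
transitivity (r'%:C * (c * quat w0 w1 a l)); first by rewrite /quat; ring.
rewrite -El /quat; transitivity ((r'%:C * w0') * a' l + (r'%:C * w1') * jrot a' l); first by ring.
by rewrite E0 E1; ring.
Qed.

Lemma tvec_surj (z : vec) : (co z (inord N.+1) != 0) || (co z (inord N.+2) != 0) ->
  exists b, tvec (co z ord0) (co z (inord N.+1)) (co z (inord N.+2)) b 1 = z.
Proof.
move=> w; have [b bP] := quat_surj (fun l => co z (inord (l + p))) w.
exists b; apply/rowP => j; rewrite -[LHS]/(co _ j) -[RHS]/(co _ j) co_tvec /tcoord.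
case: ltnP => [jp|pj].
  congr (co z _); apply: val_inj => /=; move: jp; case: (p) p1 => [|[|]] // _.
  by case: (nat_of_ord j).
case: leqP => [jN|Nj]; first by rewrite bP subnK// inord_val.
rewrite !mul1r; case: eqP => [jN|/eqP jN].
  by congr (co z _); apply: val_inj; rewrite /= inordK -?jN.
congr (co z _); apply: val_inj; rewrite /= inordK//.
by apply/eqP; rewrite eq_sym eqn_leq -ltnS ltn_ord /= ltn_neqAle eq_sym jN.
Qed.

Lemma tvec_neq0 z0 w0 w1 a r : (w0 != 0) || (w1 != 0) ->
  r != 0 \/ (exists2 l, (l < N.+1 - p)%N & a l != 0) -> tvec z0 w0 w1 a r != 0.
Proof.
move=> w h; apply/eqP => /rowP E.
have {}E j : (j < N.+3)%N -> tcoord z0 w0 w1 a r j = 0.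
  by move=> jN; have := E (Ordinal jN); rewrite -[LHS]/(co _ _) co_tvec mxE.
have [l1 l2] := tcoord_last z0 w0 w1 a r.
case: h => [r0|[l lM] /eqP[]].
  have rC : r%:C != 0 :> R[i] by rewrite eq_complex /= negb_and r0.
  move: l1 l2 w; rewrite !E// => /esym/eqP; rewrite mulf_eq0 (negbTE rC) => /= /eqP -> /esym/eqP.
  by rewrite mulf_eq0 (negbTE rC) => /= /eqP ->; rewrite eqxx.
apply: (@quat_inj _ _ _ _ a (fun=> 0) oM w _ l lM) => {lM}l lM.
have lN : (l + p < N.+3)%N.
  by rewrite addnC -ltn_subRL (leq_trans lM)// leq_sub2r// ltnW.
rewrite -(tcoord_quat z0 w0 w1 a r lM) E// /quat /jrot mulr0 conjc0 oppr0 if_same mulr0 addr0.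
by [].
Qed.

End twisted_vectors.

(** * Real cubes as complex vectors, and radial compression *)

Section real_coordinates.
Context {R : realType}.
Local Open Scope complex_scope.

Definition rv m (T : 'rV[R]_m) (j : nat) : R := if insub j is Some i then T 0 i else 0.
Definition cplx m (T : 'rV[R]_m) (l : nat) : R[i] := rv T l.*2 +i* rv T l.*2.+1.
Definition realv m (b : nat -> R[i]) : 'rV[R]_m :=
  \row_(j < m) (if odd j then Im (b j./2) else Re (b j./2)).

Lemma rvE m (T : 'rV[R]_m) (i : 'I_m) : rv T i = T 0 i.
Proof. by rewrite /rv valK. Qed.

Lemma rvZ m (r : R) (T : 'rV[R]_m) j : rv (r *: T) j = r * rv T j.
Proof. by rewrite /rv; case: insubP => [i _ _|_]; rewrite ?mxE ?mulr0. Qed.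

Lemma rv_le_norm m (T : 'rV[R]_m) j : `|rv T j| <= `|T|.
Proof. by rewrite /rv; case: insubP => [i _ _|_]; rewrite ?normr0//; exact: coord_le_norm. Qed.

Lemma cplxZ m (r : R) (T : 'rV[R]_m) l : cplx (r *: T) l = r%:C * cplx T l.
Proof. by apply/eqP; rewrite eq_complex /cplx /= !rvZ !mul0r subr0 addr0 !eqxx. Qed.

Lemma cplx_realv m b l : (l.*2.+1 < m)%N -> cplx (realv m b) l = b l.
Proof.
move=> lm; rewrite /cplx.
have := rvE (realv m b) (Ordinal lm); have := rvE (realv m b) (Ordinal (ltnW lm)).
rewrite !mxE /= odd_double uphalf_double doubleK => -> ->.
by case: (b l).
Qed.

Lemma cplx_inj M (T T' : 'rV[R]_M.*2) :
  (forall l, (l < M)%N -> cplx T l = cplx T' l) -> T = T'.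
Proof.
move=> h; apply/rowP => j; rewrite -!rvE.
have jM : (j./2 < M)%N by rewrite ltn_half_double.
have := h _ jM; rewrite -[X in rv T X]odd_double_half -[X in rv T' X]odd_double_half.
by case: (odd j) => /= -[].
Qed.

Lemma cplx_neq0 M (T : 'rV[R]_M.*2) : T != 0 -> exists2 l, (l < M)%N & cplx T l != 0.
Proof.
move=> T0; apply: contrapT => h; move/eqP: T0; apply; apply: cplx_inj => l lM.
have -> : cplx (0 : 'rV[R]_M.*2) l = 0 by rewrite -(scale0r (0 : 'rV[R]_M.*2)) cplxZ mul0r.
by apply/eqP; apply: contrapT => /negP n; apply: h; exists l.
Qed.

Lemma con_rv (X : topologicalType) (A : set X) m (f : X -> 'rV[R]_m) j :
  cont_on A f -> cont_on A (fun x => rv (f x) j).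
Proof. by move=> cf; rewrite /rv; case: insubP => [i _ _|_]; [exact: con_coord|exact: con_cst]. Qed.

Lemma con_cplx (X : topologicalType) (A : set X) m (f : X -> 'rV[R]_m) l :
  cont_on A f -> con_onC A (fun x => cplx (f x) l).
Proof. by move=> cf; apply: con_complexC; exact: con_rv. Qed.

(** Injectivity of $x\mapsto x/(1-|x|)$ on the open ball, with denominators cleared: norms are
    compared first. [radial_surj] is the matching surjectivity. *)
Lemma radial_inj (V : normedModType R) (x y : V) : `|x| < 1 -> `|y| < 1 ->
  (1 - `|y|) *: x = (1 - `|x|) *: y -> x = y.
Proof.
move=> x1 y1 E; have E2 : `|x| = `|y|.
  move: (congr1 Num.norm E); rewrite !normrZ !ger0_norm ?subr_ge0 ?ltW//; lra.
by apply: (scalerI (a := 1 - `|y|)); rewrite ?subr_eq0 ?gt_eqF// E E2.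
Qed.

Lemma radial_surj (V : normedModType R) (b : V) :
  exists2 r : R, 0 < r & 1 - `|r *: b| = r.
Proof.
have b1 : 0 < 1 + `|b| by rewrite ltr_wpDr.
exists (1 + `|b|)^-1; first by rewrite invr_gt0.
rewrite normrZ ger0_norm ?invr_ge0 ?ltW//.
by apply: (mulIf (lt0r_neq0 b1)); rewrite mulrBl mulrAC mulVf ?gt_eqF//; lra.
Qed.

End real_coordinates.

Section homeomorphism.
Context {R : realType}.

Lemma homeo_homotopy_equivalent (X Y : topologicalType) (f : X -> Y) (g : Y -> X) :
  continuous f -> continuous g -> cancel f g -> cancel g f -> homotopy_equivalent R X Y.
Proof.
move=> cf cg fK gK; exists f, g; split=> //.
- exists fst; split=> [|x /=|//]; last by rewrite fK.
  by apply: (@cont_onT _ _ setT) => //; apply: con_fst; exact: con_id.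
- exists fst; split=> [|x /=|//]; last by rewrite gK.
  by apply: (@cont_onT _ _ setT) => //; apply: con_fst; exact: con_id.
Qed.

End homeomorphism.

Section twisted_vectors_topology.
Context {R : realType} (p N : nat).
Local Open Scope complex_scope.

Lemma con_tvec (X : topologicalType) (A : set X) (z0 w0 w1 : X -> R[i]) (a : X -> nat -> R[i])
    (r : X -> R) : con_onC A z0 -> con_onC A w0 -> con_onC A w1 ->
  (forall l, con_onC A (fun x => a x l)) -> cont_on A r ->
  cont_on A (fun x => tvec p N (z0 x) (w0 x) (w1 x) (a x) (r x)).
Proof.
move=> c0 c1 c2 ca cr; apply: con_mx => i j.
under [X in cont_on _ X]funext do rewrite mxE; rewrite /tcoord.
case: (j < p)%N; first exact: c0.
case: (j <= N)%N; last first.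
  by case: (_ == _); [exact: (con_MC (con_real cr) c1)|exact: (con_MC (con_real cr) c2)].
have cj : con_onC A (fun x => jrot (a x) (j - p)).
  rewrite /jrot; case: (odd _); first exact: (con_conj (ca _)).
  have := con_MC (@con_cstC R X A (-1)) (con_conj (ca (j - p).+1)).
  by apply: eq_cont_on => x _; rewrite mulN1r.
exact: (con_DC (con_MC c1 (ca _)) (con_MC c2 cj)).
Qed.

Lemma CP_sub_tvec z0 w0 w1 a (r : R) : (p <= N)%N -> tvec p N z0 w0 w1 a r != 0 ->
  @CP_sub R N.+2 N (mkCP (tvec p N z0 w0 w1 a r)) <-> r = 0 \/ w0 = 0 /\ w1 = 0.
Proof.
move=> pN /CP_sub_mk ->; have [l1 l2] := tcoord_last pN z0 w0 w1 a r; split=> [h|h i].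
  have := h (inord N.+1); have := h (inord N.+2); rewrite !co_tvec !inordK//.
  rewrite l1 l2 => /(_ (leqnSn _)) /eqP; rewrite mulf_eq0 => e2 /(_ (leqnn _)) /eqP; rewrite mulf_eq0 => e1.
  have [r0|r0] := eqVneq r 0; [by left|right].
  have rC : (r%:C == 0 :> R[i]) = false by rewrite eq_complex /= eqxx andbT (negbTE r0).
  by move: e1 e2; rewrite rC /= => /eqP -> /eqP ->.
rewrite co_tvec => Ni.
have z1 : r%:C * w0 = 0 by case: h => [->|[-> _]]; rewrite ?mul0r ?mulr0.
have z2 : r%:C * w1 = 0 by case: h => [->|[_ ->]]; rewrite ?mul0r ?mulr0.
rewrite /tcoord ltnNge (leq_trans pN (ltnW Ni))//= leqNgt Ni /=.
by case: ifP.
Qed.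

Lemma CP_sub_coords (x : CP R N.+2) : ~ CP_sub N x ->
  (co (repCP x) (inord N.+1) != 0) || (co (repCP x) (inord N.+2) != 0).
Proof.
move=> nAx; rewrite -negb_and; apply/negP => /andP[/eqP h1 /eqP h2]; apply: nAx.
apply/CP_subP => i Ni; rewrite /hcoord.
have [E|E] := eqVneq (nat_of_ord i) N.+1.
  by rewrite (_ : i = inord N.+1)//; apply: val_inj; rewrite /= inordK.
rewrite (_ : i = inord N.+2)//; apply: val_inj; rewrite /= inordK//; apply/eqP.
by rewrite eqn_leq -ltnS ltn_ord /= ltn_neqAle eq_sym E.
Qed.

Lemma CP_sub_point n m : CP_sub m (point : CP R n).
Proof.
exists (exist (fun z => z \in @nonzero_vec R n) _ (@CP_point_subproof R n)) => //.
move=> i mi; rewrite /= /set_val /= mxE eqxx /= -val_eqE /= gtn_eqF//.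
exact: leq_ltn_trans mi.
Qed.

End twisted_vectors_topology.

(** * Even $n$: a homeomorphism with the iterated suspension *)

Section even_case.
Context {R : realType} (N : nat) (N0 : (0 < N)%N) (oN : ~~ odd N).
Local Open Scope complex_scope.
Local Notation i1 := (inord 1 : 'I_3).
Local Notation i2 := (inord 2 : 'I_3).
Local Notation A := (@CP_sub R N.+2 N).
Local Notation par := (CP R 2 * 'rV[R]_N.*2)%type.

(** $(z_0:w_0:w_1)$ is the point of $\mathbb CP^2$, the Thom space of the untwisted copy. The factor
    $1-|T|$ compresses the remaining fibre into a cube whose boundary goes to $\mathbb CP^N$. *)
Definition twist_vec (z : 'rV[R[i]^o]_3) (T : 'rV[R]_N.*2) : 'rV[R[i]^o]_N.+3 :=
  tvec 1 N (co z ord0) (co z i1) (co z i2) (cplx T) (1 - `|T|).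
Definition twist_param (y : par) : CP R N.+2 := mkCP (twist_vec (repCP y.1) y.2).
Definition degenerate (y : par) : Prop := `|y.2| = 1 \/ y.1 = point.

Let oM : ~~ odd (N.+1 - 1). Proof. by rewrite subn1. Qed.
Let p1 : (1 <= 1)%N. Proof. by []. Qed.

Lemma twist_vecZ c z T : twist_vec (c *: z) T = c *: twist_vec z T.
Proof. by rewrite /twist_vec !coZ tvecZ. Qed.

Lemma ord3P (P : 'I_3 -> Prop) : P ord0 -> P i1 -> P i2 -> forall i, P i.
Proof.
move=> h0 h1 h2 i; have := ltn_ord i; case E : (nat_of_ord i) => [|[|[|k]]] // _.
- by rewrite (_ : i = ord0)//; exact: val_inj.
- by rewrite (_ : i = i1)//; apply: val_inj; rewrite /= inordK.
- by rewrite (_ : i = i2)//; apply: val_inj; rewrite /= inordK.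
Qed.

Lemma repCP_point3 (y : CP R 2) : y = point <-> co (repCP y) i1 = 0 /\ co (repCP y) i2 = 0.
Proof.
have E : mkCP (delta_mx 0 0 : 'rV[R[i]^o]_3) = (point : CP R 2).
  by rewrite (mkCPE (@CP_point_subproof R 2)).
have d0 : (delta_mx 0 0 : 'rV[R[i]^o]_3) != 0 := set_mem (@CP_point_subproof R 2).
split=> [->|[h1 h2]].
  have [c c0 Ec] := repCP_mk d0; rewrite -E Ec !coZ /co !mxE /=.
  by rewrite -!val_eqE /= !inordK// mulr0.
have [i ni] := vec_neq0 (repCP_neq0 y).
have n0 : co (repCP y) ord0 != 0.
  by apply: contra ni => /eqP h0; apply/eqP; elim/ord3P : i.
rewrite -E -(repCPK y) -(mkCPZ (delta_mx 0 0) n0); congr mkCP; apply/rowP => j.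
rewrite -[LHS]/(co _ j) -[RHS]/(co _ j) coZ /co [in RHS]mxE; elim/ord3P : j.
- by rewrite eqxx mulr1.
- by rewrite -!val_eqE /= inordK// mulr0.
- by rewrite -!val_eqE /= inordK// mulr0.
Qed.

Lemma twist_vec_neq0 z T : z != 0 -> twist_vec z T != 0.
Proof.
move=> z0; have [/orP w|] := boolP ((co z i1 != 0) || (co z i2 != 0)).
  apply: tvec_neq0 => //; first exact/orP.
  have [T1|T1] := eqVneq `|T| 1; last by left; rewrite subr_eq0 eq_sym.
  by right; rewrite subn1; apply: cplx_neq0; rewrite -normr_gt0 T1.
rewrite negb_or !negbK => /andP[/eqP h1 /eqP h2].
have [i ni] := vec_neq0 z0; apply: (@co_neq0 _ _ _ ord0).
rewrite co_tvec /tcoord /=; apply: contra ni => /eqP h0; apply/eqP.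
by elim/ord3P : i.
Qed.

Lemma twist_param_sub y : `|y.2| <= 1 -> A (twist_param y) <-> degenerate y.
Proof.
move=> T1; rewrite /twist_param /degenerate CP_sub_tvec//; last exact/twist_vec_neq0/repCP_neq0.
rewrite repCP_point3; split=> -[h|h]; by [left; lra|right].
Qed.

Lemma twist_param_inj y y' : `|y.2| <= 1 -> `|y'.2| <= 1 -> ~ degenerate y ->
  twist_param y = twist_param y' -> y = y'.
Proof.
move=> T1 T1' dy E; have dy' : ~ degenerate y'.
  by move=> /(twist_param_sub T1'); rewrite -E => /(twist_param_sub T1).
have n1 : `|y.2| < 1 by rewrite lt_neqAle T1 andbT; apply/eqP => h; apply: dy; left.
have n1' : `|y'.2| < 1 by rewrite lt_neqAle T1' andbT; apply/eqP => h; apply: dy'; left.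
have w : (co (repCP y.1) i1 != 0) || (co (repCP y.1) i2 != 0).
  by rewrite -negb_and; apply/negP => /andP[/eqP h1 /eqP h2]; apply: dy; right; apply/repCP_point3.
move: E => /mkCP_eqP [||c c0 E]; [exact/twist_vec_neq0/repCP_neq0..|].
have r0 : 1 - `|y.2| != 0 by rewrite subr_eq0 gt_eqF.
have r0' : 1 - `|y'.2| != 0 by rewrite subr_eq0 gt_eqF.
have [e0 e1 e2 ea] := tvec_inj N0 oM c0 r0 r0' w E.
have ET : y.2 = y'.2.
  apply: radial_inj => //; apply: cplx_inj => l lN; rewrite !cplxZ; apply: ea.
  by rewrite subn1.
have rC : (1 - `|y'.2|)%:C != 0 :> R[i] by rewrite eq_complex /= negb_and r0'.
rewrite (surjective_pairing y) (surjective_pairing y') -ET; congr (_, _).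
rewrite -(repCPK y.1) -(repCPK y'.1) -(mkCPZ (repCP y.1) c0); congr mkCP.
apply/rowP => j; rewrite -[LHS]/(co _ j) -[RHS]/(co _ j) coZ; elim/ord3P : j.
- exact/esym/e0.
- by apply: (mulfI rC); rewrite e1 ET mulrCA.
- by apply: (mulfI rC); rewrite e2 ET mulrCA.
Qed.

(** Solve for the fibre vector at scale 1, multiply it by [r] to bring it into the cube, and
    compensate by dividing $(w_0,w_1)$ by [r] ([tvec_rescale]). *)
Lemma twist_param_surj x : ~ A x -> exists2 y, `|y.2| <= 1 & twist_param y = x.
Proof.
move=> nAx; set z := repCP x; have w := CP_sub_coords nAx.
have [b bE] := tvec_surj p1 w.
have [r r0 rE] := radial_surj (realv N.*2 b).
pose z3 : 'rV[R[i]^o]_3 := \row_j (if j == ord0 then co z ord0 else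
  if j == i1 then r^-1%:C * co z (inord N.+1) else r^-1%:C * co z (inord N.+2) : R[i]^o).
have c0 : co z3 ord0 = co z ord0 by rewrite /co mxE.
have c1 : co z3 i1 = r^-1%:C * co z (inord N.+1).
  by rewrite {1}/co mxE -!val_eqE /= inordK.
have c2 : co z3 i2 = r^-1%:C * co z (inord N.+2).
  by rewrite {1}/co mxE -!val_eqE /= !inordK.
have rC : r^-1%:C != 0 :> R[i] by rewrite eq_complex /= negb_and invr_eq0 gt_eqF.
have z30 : z3 != 0.
  case/orP: w => w; [apply: (@co_neq0 _ _ _ i1)|apply: (@co_neq0 _ _ _ i2)].
    by rewrite c1 mulf_neq0.
  by rewrite c2 mulf_neq0.
exists (mkCP z3, r *: realv N.*2 b); first by rewrite /= -subr_ge0 rE ltW.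
have [c cn0 E] := repCP_mk z30.
rewrite /twist_param /= E twist_vecZ mkCPZ// -[RHS]repCPK; congr mkCP.
rewrite /twist_vec c0 c1 c2 rE -[RHS]bE -(tvec_rescale _ _ _ _ _ _ (lt0r_neq0 r0)).
apply: eq_tvec => // l lN; rewrite cplxZ cplx_realv//.
by rewrite -doubleS leq_double; move: lN; rewrite subn1.
Qed.

Lemma con_twist_param : continuous twist_param.
Proof.
apply: (@cont_onT _ _ setT) => //; apply: con_CP.
set B := [set _ | _].
apply: (@eq_cont_on _ _ _ (fun zt => mkCP (twist_vec zt.1 zt.2))).
  move=> [z T] /= [z0 _]; have [c c0 E] := repCP_mk z0.
  by rewrite /twist_param /= E twist_vecZ mkCPZ.
apply: con_mkCP; last by move=> [z T] [z0 _]; exact: twist_vec_neq0.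
have cz : cont_on B (fun zt => zt.1) by apply: con_fst; exact: con_id.
have cT : cont_on B (fun zt => zt.2) by apply: con_snd; exact: con_id.
apply: con_tvec; try exact: (con_co cz).
- by move=> l; exact: con_cplx.
- by apply: con_D; [exact: con_cst|apply: con_N; exact: con_norm].
Qed.

Definition cube_time (T : 'rV[R]_N.*2) (j : nat) : unit_interval R := clampI ((rv T j + 1) / 2).

Lemma val_cube_time T j : `|T| <= 1 -> set_val (cube_time T j) = (rv T j + 1) / 2 :> R.
Proof.
move=> T1; apply: val_clampI; have := le_trans (rv_le_norm T j) T1.
by rewrite ler_norml => /andP[h1 h2]; apply/andP; split; lra.
Qed.

Lemma cube_time_end T : `|T| <= 1 ->
  `|T| = 1 <-> exists2 j, (j < N.*2)%N & cube_time T j = I0 \/ cube_time T j = I1.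
Proof.
move=> T1; split=> [E|[j jN h]].
  have [|i Ei] := @rowvec_norm_attained _ _ T; first by rewrite -normr_gt0 E.
  exists (nat_of_ord i); first exact: ltn_ord.
  have := val_cube_time i T1; rewrite rvE => Ev.
  have : `|T 0 i| = 1 by rewrite -Ei.
  move=> /eqP; rewrite eqr_norml ler01 andbT => /orP[/eqP h|/eqP h].
    by right; apply: I1P; rewrite Ev h; lra.
  by left; apply: I0P; rewrite Ev h; lra.
apply/eqP; rewrite eq_le T1 /=; apply: le_trans (rv_le_norm T j).
have := val_cube_time j T1; case: h => ->; rewrite ?set_val_I0 ?set_val_I1 => h.
  by rewrite (_ : rv T j = -1) ?normrN ?normr1//; lra.
by rewrite (_ : rv T j = 1) ?normr1//; lra.
Qed.

(** Both presentations are injective off the degenerate points and identify all of these with one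
    another, so their kernels agree. *)
Theorem even_homeomorphism :
  exists (f : collapse A -> iter_susp R N.*2 (CP R 2)) (g : iter_susp R N.*2 (CP R 2) -> collapse A),
    [/\ continuous f, continuous g, cancel f g & cancel g f].
Proof.
pose K := [set y : par | `|y.2| <= 1].
pose q1 (y : par) := cpi A (twist_param y).
pose q2 (y : par) := suspc (R := R) N.*2 y.1 (cube_time y.2).
have dP y : K y -> q2 y = point <-> degenerate y.
  move=> Ky; rewrite /q2 suspc_point -(cube_time_end Ky) /degenerate; tauto.
have k1 a b : K a -> K b -> q1 a = q1 b <-> a = b \/ degenerate a /\ degenerate b.
  move=> Ka Kb; rewrite /q1 cpi_eqP !twist_param_sub//; split=> [[E|]|[->|]]; [|by right|by left|by right].
  have [da|da] := pselect (degenerate a); last by left; exact: twist_param_inj E.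
  by right; split=> //; apply/(twist_param_sub Kb); rewrite -E; exact/twist_param_sub.
have k2 a b : K a -> K b -> q2 a = q2 b <-> a = b \/ degenerate a /\ degenerate b.
  move=> Ka Kb; rewrite -(dP _ Ka) -(dP _ Kb) suspc_eq; split=> [[[E h]|]|[->|]]; [|by right| by left|by right].
  left; rewrite (surjective_pairing a) (surjective_pairing b) E; congr (_, _).
  apply/rowP => i; have := congr1 (fun t : unit_interval R => set_val t : R) (h i (ltn_ord i)).
  by rewrite !val_cube_time// !rvE; lra.
apply: (@same_kernel_homeo par (collapse A) (iter_susp R N.*2 (CP R 2)) K q1 q2).
- exact: embeds_hausdorff (embeds_CP_collapse (CP_sub_point _ _)).
- exact: embeds_hausdorff (embeds_iter_susp _ (embeds_CP (R := R) (n := 2))).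
- rewrite (_ : K = setT `*` [set T | `|T| <= 1]); last first.
    by apply/seteqP; split=> [y|y []].
  by apply: compact_setX; [exact: compact_CP|exact: compact_cube].
- apply: con_comp (@cpi_continuous _ _) _; apply: continuous_cont_on; exact: con_twist_param.
- apply: con_suspc; first by apply: con_fst; exact: con_id.
  move=> j; apply: con_clampI; apply: con_M; last exact: con_cst.
  by apply: con_D; [apply: con_rv; apply: con_snd; exact: con_id|exact: con_cst].
- apply/seteqP; split=> // x _; have [Ax|nAx] := pselect (A (csec x)).
    exists (point, 0); first by rewrite /K /= normr0.
    rewrite -[RHS]csecK; apply/cpi_eqP; right; split=> //.
    by apply/twist_param_sub; [rewrite normr0|right].
  have [y y1 E] := twist_param_surj nAx; exists y => //.
  by rewrite /q1 E csecK.
- apply/seteqP; split=> // x _; have [y [t E]] := suspc_surj x.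
  exists (y, \row_j (2 * set_val (t j) - 1)).
    rewrite /K /=; apply/rowvec_norm_le => // j; rewrite mxE.
    by have := unit_intervalP (t j); rewrite ler_norml => /andP[h1 h2]; apply/andP; split; lra.
  rewrite -E; apply/suspc_eq; left; split=> // j jN; rewrite /cube_time /=.
  rewrite (rvE _ (Ordinal jN)) mxE /= subrK mulrC mulKf ?pnatr_eq0//.
  exact: clampI_val.
- by move=> a b Ka Kb; rewrite k1// k2.
Qed.

End even_case.

(** * Attaching a cell along homotopic maps *)

Lemma hausdorff_prod (X Y : topologicalType) :
  hausdorff_space X -> hausdorff_space Y -> hausdorff_space (X * Y)%type.
Proof.
move=> hX hY [x y] [x' y'] h; congr (_, _).
  apply: hX => U V Ux Vx.
  have [||[a b] [/= [Ua _] [Va _]]] := h (U `*` setT) (V `*` setT); last by exists a.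
    by exists (U, setT) => //; split=> //; exact: filterT.
  by exists (V, setT) => //; split=> //; exact: filterT.
apply: hY => U V Uy Vy.
have [||[a b] [/= [_ Ub] [_ Vb]]] := h (setT `*` U) (setT `*` V); last by exists b.
  by exists (setT, U) => //; split=> //; exact: filterT.
by exists (setT, V) => //; split=> //; exact: filterT.
Qed.

Lemma con_if {R : realType} (X V : topologicalType) (A : set X) (c : X -> R) (f g : X -> V) :
  closed A -> cont_on setT c ->
  cont_on (A `&` [set x | c x <= 0]) f -> cont_on (A `&` [set x | 0 <= c x]) g ->
  (forall x, A x -> c x = 0 -> f x = g x) ->
  cont_on A (fun x => if c x <= 0 then f x else g x).
Proof.
move=> clA cc cf cg fg.
have -> : A = (A `&` [set x | c x <= 0]) `|` (A `&` [set x | 0 <= c x]).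
  rewrite -setIUr; apply/seteqP; split=> x; last by case.
  by move=> Ax; split=> //; case: (leP (c x) 0) => h; [left|right => /=; exact: ltW].
have cc' x : {for x, continuous c}.
  by move: x; apply: (@cont_onT _ _ setT).
apply: con_closedU.
- by apply: closedI => //; apply: (@preimage_closed _ _ c [set t | t <= 0]) => [x _|]; [exact: cc'|exact: closed_le].
- by apply: closedI => //; apply: (@preimage_closed _ _ c [set t | 0 <= t]) => [x _|]; [exact: cc'|exact: closed_ge].
- by apply: eq_cont_on cf => x [_ /= ->].
- apply: eq_cont_on cg => x [Ax /= x0]; case: leP => // x0'.
  by rewrite fg//; apply/eqP; rewrite eq_le x0 x0'.
Qed.

Section block_norms.
Context {R : realType} {p q : nat}.
Implicit Types y : 'rV[R]_(p + q).

Lemma norm_rsubmx y : `|rsubmx y| <= `|y|.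
Proof. by apply/rowvec_norm_le => // i; rewrite mxE; exact: coord_le_norm. Qed.

Lemma norm_lsubmx y : `|lsubmx y| <= `|y|.
Proof. by apply/rowvec_norm_le => // i; rewrite mxE; exact: coord_le_norm. Qed.

Lemma norm_row_blocks y : `|y| = Num.max `|lsubmx y| `|rsubmx y|.
Proof.
apply/eqP; rewrite eq_le ge_max norm_lsubmx norm_rsubmx !andbT.
apply/rowvec_norm_le => [|l]; first by rewrite le_max normr_ge0.
case: (split_ordP l) => j -> /=; rewrite le_max.
  by have := coord_le_norm (lsubmx y) j; rewrite mxE => ->.
by have := coord_le_norm (rsubmx y) j; rewrite mxE => ->; rewrite orbT.
Qed.

Lemma con_rsubmx (X : topologicalType) (A : set X) (f : X -> 'rV[R]_(p + q)) :
  cont_on A f -> cont_on A (fun x => rsubmx (f x)).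
Proof.
by move=> cf; apply: con_mx => i j; under [X in cont_on _ X]funext do rewrite mxE; exact: con_coord.
Qed.

Lemma con_lsubmx (X : topologicalType) (A : set X) (f : X -> 'rV[R]_(p + q)) :
  cont_on A f -> cont_on A (fun x => lsubmx (f x)).
Proof.
by move=> cf; apply: con_mx => i j; under [X in cont_on _ X]funext do rewrite mxE; exact: con_coord.
Qed.

Lemma norm_scale_rsubmx (k : R) y : `|(k / `|y|) *: rsubmx y| <= `|k|.
Proof.
rewrite normrZ normrM normfV normr_id -mulrA ler_piMr// mulrC.
have [->|y0] := eqVneq `|y| 0; first by rewrite invr0 mulr0.
by rewrite ler_pdivrMr ?lt0r ?y0 ?mul1r ?norm_rsubmx/=.
Qed.

End block_norms.

Lemma con_scale {R : realType} (X : topologicalType) (A : set X) m n (k : X -> R)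
    (f : X -> 'M[R]_(m, n)) :
  cont_on A k -> cont_on A f -> cont_on A (fun x => k x *: f x).
Proof.
move=> ck cf; apply: con_mx => i j; under [X in cont_on _ X]funext do rewrite mxE.
by apply: con_M => //; exact: con_coord.
Qed.

Section two_cells.
Context {R : realType} {m : nat}.
Local Notation I := (unit_interval R).
Local Notation dvec := 'rV[R]_(2 + m).
Local Notation svec := 'rV[R]_m.

(* [qS] presents an m-sphere as a cube modulo its boundary, and [qD] attaches *)
(* an (m+2)-cube to it along e times the projection to the last m coordinates. *)
Record two_cells (e : R) (Q : topologicalType) (qD : dvec -> Q) (qS : svec -> Q) : Prop := TwoCells {
  cells_hausdorff : hausdorff_space Q;
  cells_conD : cont_on [set y : dvec | `|y| <= 1] qD;
  cells_conS : cont_on [set T : svec | `|T| <= 1] qS;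
  cells_surj : forall x, (exists2 y, `|y| <= 1 & qD y = x) \/ (exists2 T, `|T| <= 1 & qS T = x);
  cells_bd : forall y, `|y| = 1 -> qD y = qS (e *: rsubmx y);
  cells_injD : forall y y', `|y| < 1 -> `|y'| <= 1 -> qD y = qD y' -> y = y';
  cells_DS : forall y T, `|y| < 1 -> `|T| <= 1 -> qD y <> qS T;
  cells_injS : forall T T', `|T| <= 1 -> `|T'| <= 1 ->
    qS T = qS T' <-> T = T' \/ `|T| = 1 /\ `|T'| = 1 }.

Lemma norm_attach e (y : dvec) : 0 <= e <= 1 -> `|y| <= 1 -> `|e *: rsubmx y| <= 1.
Proof.
move=> /andP[e0 e1] y1; rewrite normrZ ger0_norm//.
by apply: mulr_ile1 => //; exact: le_trans (norm_rsubmx y) y1.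
Qed.

(** The images of the two cylinders are closed and cover [Q * I]; continuity holds on each by
    [con_chart], and the two pieces fit along the boundary of the cube. *)
Lemma cells_glue e (Q V : topologicalType) (qD : dvec -> Q) (qS : svec -> Q)
    (hD : dvec * I -> V) (hS : svec * I -> V) : 0 <= e <= 1 -> two_cells e qD qS ->
  cont_on [set z : dvec * I | `|z.1| <= 1] hD -> cont_on [set z : svec * I | `|z.1| <= 1] hS ->
  (forall T T' s, `|T| = 1 -> `|T'| = 1 -> hS (T, s) = hS (T', s)) ->
  (forall y s, `|y| = 1 -> hD (y, s) = hS (e *: rsubmx y, s)) ->
  exists h : Q * I -> V, [/\ continuous h, forall y s, `|y| <= 1 -> h (qD y, s) = hD (y, s) &
    forall T s, `|T| <= 1 -> h (qS T, s) = hS (T, s)].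
Proof.
move=> e01 [hQ cD cS sur bd iD DS iS] chD chS hSb hDb.
have hSE T T' s : `|T| <= 1 -> `|T'| <= 1 -> qS T = qS T' -> hS (T, s) = hS (T', s).
  by move=> T1 T1' /(iS _ _ T1 T1')[->//|[]]; exact: hSb.
have hDE (y : dvec) : `|y| = 1 -> qD y = qS (e *: rsubmx y) /\ `|e *: rsubmx y| <= 1.
  by move=> y1; split; [exact: bd|apply: norm_attach; rewrite ?y1].
have /choice [r rP] : forall x, exists u : dvec + svec,
    match u with inl y => `|y| <= 1 /\ qD y = x | inr T => `|T| <= 1 /\ qS T = x end.
  by move=> x; have [[y y1 E]|[T T1 E]] := sur x; [exists (inl y)|exists (inr T)].
pose h (z : Q * I) := match r z.1 with inl y => hD (y, z.2) | inr T => hS (T, z.2) end.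
have lt1 (u : R) : u <= 1 -> u < 1 \/ u = 1.
  by rewrite le_eqVlt => /predU1P[->|]; [right|left].
have hhD (y : dvec) s : `|y| <= 1 -> h (qD y, s) = hD (y, s).
  move=> y1; rewrite /h /=; have := rP (qD y); case: (r (qD y)) => [y'|T] [u1 E].
    have [l|l] := lt1 _ u1; first by rewrite (iD _ _ l y1 E).
    have [l'|l'] := lt1 _ y1; first by rewrite (iD _ _ l' u1 (esym E)).
    have [E1 n1] := hDE _ l; have [E2 n2] := hDE _ l'.
    by rewrite !hDb//; apply: hSE; rewrite // -E1 -E2.
  have [l|l] := lt1 _ y1; first by have /esym := E => /DS []//.
  by have [E1 n1] := hDE _ l; rewrite hDb//; apply: hSE; rewrite // -E1.
have hhS T s : `|T| <= 1 -> h (qS T, s) = hS (T, s).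
  move=> T1; rewrite /h /=; have := rP (qS T); case: (r (qS T)) => [y|T'] [u1 E]; last exact: hSE.
  have [l|l] := lt1 _ u1; first by have := E => /DS []//.
  by have [E1 n1] := hDE _ l; rewrite hDb//; apply: hSE; rewrite // -E1.
exists h; split=> //.
have hQI : hausdorff_space (Q * I)%type.
  apply: hausdorff_prod => //.
  apply: (@hausdorff_inj _ _ (fun t : I => set_val t : R)).
  - exact: unit_interval_val_continuous.
  - exact: val_inj.
  - exact: norm_hausdorff.
have cK k : compact [set z : 'rV[R]_k * I | `|z.1| <= 1].
  rewrite (_ : [set _ | _] = [set T | `|T| <= 1] `*` setT).
    by apply: compact_setX; [exact: compact_cube|exact: compact_unit_interval].
  by apply/seteqP; split=> z //= [].
have cq k (q : 'rV[R]_k -> Q) : cont_on [set T | `|T| <= 1] q ->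
    cont_on [set z : 'rV[R]_k * I | `|z.1| <= 1] (fun z => (q z.1, z.2)).
  move=> cq; apply: con_pair; last by apply: con_snd; exact: con_id.
  apply: (@cont_on_comp _ _ _ _ [set T | `|T| <= 1] (fun z => z.1) q) => //.
  by apply: con_fst; exact: con_id.
apply: (@cont_onT _ _ (((fun z => (qD z.1, z.2)) @` [set z : dvec * I | `|z.1| <= 1]) `|`
   ((fun z => (qS z.1, z.2)) @` [set z : svec * I | `|z.1| <= 1]))).
  apply/seteqP; split=> // -[x s] _; have [[y y1 E]|[T T1 E]] := sur x.
    by left; exists (y, s) => //=; rewrite E.
  by right; exists (T, s) => //=; rewrite E.
apply: con_closedU.
- apply: closed_chart_image => //; exact: cq.
- apply: closed_chart_image => //; exact: cq.
- apply: con_chart => //; first exact: cq.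
  by apply: eq_cont_on chD => -[y s] /= y1; rewrite hhD.
- apply: con_chart => //; first exact: cq.
  by apply: eq_cont_on chS => -[T s] /= T1; rewrite hhS.
Qed.

End two_cells.

(** * Changing the attaching parameter *)

Section two_cells_comparison.
Context {R : realType} {m : nat}.
Local Notation I := (unit_interval R).
Local Notation dvec := 'rV[R]_(2 + m).
Local Notation svec := 'rV[R]_m.

Lemma rsubmxZ k (y : dvec) : rsubmx (k *: y) = k *: rsubmx y.
Proof. by apply/rowP => i; rewrite !mxE. Qed.

Definition slope (e e' x : R) : R := e' + (e - e') * (2 * x - 1).

(** The inner half of the cube is stretched over the whole cell. The collar is sent into the sphere
    by the attaching formula, with [slope] moving the parameter from [e'] at norm $1/2$ to [e] at
    norm 1. *)
Definition cells_map (e e' : R) (Q Q' : Type) (qD : dvec -> Q) (qS : svec -> Q)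
    (qD' : dvec -> Q') (qS' : svec -> Q') (f : Q -> Q') : Prop :=
  [/\ forall y, `|y| <= 2^-1 -> f (qD y) = qD' (2 *: y),
      forall y, 2^-1 <= `|y| <= 1 -> f (qD y) = qS' ((slope e e' `|y| / `|y|) *: rsubmx y) &
      forall T, `|T| <= 1 -> f (qS T) = qS' T].

Lemma con_cube_fst k (X : topologicalType) : cont_on setT (fun z : 'rV[R]_k * X => `|z.1|).
Proof. by apply: con_norm; apply: con_fst; exact: con_id. Qed.

Lemma closed_cylinder k (X : topologicalType) : closed [set z : 'rV[R]_k * X | `|z.1| <= 1].
Proof.
apply: (@preimage_closed _ _ (fun z : 'rV[R]_k * X => `|z.1|) [set t | t <= 1]); last exact: closed_le.
by move=> z _; move: z; apply: (@cont_onT _ _ setT) => //; exact: con_cube_fst.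
Qed.

Lemma convex_unit (e e' t : R) : 0 <= e <= 1 -> 0 <= e' <= 1 -> 0 <= t <= 1 ->
  `|e + (e' - e) * t| <= 1.
Proof.
move=> /andP[e0 e1] /andP[e0' e1'] /andP[t0 t1].
have E : e + (e' - e) * t = e * (1 - t) + e' * t by ring.
have h0 : 0 <= e * (1 - t) by rewrite mulr_ge0// subr_ge0.
have h1 : 0 <= e' * t by rewrite mulr_ge0.
have h2 : e * (1 - t) <= 1 - t by rewrite ler_piMl// subr_ge0.
have h3 : e' * t <= t by rewrite ler_piMl.
by rewrite ger0_norm E; lra.
Qed.

Lemma slope_unit e e' x : 0 <= e <= 1 -> 0 <= e' <= 1 -> 2^-1 <= x <= 1 ->
  `|slope e e' x| <= 1.
Proof. by move=> h h' x1; apply: convex_unit => //; apply/andP; split; lra. Qed.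

Lemma cells_map_exists (e e' : R) (Q Q' : topologicalType) (qD : dvec -> Q) (qS : svec -> Q)
    (qD' : dvec -> Q') (qS' : svec -> Q') : 0 <= e <= 1 -> 0 <= e' <= 1 ->
  two_cells e qD qS -> two_cells e' qD' qS' ->
  exists2 f : Q -> Q', continuous f & cells_map e e' qD qS qD' qS' f.
Proof.
move=> e01 e01' c c'.
pose c0 (z : dvec * I) : R := `|z.1| - 2^-1.
pose f1 (z : dvec * I) := qD' (2 *: z.1).
pose f2 (z : dvec * I) := qS' ((slope e e' `|z.1| / `|z.1|) *: rsubmx z.1).
pose hD (z : dvec * I) := if c0 z <= 0 then f1 z else f2 z.
pose hS (z : svec * I) := qS' z.1.
have E12 z : `|z.1| <= 1 -> c0 z = 0 -> f1 z = f2 z.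
  rewrite /c0 /f1 /f2 => _ /eqP; rewrite subr_eq0 => /eqP h.
  have -> : qD' (2 *: z.1) = qS' (e' *: rsubmx (2 *: z.1)).
    by apply: (cells_bd c'); rewrite normrZ h ger0_norm ?divff ?pnatr_eq0.
  by rewrite rsubmxZ scalerA h; congr (qS' (_ *: _)); rewrite /slope invrK; lra.
have chD : cont_on [set z : dvec * I | `|z.1| <= 1] hD.
  apply: con_if E12 => //.
  - exact: closed_cylinder.
  - by apply: con_D; [exact: con_cube_fst|exact: con_cst].
  - apply: (@cont_on_comp _ _ _ _ [set y | `|y| <= 1] (fun z : dvec * I => 2 *: z.1) qD').
    + by apply: con_scale; [exact: con_cst|apply: con_fst; exact: con_id].
    + exact: cells_conD c'.
    + by move=> z [/= _]; rewrite /c0 normrZ ger0_norm//; lra.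
  - set B := _ `&` _.
    have cn : cont_on B (fun z => `|z.1|) by apply: con_norm; apply: con_fst; exact: con_id.
    apply: (@cont_on_comp _ _ _ _ [set T | `|T| <= 1] (fun z : dvec * I => (slope e e' `|z.1| / `|z.1|) *: rsubmx z.1) qS').
    + apply: con_scale; last by apply: con_rsubmx; apply: con_fst; exact: con_id.
      apply: con_M.
        apply: con_D; first exact: con_cst.
        apply: con_M; first exact: con_cst.
        by apply: con_D; [apply: con_M => //; exact: con_cst|exact: con_cst].
      by apply: con_V => // z [_ /=]; rewrite /c0; lra.
    + exact: cells_conS c'.
    + move=> z [/= z1]; rewrite /c0 => z2; apply: le_trans (norm_scale_rsubmx _ _) _.
      by apply: slope_unit => //; apply/andP; split; lra.
have chS : cont_on [set z : svec * I | `|z.1| <= 1] hS.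
  apply: (@cont_on_comp _ _ _ _ [set T | `|T| <= 1] (fun z : svec * I => z.1) qS') => //.
    by apply: con_fst; exact: con_id.
  exact: cells_conS c'.
have [|y s y1|h [ch hhD hhS]] := cells_glue e01 c chD chS.
- move=> T T' s T1 T1'; rewrite /hS; apply/(cells_injS c'); rewrite ?T1 ?T1'//; by right.
- rewrite /hD /hS /c0 /f2 /= y1 ifF; last by apply/negbTE; rewrite -ltNge; lra.
  by congr (qS' (_ *: _)); rewrite /slope; lra.
exists (fun x => h (x, I0)).
  apply: (@cont_onT _ _ setT) => //; apply: con_comp ch _.
  by apply: con_pair; [exact: con_id|exact: con_cst].
split=> [y y1|y /andP[y0 y1]|T T1]; last by rewrite hhS.
  by rewrite hhD ?/hD ?/c0 /= ?subr_le0 ?y1//; lra.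
rewrite hhD// /hD; case: ifP => // h0.
have E0 : c0 (y, I0) = 0 by apply/eqP; rewrite eq_le h0 /c0 /= subr_ge0 y0.
exact: (E12 (y, I0)).
Qed.

(** In the composite the cell occupies the inner quarter of the cube, and the collar parameter goes
    from [e] to [e'] and back to [e]. The homotopy flattens this excursion while the cell, of radius
    [cs s], grows to fill the cube. *)
Lemma cells_homotopic (e e' : R) (Q Q' : topologicalType) (qD : dvec -> Q) (qS : svec -> Q)
    (qD' : dvec -> Q') (qS' : svec -> Q') f g : 0 <= e <= 1 -> 0 <= e' <= 1 ->
  two_cells e qD qS -> cells_map e e' qD qS qD' qS' f -> cells_map e' e qD' qS' qD qS g ->
  homotopic R (g \o f) id.
Proof.
move=> e01 e01' c [f1 f2 f3] [g1 g2 g3].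
pose cs (s : I) : R := 4^-1 + 3 / 4 * set_val s.
(* At [s = 0] it rises from 0 at $1/4$ to 1 at $1/2$ and falls to 0 at 1, which is the path of the
   composite. Lowering it by [3 * s] keeps it 0 at the moving inner radius, because
   [4 * cs s - 1 = 3 * s]. *)
pose tent (s : I) (x : R) : R := Num.max 0 (Num.min (4 * x - 1) (2 - 2 * x) - 3 * set_val s).
pose mu (s : I) (x : R) : R := e + (e' - e) * tent s x.
pose c0 (z : dvec * I) : R := `|z.1| - cs z.2.
pose h1 (z : dvec * I) := qD ((cs z.2)^-1 *: z.1).
pose h2 (z : dvec * I) := qS ((mu z.2 `|z.1| / `|z.1|) *: rsubmx z.1).
pose hD (z : dvec * I) := if c0 z <= 0 then h1 z else h2 z.
pose hS (z : svec * I) := qS z.1.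
have cs4 s : 4^-1 <= cs s <= 1 by have /andP[s0 s1] := unit_intervalP s; rewrite /cs; apply/andP; split; lra.
have tent0 s x : x = cs s \/ x = 1 -> tent s x = 0.
  have /andP[s0 s1] := unit_intervalP s.
  move=> h; rewrite /tent max_l// subr_le0 ge_min; apply/orP; case: h => ->.
    by left; rewrite /cs; lra.
  by right; lra.
have tent1 s x : 0 <= tent s x <= 1.
  have /andP[s0 s1] := unit_intervalP s.
  rewrite /tent le_max lexx /= ge_max ler01 lerBlDr ge_min.
  by case: (leP x 2^-1) => hx; apply/orP; [left|right]; lra.
have E12 z : `|z.1| <= 1 -> c0 z = 0 -> h1 z = h2 z.
  rewrite /c0 /h1 /h2 => _ /eqP; rewrite subr_eq0 => /eqP h.
  have /andP[k0 k1] := cs4 z.2; have n0 : cs z.2 != 0 by lra.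
  have -> : qD ((cs z.2)^-1 *: z.1) = qS (e *: rsubmx ((cs z.2)^-1 *: z.1)).
    by apply: (cells_bd c); rewrite normrZ h normfV ger0_norm ?mulVf//; lra.
  rewrite rsubmxZ scalerA; congr (qS (_ *: _)).
  by rewrite /mu tent0 ?h ?mulr0 ?addr0//; left.
have chD : cont_on [set z : dvec * I | `|z.1| <= 1] hD.
  have ccs B : cont_on B (fun z : dvec * I => cs z.2).
    apply: con_D; first exact: con_cst.
    apply: con_M; first exact: con_cst.
    by apply: con_comp (@unit_interval_val_continuous R) _; apply: con_snd; exact: con_id.
  apply: con_if E12 => //.
  - exact: closed_cylinder.
  - by apply: con_D; [exact: con_cube_fst|apply: con_N; exact: ccs].
  - apply: (@cont_on_comp _ _ _ _ [set y | `|y| <= 1] (fun z : dvec * I => (cs z.2)^-1 *: z.1) qD).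
    + apply: con_scale; last by apply: con_fst; exact: con_id.
      by apply: con_V => // z _; have /andP[] := cs4 z.2; lra.
    + exact: cells_conD c.
    + move=> z [/= _]; rewrite /c0 subr_le0 => h; have /andP[k0 k1] := cs4 z.2.
      have k : 0 < cs z.2 by lra.
      by rewrite normrZ normfV (gtr0_norm k) mulrC ler_pdivrMr// mul1r.
  - set B := _ `&` _.
    have cn : cont_on B (fun z => `|z.1|) by apply: con_norm; apply: con_fst; exact: con_id.
    apply: (@cont_on_comp _ _ _ _ [set T | `|T| <= 1] (fun z : dvec * I => (mu z.2 `|z.1| / `|z.1|) *: rsubmx z.1) qS).
    + apply: con_scale; last by apply: con_rsubmx; apply: con_fst; exact: con_id.
      apply: con_M; last by apply: con_V => // z [_ /=]; rewrite /c0; have /andP[] := cs4 z.2; lra.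
      apply: con_D; first exact: con_cst.
      apply: con_M; first exact: con_cst.
      apply: con_max; first exact: con_cst.
      apply: con_D; last first.
        apply: con_N; apply: con_M; first exact: con_cst.
        by apply: con_comp (@unit_interval_val_continuous R) _; apply: con_snd; exact: con_id.
      apply: con_min.
        by apply: con_D; [apply: con_M => //; exact: con_cst|exact: con_cst].
      apply: con_D; first exact: con_cst.
      by apply: con_N; apply: con_M => //; exact: con_cst.
    + exact: cells_conS c.
    + move=> z [/= z1 _]; apply: le_trans (norm_scale_rsubmx _ _) _.
      exact: convex_unit.
have chS : cont_on [set z : svec * I | `|z.1| <= 1] hS.
  apply: (@cont_on_comp _ _ _ _ [set T | `|T| <= 1] (fun z : svec * I => z.1) qS) => //.
    by apply: con_fst; exact: con_id.
  exact: cells_conS c.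
have [|y s y1|h [ch hhD hhS]] := cells_glue e01 c chD chS.
- move=> T T' s T1 T1'; rewrite /hS; apply/(cells_injS c); rewrite ?T1 ?T1'//; by right.
- have mu1 : mu s 1 = e by rewrite /mu tent0 ?mulr0 ?addr0//; right.
  case: (leP (c0 (y, s)) 0) => h0.
    have [k0 k1] := andP (cs4 s).
    have E0 : c0 (y, s) = 0 by apply/eqP; rewrite eq_le h0 /c0 /= y1 subr_ge0.
    by rewrite /hD h0 E12 ?/= ?y1// /h2 /= y1 mu1 divr1.
  by rewrite /hD leNgt h0 /= /h2 /= y1 mu1 divr1.
exists h; split=> // x; (have [[y y1 <-]|[T T1 <-]] := cells_surj c x; last by rewrite hhS//= ?f3// ?g3//).
- have c_0 : cs I0 = 4^-1 by rewrite /cs set_val_I0 mulr0 addr0.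
  have tt : tent I0 `|y| = Num.max 0 (Num.min (4 * `|y| - 1) (2 - 2 * `|y|)).
    by rewrite /tent set_val_I0 mulr0 subr0.
  have n2 : `|2 *: y| = 2 * `|y| by rewrite normrZ ger0_norm.
  rewrite hhD//= /hD /c0 /h1 /h2 /= c_0.
  case: (leP `|y| 2^-1) => hy.
    rewrite f1//; case: (leP (`|y| - 4^-1) 0) => h0.
      rewrite g1 ?n2; last by lra.
      by rewrite scalerA invrK; congr (qD (_ *: _)); lra.
    rewrite g2 ?n2; last by apply/andP; split; lra.
    rewrite rsubmxZ scalerA; congr (qS (_ *: _)).
    rewrite /mu tt min_l ?max_r; [|lra..].
    rewrite /slope; have y0 : `|y| != 0 by lra.
    by field.
  rewrite f2 ?(ltW hy)//.
  have s1 : `|slope e e' `|y| | <= 1 by apply: slope_unit => //; rewrite (ltW hy).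
  rewrite g3; last exact: le_trans (norm_scale_rsubmx _ _) s1.
  rewrite ifF; last by apply/negbTE; rewrite -ltNge; lra.
  congr (qS ((_ / _) *: _)); rewrite /mu tt min_r ?max_r; [|lra..].
  by rewrite /slope; ring.
- rewrite hhD//= /hD /c0 /h1 /=.
  have -> : cs I1 = 1 by rewrite /cs set_val_I1; lra.
  by rewrite subr_le0 y1 invr1 scale1r.
Qed.

Theorem two_cells_homotopy_equivalent (e e' : R) (Q Q' : topologicalType)
    (qD : dvec -> Q) (qS : svec -> Q) (qD' : dvec -> Q') (qS' : svec -> Q') :
  0 <= e <= 1 -> 0 <= e' <= 1 -> two_cells e qD qS -> two_cells e' qD' qS' ->
  homotopy_equivalent R Q Q'.
Proof.
move=> e01 e01' c c'.
have [f cf fP] := cells_map_exists e01 e01' c c'.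
have [g cg gP] := cells_map_exists e01' e01 c' c.
exists f, g; split=> //; first exact: cells_homotopic c fP gP.
exact: cells_homotopic c' gP fP.
Qed.

End two_cells_comparison.

(** * Odd $n$: the quotient as a sphere with one cell attached *)

Section projective_cells.
Context {R : realType} (N : nat) (oN : odd N).
Local Open Scope complex_scope.
Local Notation A := (@CP_sub R N.+2 N).
Local Notation m := (N.+1).*2.
Local Notation dvec := 'rV[R]_(2 + m).
Local Notation svec := 'rV[R]_m.
Implicit Types (y : dvec) (T : svec).

(** The two left coordinates [v] run over the 2-cell of $\mathbb CP^1$ through
    $(w_0:w_1)=(v:1-|v|)$, with $|v|=1$ going to the point $(1:0)$; the right block is the fibre.
    [fibre_vec] is the fibre over $(1:0)$. *)
Definition disc_vec y : 'rV[R[i]^o]_N.+3 :=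
  tvec 0 N 0 (cplx (lsubmx y) 0) (1 - `|lsubmx y|)%:C (cplx (rsubmx y)) (1 - `|rsubmx y|).
Definition fibre_vec T : 'rV[R[i]^o]_N.+3 := tvec 0 N 0 1 0 (cplx T) (1 - `|T|).
Definition disc_chart y : collapse A := cpi A (mkCP (disc_vec y)).
Definition fibre_chart T : collapse A := cpi A (mkCP (fibre_vec T)).

Let oM : ~~ odd (N.+1 - 0). Proof. by rewrite subn0 /= oN. Qed.
Let p0 : (0 <= N)%N. Proof. by []. Qed.

Lemma fibre_nonzero T : 1 - `|T| != 0 \/ exists2 l, (l < N.+1 - 0)%N & cplx T l != 0.
Proof.
have [T1|T1] := eqVneq `|T| 1; last by left; rewrite subr_eq0 eq_sym.
by right; rewrite subn0; apply: cplx_neq0; rewrite -normr_gt0 T1.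
Qed.

Lemma disc_nonzero (v : 'rV[R]_2) : (cplx v 0 != 0) || ((1 - `|v|)%:C != 0 :> R[i]).
Proof.
have [v1|v1] := eqVneq `|v| 1.
  have [|l l1 h] := @cplx_neq0 R 1 v; first by rewrite -normr_gt0 v1.
  by case: l l1 h => // _ ->.
by apply/orP; right; rewrite eq_complex /= negb_and subr_eq0 eq_sym v1.
Qed.

Lemma disc_vec_neq0 y : disc_vec y != 0.
Proof. apply: tvec_neq0 => //; [exact: disc_nonzero|exact: fibre_nonzero]. Qed.

Lemma fibre_vec_neq0 T : fibre_vec T != 0.
Proof. by apply: tvec_neq0 => //; [rewrite oner_neq0|exact: fibre_nonzero]. Qed.

Lemma disc_sub y : A (mkCP (disc_vec y)) <-> `|rsubmx y| = 1.
Proof.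
rewrite CP_sub_tvec ?disc_vec_neq0//; split=> [[h|[/eqP h1 /eqP h2]]|->]; first by lra.
  by have := disc_nonzero (lsubmx y); rewrite h1 h2.
by left; rewrite subrr.
Qed.

Lemma fibre_sub T : A (mkCP (fibre_vec T)) <-> `|T| = 1.
Proof.
rewrite CP_sub_tvec ?fibre_vec_neq0//; split=> [[h|[/eqP h1 _]]|->]; first by lra.
  by move: h1; rewrite oner_eq0.
by left; rewrite subrr.
Qed.

Lemma tvec_rescale_fibre (c : R[i]) (r : R) z0 w0 w1 b : c != 0 -> r != 0 ->
  mkCP (tvec 0 N 0 (c * w0) (c * w1) (fun l => r%:C * b l) r) = mkCP (tvec 0 N z0 w0 w1 b 1).
Proof.
move=> c0 r0; have rC : r%:C != 0 :> R[i] by rewrite eq_complex /= negb_and r0.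
rewrite -(tvec_rescale _ _ _ _ _ _ r0) -[RHS](mkCPZ _ (mulf_neq0 c0 rC)).
have rr : r%:C * r^-1%:C = 1 :> R[i] by rewrite -rmorphM /= divff.
have E w : c * r%:C * (r^-1%:C * w) = c * w by rewrite mulrA -(mulrA c) rr mulr1.
by rewrite -tvecZ !E; congr mkCP.
Qed.

(** Either the fibre coordinate is on the boundary and both sides are collapsed, or $|v|=1$ and
    $w_1=0$. In the latter case [tvecZ] divides out $w_0$ without moving the fibre coordinate,
    whence parameter 1. *)
Lemma disc_fibre_bd y : `|y| = 1 -> disc_chart y = fibre_chart (1 *: rsubmx y).
Proof.
rewrite scale1r norm_row_blocks => y1; apply/cpi_eqP.
have [T1|T1] := eqVneq `|rsubmx y| 1; first by right; rewrite disc_sub fibre_sub.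
have v1 : `|lsubmx y| = 1.
  by move: y1; rewrite /Num.max; case: ifP => // _ E; rewrite E eqxx in T1.
left; have := disc_nonzero (lsubmx y); rewrite v1 subrr eqxx orbF => v0.
rewrite /fibre_vec -[RHS](mkCPZ _ v0) -tvecZ !mulr0 mulr1.
by rewrite /disc_vec v1 subrr.
Qed.

Lemma disc_inj y y' : `|y| < 1 -> `|y'| <= 1 -> disc_chart y = disc_chart y' -> y = y'.
Proof.
move=> y1 y1'; have T1 := le_lt_trans (norm_rsubmx y) y1; have v1 := le_lt_trans (norm_lsubmx y) y1.
have T1' := le_trans (norm_rsubmx y') y1'; have v1' := le_trans (norm_lsubmx y') y1'.
move=> /cpi_eqP[E|[/disc_sub h _]]; last by rewrite h ltxx in T1.
have n1 : `|rsubmx y'| < 1.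
  rewrite lt_neqAle T1' andbT; apply/eqP => /disc_sub; rewrite -E => /disc_sub h.
  by rewrite h ltxx in T1.
move/(mkCP_eqP (disc_vec_neq0 y) (disc_vec_neq0 y')) : E => [c c0 E].
have r0 : 1 - `|rsubmx y| != 0 by rewrite subr_eq0 gt_eqF.
have r0' : 1 - `|rsubmx y'| != 0 by rewrite subr_eq0 gt_eqF.
have [_ e0 e1 ea] := tvec_inj p0 oM c0 r0 r0' (disc_nonzero _) E.
have ET : rsubmx y = rsubmx y'.
  apply: radial_inj => //; apply: cplx_inj => l lN; rewrite !cplxZ; apply: ea.
  by rewrite subn0.
have rC : (1 - `|rsubmx y'|)%:C != 0 :> R[i] by rewrite eq_complex /= negb_and r0'.
have {}e0 : cplx (lsubmx y') 0 = c * cplx (lsubmx y) 0.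
  by apply: (mulfI rC); rewrite e0 ET mulrCA.
have {}e1 : (1 - `|lsubmx y'|)%:C = c * (1 - `|lsubmx y|)%:C.
  by apply: (mulfI rC); rewrite e1 ET mulrCA.
have n2 : `|lsubmx y'| < 1.
  rewrite lt_neqAle v1' andbT; apply/eqP => h; move/eqP: e1; rewrite h subrr eq_sym.
  by rewrite mulf_eq0 (negbTE c0) eq_complex /= eqxx andbT subr_eq0 gt_eqF.
have Ev : lsubmx y = lsubmx y'.
  apply: radial_inj => //; apply: (@cplx_inj R 1) => l; rewrite ltnS leqn0 => /eqP ->.
  by rewrite !cplxZ e0 e1; ring.
by rewrite -(hsubmxK y) Ev ET hsubmxK.
Qed.

Lemma disc_fibre_neq y T : `|y| < 1 -> `|T| <= 1 -> disc_chart y <> fibre_chart T.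
Proof.
move=> y1 T1 /cpi_eqP; have yT := le_lt_trans (norm_rsubmx y) y1.
have yv := le_lt_trans (norm_lsubmx y) y1.
move=> [E|[/disc_sub h _]]; last by rewrite h ltxx in yT.
have n1 : `|T| < 1.
  rewrite lt_neqAle T1 andbT; apply/eqP => /fibre_sub; rewrite -E => /disc_sub h.
  by rewrite h ltxx in yT.
move/(mkCP_eqP (disc_vec_neq0 y) (fibre_vec_neq0 T)) : E => [c c0 E].
have r0 : 1 - `|rsubmx y| != 0 by rewrite subr_eq0 gt_eqF.
have r0' : 1 - `|T| != 0 by rewrite subr_eq0 gt_eqF.
have [_ _ + _] := tvec_inj p0 oM c0 r0 r0' (disc_nonzero _) E.
rewrite mulr0 => /esym/eqP; rewrite !mulf_eq0 (negbTE c0) !eq_complex /= !eqxx !andbT.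
by rewrite (negbTE r0) subr_eq0 gt_eqF.
Qed.

Lemma fibre_eqP T T' : `|T| <= 1 -> `|T'| <= 1 ->
  fibre_chart T = fibre_chart T' <-> T = T' \/ `|T| = 1 /\ `|T'| = 1.
Proof.
move=> T1 T1'; rewrite cpi_eqP !fibre_sub; split=> [[E|]|[->|]]; [|by right|by left|by right].
have [h|h] := eqVneq `|T| 1.
  by right; split=> //; apply/fibre_sub; rewrite -E; exact/fibre_sub.
have [h'|h'] := eqVneq `|T'| 1.
  by move/eqP: h; case; apply/fibre_sub; rewrite E; exact/fibre_sub.
left; move/(mkCP_eqP (fibre_vec_neq0 T) (fibre_vec_neq0 T')) : E => [c c0 E].
have r0 : 1 - `|T| != 0 by rewrite subr_eq0 eq_sym.
have r0' : 1 - `|T'| != 0 by rewrite subr_eq0 eq_sym.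
have [|_ _ _ ea] := tvec_inj p0 oM c0 r0 r0' _ E; first by rewrite oner_neq0.
apply: radial_inj; rewrite ?lt_neqAle ?h ?h'//; apply: cplx_inj => l lN.
by rewrite !cplxZ; apply: ea; rewrite subn0.
Qed.

Lemma projective_cells_surj x : (exists2 y, `|y| <= 1 & disc_chart y = x) \/
  (exists2 T, `|T| <= 1 & fibre_chart T = x).
Proof.
have [Ax|nAx] := pselect (A (csec x)).
  right; have n1 := @norm_const_mx1 R m isT.
  exists (const_mx 1); first by rewrite n1.
  by rewrite -[RHS]csecK; apply/cpi_eqP; right; split=> //; exact/fibre_sub.
have w := CP_sub_coords nAx; set z := repCP (csec x) in w *.
have p1 : (0 <= 1)%N by [].
have [b bE] := tvec_surj p1 w.
have [r r0 rE] := radial_surj (realv m b).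
have r0' := lt0r_neq0 r0.
have T1 : `|r *: realv m b| <= 1 by rewrite -subr_ge0 rE ltW.
have aE l : (l < N.+1 - 0)%N -> r%:C * b l = cplx (r *: realv m b) l.
  by rewrite subn0 => lN; rewrite cplxZ cplx_realv// -doubleS leq_double.
have [w1|w1] := eqVneq (co z (inord N.+2)) 0.
  right; exists (r *: realv m b) => //; rewrite /fibre_chart -[RHS]csecK; congr cpi.
  rewrite w1 eqxx orbF in w; rewrite -[RHS]repCPK -/z -bE w1.
  rewrite -(tvec_rescale_fibre _ _ _ _ (invr_neq0 w) r0') mulVf// mulr0 /fibre_vec rE.
  by congr mkCP; apply: eq_tvec => // l lN; rewrite aE.
pose u := realv 2 (fun=> co z (inord N.+1) / co z (inord N.+2)).
have [s s0 sE] := radial_surj u; have s0' := lt0r_neq0 s0.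
have cs : s%:C / co z (inord N.+2) != 0 by rewrite mulf_neq0 ?invr_eq0// eq_complex /= negb_and s0'.
left; exists (row_mx (s *: u) (r *: realv m b)).
  by rewrite norm_row_blocks row_mxKl row_mxKr ge_max T1 -subr_ge0 sE ltW.
rewrite /disc_chart -[RHS]csecK; congr cpi; rewrite -[RHS]repCPK -/z -bE.
rewrite -(tvec_rescale_fibre _ _ _ _ cs r0') divfK// /disc_vec row_mxKl row_mxKr rE sE.
rewrite cplxZ cplx_realv// mulrA [X in tvec _ _ _ X](mulrAC s%:C).
by congr mkCP; apply: eq_tvec => // l lN; rewrite aE.
Qed.

Theorem projective_two_cells : two_cells 1 disc_chart fibre_chart.
Proof.
split.
- exact: embeds_hausdorff (embeds_CP_collapse (CP_sub_point N.+2 N)).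
- apply: con_comp (@cpi_continuous _ _) _; apply: con_mkCP; last by move=> y _; exact: disc_vec_neq0.
  have cl := con_lsubmx (@con_id dvec [set y : dvec | `|y| <= 1]).
  have cr := con_rsubmx (@con_id dvec [set y : dvec | `|y| <= 1]).
  apply: con_tvec.
  + exact: con_cst.
  + exact: con_cplx.
  + by apply: con_real; apply: con_D; [exact: con_cst|apply: con_N; exact: con_norm].
  + by move=> l; exact: con_cplx.
  + by apply: con_D; [exact: con_cst|apply: con_N; exact: con_norm].
- apply: con_comp (@cpi_continuous _ _) _; apply: con_mkCP; last by move=> y _; exact: fibre_vec_neq0.
  apply: con_tvec; try exact: con_cst.
  + by move=> l; apply: con_cplx; exact: con_id.
  + by apply: con_D; [exact: con_cst|apply: con_N; apply: con_norm; exact: con_id].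
- exact: projective_cells_surj.
- exact: disc_fibre_bd.
- exact: disc_inj.
- exact: disc_fibre_neq.
- exact: fibre_eqP.
Qed.

End projective_cells.

(** * Spheres as cubes modulo their boundary *)

Section stereographic.
Context {R : realType} {k : nat} (s : R).
Context (s2 : s * s = 1).
Implicit Types (y : 'rV[R]_k) (x : sphere R k).

Definition sumsq y : R := \sum_i y 0 i ^+ 2.
(** Inverse stereographic projection of $y/(1-|y|)$, multiplied by $(1-|y|)^2$ to clear
    denominators; the sign [s] selects the pole to which the boundary of the cube goes. *)
Definition stereo_vec y : 'rV[R]_k.+1 := \row_j
  (if unlift ord0 j is Some i then 2 * (1 - `|y|) * y 0 i
   else s * (sumsq y - (1 - `|y|) ^+ 2)).
Definition stereo y : sphere R k := to_sphere (stereo_vec y).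
Definition denom y : R := sumsq y + (1 - `|y|) ^+ 2.

Lemma stereo_vec0 y : stereo_vec y 0 ord0 = s * (sumsq y - (1 - `|y|) ^+ 2).
Proof. by rewrite mxE unlift_none. Qed.

Lemma stereo_vecS y i : stereo_vec y 0 (lift ord0 i) = 2 * (1 - `|y|) * y 0 i.
Proof. by rewrite mxE liftK. Qed.

Lemma sumsq_ge0 y : 0 <= sumsq y.
Proof. by apply: sumr_ge0 => i _; exact: sqr_ge0. Qed.

Lemma sumsqZ (a : R) y : sumsq (a *: y) = a ^+ 2 * sumsq y.
Proof. by rewrite /sumsq mulr_sumr; apply: eq_bigr => i _; rewrite mxE exprMn. Qed.

Lemma denom_gt0 y : 0 < denom y.
Proof.
rewrite lt_neqAle addr_ge0 ?sumsq_ge0 ?sqr_ge0// andbT eq_sym /denom.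
rewrite paddr_eq0 ?sumsq_ge0 ?sqr_ge0//; apply/negP => /andP[].
rewrite psumr_eq0 => [/allP h|i _]; last exact: sqr_ge0.
have -> : y = 0.
  apply/rowP => i; rewrite mxE; apply/eqP; rewrite -sqrf_eq0.
  by apply: (implyP (h i _)) => //; rewrite mem_index_enum.
by rewrite normr0 subr0 expr1n oner_eq0.
Qed.

Lemma sqnorm_stereo y : sqnorm (stereo_vec y) = denom y ^+ 2.
Proof.
rewrite /sqnorm big_ord_recl stereo_vec0.
under eq_bigr do rewrite stereo_vecS exprMn.
rewrite -mulr_sumr -/(sumsq y) exprMn expr2 s2 /denom; ring.
Qed.

Lemma stereo_vec_neq0 y : stereo_vec y != 0.
Proof.
apply/eqP => E; have := sqnorm_stereo y; rewrite E /sqnorm big1 => [/esym/eqP|i _].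
  by rewrite sqrf_eq0 gt_eqF// denom_gt0.
by rewrite mxE expr0n.
Qed.

Lemma val_stereo y : set_val (stereo y) = (denom y)^-1 *: stereo_vec y.
Proof.
rewrite val_to_sphere ?stereo_vec_neq0// sqnorm_stereo sqrtr_sqr.
by rewrite gtr0_norm ?denom_gt0.
Qed.

Lemma con_stereo (T : topologicalType) (A : set T) (f : T -> 'rV[R]_k) :
  cont_on A f -> cont_on A (fun z => stereo (f z)).
Proof.
move=> cf; apply: con_to_sphere => [|x _]; last exact: stereo_vec_neq0.
apply: con_mx => i j; under [X in cont_on _ X]funext do rewrite mxE.
have cr : cont_on A (fun z => 1 - `|f z|).
  by apply: con_D; [exact: con_cst|apply: con_N; exact: con_norm].
case: (unlift ord0 j) => [l|].
  by apply: con_M; [apply: con_M => //; exact: con_cst|exact: con_coord].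
apply: con_M; first exact: con_cst.
apply: con_D; last by apply: con_N; exact: con_X.
by apply: con_sum => l; apply: con_X; exact: con_coord.
Qed.

Lemma stereo_bd y : `|y| = 1 ->
  set_val (stereo y) = s *: (delta_mx 0 0 : 'rV[R]_k.+1).
Proof.
move=> y1; have d := denom_gt0 y; rewrite val_stereo; apply/rowP => j; rewrite !mxE.
move: d; rewrite /denom y1 subrr expr0n /= addr0 subr0 mulr0 => d.
case: unliftP => [i ->|->]; first by rewrite mul0r !mulr0.
by rewrite !eqxx mulr1 mulrCA mulVf ?mulr1 ?gt_eqF.
Qed.

Lemma stereo_inj y y' : `|y| < 1 -> `|y'| <= 1 -> stereo y = stereo y' -> y = y'.
Proof.
move=> y1 y1' /(congr1 (fun x : sphere R k => set_val x)); rewrite !val_stereo => /rowP E.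
have {}E j : (denom y)^-1 * stereo_vec y 0 j = (denom y')^-1 * stereo_vec y' 0 j.
  by have := E j; rewrite [LHS]mxE [RHS]mxE.
have r0 : 0 < 1 - `|y| by rewrite subr_gt0.
have d := denom_gt0 y; have d' := denom_gt0 y'.
(* Up to the sign [s], the zeroth coordinate of the point is $1-2(1-|y|)^2/d$ with $d$ =
   [denom y]. *)
have E0 : (1 - `|y|) ^+ 2 / denom y = (1 - `|y'|) ^+ 2 / denom y'.
  have := E ord0; rewrite !stereo_vec0 => /(congr1 ( *%R s)).
  rewrite ![s * (_^-1 * _)]mulrCA ![s * (s * _)]mulrA s2 !mul1r.
  have e z : (denom z)^-1 * (sumsq z - (1 - `|z|) ^+ 2) = 1 - 2 * ((1 - `|z|) ^+ 2 / denom z).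
    by rewrite /denom; field; rewrite -/(denom z) gt_eqF// denom_gt0.
  by rewrite !e; lra.
have r0' : 0 < 1 - `|y'|.
  rewrite lt_neqAle subr_ge0 y1' andbT eq_sym; apply/eqP => h; move/eqP: E0.
  by rewrite h expr0n mul0r mulf_eq0 sqrf_eq0 invr_eq0 !gt_eqF.
apply: radial_inj => //; first by rewrite -subr_gt0.
apply/rowP => i; rewrite !mxE.
have := E (lift ord0 i); rewrite !stereo_vecS => Ei.
set r := 1 - `|y| in r0 E0 Ei *; set r' := 1 - `|y'| in r0' E0 Ei *.
have n0 : 2 * (r ^+ 2 / denom y) != 0 by rewrite gt_eqF// mulr_gt0// divr_gt0// exprn_gt0.
apply: (mulfI n0).
transitivity (r * r' * ((denom y)^-1 * (2 * r * y 0 i))); first by ring.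
rewrite Ei E0; ring.
Qed.

Lemma stereo_surj x : (0 < k)%N -> exists2 y, `|y| <= 1 & stereo y = x.
Proof.
move=> k0; pose p := set_val x.
have p1 : p 0 ord0 ^+ 2 + \sum_i p 0 (lift ord0 i) ^+ 2 = 1.
  by have := sphere_val_sqnorm x; rewrite /sqnorm big_ord_recl.
have S0 : 0 <= \sum_i p 0 (lift ord0 i) ^+ 2 by apply: sumr_ge0 => i _; exact: sqr_ge0.
have [E|E] := eqVneq (s * p 0 ord0) 1.
  have n1 := @norm_const_mx1 R k k0.
  exists (const_mx 1); first by rewrite n1.
  have E0 : p 0 ord0 = s by rewrite -[LHS]mul1r -s2 -mulrA E mulr1.
  apply: val_inj; rewrite -[LHS]/(set_val (stereo (const_mx 1))) stereo_bd// -[RHS]/p.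
  apply/rowP => j; rewrite !mxE; case: (unliftP ord0 j) => [i ->|->]; last by rewrite !eqxx mulr1.
  rewrite mulr0; apply/esym/eqP; rewrite -sqrf_eq0.
  have : \sum_i p 0 (lift ord0 i) ^+ 2 = 0 by move: p1; rewrite E0 expr2 s2; lra.
  move=> /eqP; rewrite psumr_eq0 => [/allP h|l _]; last exact: sqr_ge0.
  by apply: (implyP (h i _)) => //; rewrite mem_index_enum.
have lt1 : 0 < 1 - s * p 0 ord0.
  rewrite subr_gt0 lt_neqAle E /=; have h : (s * p 0 ord0) ^+ 2 <= 1 by rewrite exprMn (expr2 s) s2 mul1r; lra.
  by apply: le_trans (ler_norm _) _; rewrite -(@ler_pXn2r _ 2) ?nnegrE// expr1n real_normK ?num_real.
(* The stereographic projection of [x] from the pole, to be compressed radially into the cube. *)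
pose b : 'rV[R]_k := \row_i (p 0 (lift ord0 i) / (1 - s * p 0 ord0)).
have [r r0 rE] := radial_surj b.
exists (r *: b); first by rewrite -subr_ge0 rE ltW.
have a0 : 0 < 2 * r ^+ 2 / (1 - s * p 0 ord0) by rewrite divr_gt0// mulr_gt0// exprn_gt0.
rewrite -(to_sphereZ x a0); congr to_sphere; apply/rowP => j; rewrite [RHS]mxE -/p.
have n0 : 1 - s * p 0 ord0 != 0 by rewrite gt_eqF.
case: (unliftP ord0 j) => [i ->|->].
  by rewrite stereo_vecS rE !mxE; ring.
rewrite stereo_vec0 rE sumsqZ.
have -> : sumsq b = (1 - p 0 ord0 ^+ 2) / (1 - s * p 0 ord0) ^+ 2.
  have -> : 1 - p 0 ord0 ^+ 2 = \sum_i p 0 (lift ord0 i) ^+ 2 by lra.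
  rewrite mulr_suml; apply: eq_bigr => i _.
  by rewrite mxE exprMn exprVn.
have h : s ^+ 2 = 1 by rewrite expr2.
have -> : 1 - p 0 ord0 ^+ 2 = (1 - s * p 0 ord0) * (1 + s * p 0 ord0).
  by rewrite -[X in X - _]h; ring: h.
by field: h; exact: n0.
Qed.

End stereographic.

(** * The wedge of spheres as a cell attached by a constant map *)

Section wedge_cells.
Context {R : realType} (m : nat) (m0 : (0 < m)%N).
Local Notation dvec := 'rV[R]_(2 + m).
Local Notation svec := 'rV[R]_m.
Local Notation W := (wedge2 (sphere R m) (sphere R (2 + m))).

Definition top_chart (y : dvec) : W := winr _ (stereo 1 y).
(** At parameter 0 the attaching map is constant at the centre of the cube, so the opposite pole is
    used here to put the base point at the centre. *)
Definition bottom_chart (T : svec) : W := winl _ (stereo (-1) T).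

Let s1 : (1 : R) * 1 = 1. Proof. by rewrite mulr1. Qed.
Let sN1 : (-1 : R) * -1 = 1. Proof. by rewrite mulrNN mulr1. Qed.

Lemma stereo_bd_point k (y : 'rV[R]_k) : `|y| = 1 -> stereo 1 y = point.
Proof.
move=> y1; apply: val_inj; rewrite -[LHS]/(set_val (stereo 1 y)) stereo_bd// scale1r.
by [].
Qed.

Lemma stereo0_point k : stereo (-1) (0 : 'rV[R]_k) = point.
Proof.
rewrite -[RHS](to_sphereZ _ (ltr01 : 0 < (1 : R))) scale1r; congr to_sphere.
apply/rowP => j; rewrite /set_val /= !mxE normr0 subr0 expr1n.
have -> : sumsq (0 : 'rV[R]_k) = 0 by apply: big1 => i _; rewrite mxE expr0n.
case: unliftP => [i ->|->]; first by rewrite mxE mulr0.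
by rewrite eqxx sub0r mulrNN mulr1.
Qed.

Theorem wedge_two_cells : two_cells 0 top_chart bottom_chart.
Proof.
split.
- by apply: wedge2_hausdorff; exact: sphere_hausdorff.
- by apply: con_comp (@winr_continuous _ _) _; apply: con_stereo => //; exact: con_id.
- by apply: con_comp (@winl_continuous _ _) _; apply: con_stereo => //; exact: con_id.
- move=> x; have [[p ->]|[p ->]] := wedge2P x; [right|left].
    by have [T T1 <-] := stereo_surj sN1 p m0; exists T.
  by have [y y1 <-] := stereo_surj s1 p isT; exists y.
- move=> y y1; rewrite /top_chart /bottom_chart scale0r stereo_bd_point// stereo0_point.
  by rewrite winl_point.
- by move=> y y' y1 y1' /winr_inj; exact: stereo_inj.
- move=> y T y1 T1 E; have := winl_winr (esym E).
  have n1 := @norm_const_mx1 R (2 + m) isT.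
  rewrite -(stereo_bd_point n1) => /(stereo_inj s1 y1).
  by rewrite n1 => /(_ (lexx _)) Ey; rewrite Ey n1 ltxx in y1.
- move=> T T' T1 T1'; split=> [/winl_inj E|[->//|[n1 n1']]]; last first.
    rewrite /bottom_chart; congr winl; apply: val_inj.
    by rewrite -[LHS]/(set_val (stereo _ _)) -[RHS]/(set_val (stereo _ _)) !stereo_bd.
  have [h|h] := eqVneq `|T| 1.
    have [h'|h'] := eqVneq `|T'| 1; [by right|left].
    by apply/esym/(stereo_inj sN1 _ T1 (esym E)); rewrite lt_neqAle h'.
  by left; apply: (stereo_inj sN1 _ T1' E); rewrite lt_neqAle h.
Qed.

End wedge_cells.

Theorem odd_homotopy_equivalent (R : realType) N : odd N ->
  homotopy_equivalent R (collapse (@CP_sub R N.+2 N))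
    (wedge2 (sphere R (N.+1).*2) (sphere R (2 + (N.+1).*2))).
Proof.
move=> oN.
by apply: (two_cells_homotopy_equivalent _ _ (@projective_two_cells R N oN)
  (@wedge_two_cells R (N.+1).*2 isT)); rewrite ?lexx ?ler01.
Qed.

Theorem mainTheorem6 (R : realType) (n : nat) (hn : (3 <= n)%N) :
  let X := collapse (@CP_sub R n (n - 2)) in
  let S2 := wedge2 (sphere R (2 * n - 2)) (sphere R (2 * n)) in
  [/\ odd n -> homotopy_equivalent R X S2,
      ~~ odd n -> homotopy_equivalent R X (iter_susp R (2 * n - 4) (CP R 2)) &
      ~~ odd n -> ~ homotopy_equivalent R X S2].
Proof.
case: n hn => [|[|N]] // N0; rewrite ltnS ltnS in N0.
have -> : (N.+2 - 2 = N)%N by rewrite !subSS subn0.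
have -> : (2 * N.+2 - 2 = (N.+1).*2)%N by rewrite mul2n !doubleS !subSS subn0.
have -> : (2 * N.+2 - 4 = N.*2)%N by rewrite mul2n !doubleS !subSS subn0.
have -> : (2 * N.+2 = 2 + (N.+1).*2)%N by rewrite mul2n !doubleS.
rewrite /= negbK; split=> oN.
- exact: odd_homotopy_equivalent.
- have [f [g [cf cg fK gK]]] := @even_homeomorphism R N N0 oN.
  exact: homeo_homotopy_equivalent cf cg fK gK.
(* Conjugated by the homeomorphism, such an equivalence would factor the identity of the suspension,
   up to homotopy, through the wedge. *)
- move=> [f [g [cf cg [H [cH H0 H1]] _]]].
  have [p [q [cp cq pK qK]]] := @even_homeomorphism R N N0 oN.
  apply: (@iter_susp_CP2_not_wedge R N.*2 (f \o q) (p \o g)).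
  - by apply: (@cont_onT _ _ setT) => //; exact: con_comp cf (continuous_cont_on cq).
  - by apply: (@cont_onT _ _ setT) => //; exact: con_comp cp (continuous_cont_on cg).
  exists (fun z => p (H (q z.1, z.2))); split=> [|x|x] /=; last by rewrite H1 qK.
    apply: (@cont_onT _ _ setT) => //; apply: con_comp cp _; apply: con_comp cH _.
    apply: con_pair; last by apply: con_snd; exact: con_id.
    by apply: con_comp cq _; apply: con_fst; exact: con_id.
  by rewrite H0.
Qed.
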